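(* For $0<\varepsilon<\varepsilon_0$ and $|\sigma|<\sigma_0(\varepsilon)$ let $\omega^\sigma_\varepsilon\in W^{1,\infty}(\mathbb{T}\times[-1,1])$ be the traveling wave vorticities associated with the bifurcation branches $(f^\sigma_\varepsilon,\lambda^\sigma_\varepsilon)$ described in the context. Fix $0\le\gamma<\tfrac32$. Then for all $\epsilon>0$ there exist $\varepsilon>0$ and $\sigma>0$ such that $$\|\omega^\sigma_\varepsilon+2y\|_{H^\gamma(\mathbb{T}\times[-1,1])}<\epsilon .$$
   Context: $\mathbb{T}=\mathbb{R}/2\pi\mathbb{Z}$; $\alpha$ is fixed with $\tfrac12\le\alpha<1$; $a=\frac{1-\varepsilon}2$, $b=\frac{1+\varepsilon}2$. Profile: $\varpi:[-1,1]\to\mathbb{R}$ is the odd Lipschitz function with $\varpi(y)=-2y$ for $0\le y<a$, $\varpi(y)=-2a$ for $a\le y\le b$, $\varpi(y)=-2(y-b)-2a$ for $b<y\le1$. Spaces: $C^{1+\alpha}_{0,\mathrm{even}}$ is the space of $f\in C^{1+\alpha}(\mathbb{T}\times([0,a)\cup(b,1]))$ with $f(x,0)=f(x,1)=0$, $\int_{\mathbb{T}}f(\bar x,y)\,d\bar x=0$ and $f(x,y)=f(-x,y)$. Values at $y=a,b$ are continuous extensions. For $f\in C^{1+\alpha}_{0,\mathrm{even}}$ with $\|f\|_{C^{1+\alpha}}<\varepsilon/4$ let $\Phi_f(x,y)=(x,y+f(x,y))$ and let $\omega_f$ on $\mathbb{T}\times[0,1]$ be $-2(\Phi_f^{-1})_2(x,y)$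 for $0\le y<a+f(x,a)$, $-2a$ for $a+f(x,a)\le y\le b+f(x,b)$, and $-2((\Phi_f^{-1})_2(x,y)-b)-2a$ for $b+f(x,b)<y\le1$. Let $\Psi_f$ solve $\Delta\Psi_f=\omega_f$ in $\mathbb{T}\times[0,1]$, $\Psi_f|_{y=0}=0$, $\Psi_f|_{y=1}=-\tfrac13$, and $\overline{\Psi}_f(x,y)=\Psi_f(x,y+f(x,y))$. Linear operator: $\Psi_0'(y)=\int_0^y\varpi(\bar y)\,d\bar y-\int_0^1\int_0^{\bar y}\varpi(z)\,dz\,d\bar y-\tfrac13$ and $\mathcal{L}^\lambda h=(\lambda-\Psi_0')h-\varphi_h$ on $C^{1+\alpha}_{0,\mathrm{even}}$, where $\Delta\varphi_h=2h$ on $\mathbb{T}\times([0,a)\cup(b,1])$, $\Delta\varphi_h=0$ on $\mathbb{T}\times[a,b]$ (one Poisson problem in $\mathbb{T}\times[0,1]$ with right-hand side extended by zero), $\varphi_h|_{y=0}=\varphi_h|_{y=1}=0$. Branches: there is $\varepsilon_0>0$ such that for each $0<\varepsilon<\varepsilon_0$ there are $\lambda^\ast\in\mathbb{R}$ and $h^\ast\in C^\infty(\mathbb{T}\times([0,a]\cup[b,1]))$ spanning the one-dimensional kernel of $\mathcal{L}^{\lambda^\ast}$, with $\lambda^\ast-\Psi_0'$ having no zeros in $[0,a]\cup[b,1]$, and $\sigma_0=\sigma_0(\varepsilon)>0$ and, for $|\sigma|<\sigma_0$, solutions $(f^\sigma_\varepsilon,\lambda^\sigma_\varepsilon)\in C^{1+\alpha}_{0,\mathrm{even}}\times\mathbb{R}$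 of $\lambda f=\overline{\Psi}_f-\frac1{2\pi}\int_{\mathbb{T}}\overline{\Psi}_f(\bar x,\cdot)\,d\bar x$ in $\mathbb{T}\times([0,a)\cup(b,1])$ with $f^\sigma_\varepsilon=\sigma h^\ast+o(\sigma)$ in $C^{1+\alpha}_{0,\mathrm{even}}$ and $\lambda^\sigma_\varepsilon=\lambda^\ast+o(1)$ as $\sigma\to0$. Extend $f^\sigma_\varepsilon$ oddly in $y$ to $[-1,-b)\cup(-a,a)\cup(b,1]$. Vorticity: $\omega^\sigma_\varepsilon(x,y+f^\sigma_\varepsilon(x,y))=\varpi(y)$ for $x\in\mathbb{T}$, $y\in[-1,-b)\cup(-a,a)\cup(b,1]$; $\omega^\sigma_\varepsilon(x_1,x_2)=-2a$ for $a+f^\sigma_\varepsilon(x_1,a)\le x_2\le b+f^\sigma_\varepsilon(x_1,b)$; $\omega^\sigma_\varepsilon(x_1,x_2)=2a$ for $-b+f^\sigma_\varepsilon(x_1,-b)\le x_2\le-a+f^\sigma_\varepsilon(x_1,-a)$. The function $\omega^\sigma_\varepsilon(x_1+\lambda^\sigma_\varepsilon t,x_2)$ is a weak traveling wave solution of 2D Euler. *)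

(* Defs.v *)
(* Functions on T x I, with T = R / 2 pi Z, are functions R * R -> R that are
   2 pi-periodic in the first variable; integrals over T are taken over the
   fundamental domain [0, 2 pi]. *)
From HB Require Import structures.
From mathcomp Require Import all_boot all_order all_algebra.
From mathcomp Require Import all_classical all_reals all_analysis.

Set Implicit Arguments.
Unset Strict Implicit.
Unset Printing Implicit Defensive.

Import Order.TTheory GRing.Theory Num.Theory.
Import numFieldNormedType.Exports.

Local Open Scope classical_set_scope.
Local Open Scope ring_scope.

Section Calculus.
Variable R : realType.
Implicit Types (f g u phi eta : R * R -> R) (p q : R * R).

Definition dir (i : bool) : R * R := if i then (0, 1) else (1, 0).

Definition dx f p : R := 'D_(dir false) f p.
Definition dy f p : R := 'D_(dir true) f p.
Definition laplacian f p : R := dx (dx f) p + dy (dy f) p.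

Definition iter_partial (s : seq bool) f : R * R -> R :=
  foldr (fun i g => (fun p => 'D_(dir i) g p)) f s.

(* C^infinity on the plane: all iterated partial derivatives exist and are
   continuous. *)
Definition smooth f : Prop :=
  forall s : seq bool, continuous (iter_partial s f) /\
    forall p i, derivable (iter_partial s f) p (dir i).

Definition strip (c d : R) : set (R * R) := `[0, 2 * pi] `*` `[c, d].

Definition leb2 := (@lebesgue_measure R \x @lebesgue_measure R)%E.

Definition mean_x (F : R -> R) : R :=
  (2 * pi)^-1 * \int[@lebesgue_measure R]_(x in `[0, 2 * pi]) F x.

(* C_c^infinity(T x (c, d)) *)
Definition test_fun (c d : R) phi : Prop :=
  [/\ smooth phi,
      forall x y, phi (x + 2 * pi, y) = phi (x, y) &
      exists2 delta : R, 0 < delta &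
        forall x y, y < c + delta \/ d - delta < y -> phi (x, y) = 0].

(* Delta phi = g in T x (0, 1), with phi = c0 at y = 0 and phi = c1 at y = 1.
   The equation holds in the sense of distributions, so that right-hand sides
   jumping across y = a and y = b are covered; the boundary values are attained
   continuously. The solution is then unique on T x [0, 1]. *)
Definition poisson g (c0 c1 : R) phi : Prop :=
  [/\ forall x y, 0 <= y <= 1 -> phi (x + 2 * pi, y) = phi (x, y),
      {within [set p | 0 <= p.2 <= 1], continuous phi},
      forall x, phi (x, 0) = c0,
      forall x, phi (x, 1) = c1 &
      leb2.-integrable (strip 0 1) (EFin \o g) /\
      forall eta, test_fun 0 1 eta ->
        \int[leb2]_(p in strip 0 1) (phi p * laplacian eta p) =
        \int[leb2]_(p in strip 0 1) (g p * eta p)].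

Definition dist2 p q : R :=
  Num.sqrt ((p.1 - q.1) ^+ 2 + (p.2 - q.2) ^+ 2).

(* One-sided continuous extensions of y |-> f (x, y) at y = c. *)
Definition trace_left f (c x : R) : R := lim (f (x, y) @[y --> c^'-]).
Definition trace_right f (c x : R) : R := lim (f (x, y) @[y --> c^'+]).

End Calculus.

Arguments leb2 R : clear implicits.

(* The Sobolev-Slobodeckij norm of H^gamma(T x [-1, 1]), for 0 <= gamma < 2. *)
Section Sobolev.
Variable R : realType.
Implicit Types (u g : R * R -> R) (p q : R * R).

Definition channel : set (R * R) := strip (-1) 1.

(* The distance of T x [-1, 1], for first coordinates in [0, 2 pi]. *)
Definition distT p q : R :=
  Num.sqrt ((Num.min `|p.1 - q.1| (2 * pi - `|p.1 - q.1|)) ^+ 2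
            + (p.2 - q.2) ^+ 2).

Definition L2sq u : \bar R := (\int[leb2 R]_(p in channel) ((u p) ^+ 2)%:E)%E.

Definition gagliardo_sq (s : R) u : \bar R :=
  (\int[(leb2 R \x leb2 R)%E]_(z in channel `*` channel)
     ((u z.1 - u z.2) ^+ 2 / distT z.1 z.2 `^ (2 + 2 * s))%:E)%E.

(* 0 <= s < 1 *)
Definition slobodeckij_sq (s : R) u : \bar R :=
  (L2sq u + if s == 0%R then 0 else gagliardo_sq s u)%E.

Definition weak_partial (i : bool) u g : Prop :=
  [/\ (leb2 R).-integrable channel (EFin \o u),
      (leb2 R).-integrable channel (EFin \o g) &
      forall eta, test_fun (-1) 1 eta ->
        \int[leb2 R]_(p in channel) (u p * 'D_(dir R i) eta p) =
        - \int[leb2 R]_(p in channel) (g p * eta p)].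

(* The weak gradient is unique up to a null set, so the infimum is over at most
   one value; it is +oo if there is no weak gradient. *)
Definition weak_grad_sq (s : R) u : \bar R :=
  ereal_inf [set (slobodeckij_sq s g.1 + slobodeckij_sq s g.2)%E |
             g in [set g : (R * R -> R) * (R * R -> R) |
                   weak_partial false u g.1 /\ weak_partial true u g.2]].

Definition Hnorm_sq (gamma : R) u : \bar R :=
  if gamma < 1 then slobodeckij_sq gamma u
  else (L2sq u + weak_grad_sq (gamma - 1) u)%E.

(* +oo outside H^gamma *)
Definition Hnorm (gamma : R) u : \bar R :=
  if `[< measurable_fun channel u >] then (Hnorm_sq gamma u `^ 2^-1)%E else +oo%E.

End Sobolev.

Section Waves.
Variables (R : realType) (alpha eps : R).
Implicit Types (f h phi w : R * R -> R) (p q : R * R) (lam x y : R).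

Definition ya : R := (1 - eps) / 2.
Definition yb : R := (1 + eps) / 2.

Definition varpi_pos y : R :=
  if y < ya then - 2 * y
  else if y <= yb then - 2 * ya
  else - 2 * (y - yb) - 2 * ya.

Definition varpi y : R := if 0 <= y then varpi_pos y else - varpi_pos (- y).

Definition outer y : bool := (0 <= y < ya) || (yb < y <= 1).

(* T x ([0, a) U (b, 1]) *)
Definition Omega : set (R * R) := [set p | outer p.2].

(* T x ((0, a) U (b, 1)) *)
Definition Omega_int : set (R * R) :=
  [set p | (0 < p.2 < ya) || (yb < p.2 < 1)].

Definition sup_norm (D : set (R * R)) f : \bar R :=
  ereal_sup [set (`|f p|)%:E | p in D].

(* As functions on T x I are lifted to R x I, taking all pairs of points of
   R x I gives the same supremum as the distance of T x I. *)
Definition holder_seminorm (D : set (R * R)) f : \bar R :=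
  ereal_sup [set (`|f p - f q| / dist2 p q `^ alpha)%:E | p in D & q in D].

Definition C1alpha_norm f : \bar R :=
  (sup_norm Omega f + sup_norm Omega_int (dx f) + sup_norm Omega_int (dy f)
   + holder_seminorm Omega_int (dx f) + holder_seminorm Omega_int (dy f))%E.

(* Only the values on Omega matter. As usual, C^{1+alpha} up to the boundary
   is C^{1+alpha} in the interior with finite norm: the first derivatives then
   extend continuously. *)
Record C1alpha_0even f : Prop := {
  C1a_periodic : forall x y, outer y -> f (x + 2 * pi, y) = f (x, y);
  C1a_continuous : {within Omega, continuous f};
  C1a_derivable : forall p i, Omega_int p -> derivable f p (dir R i);
  C1a_norm : (C1alpha_norm f < +oo)%E;
  C1a_boundary0 : forall x, f (x, 0) = 0;
  C1a_boundary1 : forall x, f (x, 1) = 0;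
  C1a_mean : forall y, outer y ->
    \int[@lebesgue_measure R]_(x in `[0, 2 * pi]) f (x, y) = 0;
  C1a_even : forall x y, outer y -> f (x, y) = f (- x, y)
}.

Definition Phi f p : R * R := (p.1, p.2 + f p).

Definition Phi_inv f : R * R -> R * R := 'pinv_(fun=> 0) Omega (Phi f).

Definition omega_half f p : R :=
  if p.2 < ya + trace_left f ya p.1 then - 2 * (Phi_inv f p).2
  else if p.2 <= yb + trace_right f yb p.1 then - 2 * ya
  else - 2 * ((Phi_inv f p).2 - yb) - 2 * ya.

Definition is_Psi f (Psi : R * R -> R) : Prop :=
  poisson (omega_half f) 0 (- 3^-1) Psi.

Definition Psi_bar f (Psi : R * R -> R) p : R := Psi (Phi f p).

Definition wave_equation f lam : Prop :=
  exists2 Psi, is_Psi f Psi &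
    forall x y, outer y ->
      lam * f (x, y) =
      Psi_bar f Psi (x, y) - mean_x (fun x' => Psi_bar f Psi (x', y)).

Definition Psi0' y : R :=
  \int[@lebesgue_measure R]_(z in `[0, y]) varpi z
  - \int[@lebesgue_measure R]_(y' in `[0, 1])
      \int[@lebesgue_measure R]_(z in `[0, y']) varpi z
  - 3^-1.

Definition is_varphi h phi : Prop :=
  poisson (fun p => if outer p.2 then 2 * h p else 0) 0 0 phi.

(* L^lam h = k on Omega *)
Definition is_calL lam h (k : R * R -> R) : Prop :=
  exists2 phi, is_varphi h phi &
    forall p, Omega p -> k p = (lam - Psi0' p.2) * h p - phi p.

(* C^infinity(T x ([0, a] U [b, 1])): restrictions of smooth functions. *)
Definition smooth_closed h : Prop :=
  exists2 H, smooth H &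
    forall x y, (0 <= y <= ya) || (yb <= y <= 1) -> h (x, y) = H (x, y).

Record bifurcation_branch (lamstar : R) (hstar : R * R -> R) (sig0 : R)
    (f : R -> R * R -> R) (lam : R -> R) : Prop := {
  hstar_smooth : smooth_closed hstar;
  hstar_C1a : C1alpha_0even hstar;
  hstar_neq0 : exists2 p, Omega p & hstar p != 0;
  hstar_kernel : forall h, C1alpha_0even h ->
    (is_calL lamstar h (fun=> 0) <->
     exists c : R, forall p, Omega p -> h p = c * hstar p);
  lamstar_nozero : forall y, (0 <= y <= ya) || (yb <= y <= 1) ->
    lamstar - Psi0' y != 0;
  sig0_gt0 : 0 < sig0;
  branch_C1a : forall s, `|s| < sig0 -> C1alpha_0even (f s);
  branch_small : forall s, `|s| < sig0 ->
    (C1alpha_norm (f s) < (eps / 4)%:E)%E;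
  branch_equation : forall s, `|s| < sig0 -> wave_equation (f s) (lam s);
  (* f s = s h* + o(s) in C^{1+alpha} and lam s = lam* + o(1) as s --> 0 *)
  branch_f_asymp : forall eta : R, 0 < eta ->
    \forall s \near 0^',
      (C1alpha_norm (fun p => f s p - s * hstar p)%R <= (eta * `|s|)%:E)%E;
  branch_lam_asymp : lam s @[s --> 0^'] --> lamstar
}.

Definition odd_ext f p : R := if 0 <= p.2 then f p else - f (p.1, - p.2).

Definition outer_sym y : bool :=
  [|| -1 <= y < - yb, - ya < y < ya | yb < y <= 1].

(* w is the vorticity on T x [-1, 1] associated with f; these conditions
   determine w there. *)
Record wave_vorticity f w : Prop := {
  vorticity_outer : forall x y, outer_sym y ->
    w (x, y + odd_ext f (x, y)) = varpi y;
  vorticity_upper : forall x y,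
    ya + trace_left (odd_ext f) ya x <= y <=
      yb + trace_right (odd_ext f) yb x ->
    w (x, y) = - 2 * ya;
  vorticity_lower : forall x y,
    - yb + trace_left (odd_ext f) (- yb) x <= y <=
      - ya + trace_right (odd_ext f) (- ya) x ->
    w (x, y) = 2 * ya
}.

End Waves.

(* Main.v *)
From HB Require Import structures.
Require Import Defs.
From mathcomp Require Import all_boot all_order all_algebra.
From mathcomp Require Import all_classical all_reals all_analysis.
From mathcomp Require Import measurable_realfun.
From mathcomp Require Import ring lra.

(** The whole estimate concerns one fixed wave; the bifurcation is only used to
    supply waves whose displacement [f] is as small as desired in C^{1+alpha},
    since [f = s h* + o(s)] ([branch_small_C1alpha]).

    Extend [f] to the channel: oddly in [y], and linearly in [y] across the two
    middle layers [a <= |y| <= b], where the vorticity is constant anyway. If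
    the C^{1+alpha} norm of [f] is at most [eps / 16], the extension [fhat] has vertical slope at most 1/4, so the
    shear [y |-> y + fhat (x, y)] is bi-Lipschitz, and with [L] the second
    component of its inverse ([wave_label]) the vorticity is [varpi (L p)] on the
    whole channel ([vorticity_label]). Hence [u = varpi (L p) + 2 y], the quantity
    to be bounded, is Lipschitz with a constant that does not depend on [eps], and
    [|u| <= 3 eps], because [varpi] is within [2 eps] of [- 2 y].

    For [gamma < 1] it suffices to interpolate: increments of [u] at distance [r]
    are [O(min eps r)], and [min eps r <= eps^th * r^(1 - th)].

    For [gamma >= 1] the weak gradient [g] of [u] must be small in H^s with
    [s = gamma - 1 < 1/2]. Outside the middle layers [g = 2 Df / (1 + f_y)],
    evaluated at the label, is small and alpha-Hoelder; inside, [g = (0, 2)]. So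
    [g] is discontinuous only at the curves [|L| = 0, a, b] and at the boundary
    [|L| = 1], and of order 1 only on a set of measure [O(eps)]. Two points at
    distance [r] therefore either satisfy the Hoelder bound, whose square is
    [O(d^2 r)], [d] being the norm of [f], as [alpha >= 1/2], or both lie within
    [O(r)] of one of these curves ([label_dichotomy], [wave_g_increment]). This makes
    the mean squared increment at distance [r] of order
    [min eps r <= eps^th * r^(1 - th)]. Summed over dyadic distances against the
    kernel of the seminorm ([gagliardo_dyadic]) it gives a geometric series, which
    converges if [2 s < 1 - th]; some [th > 0] achieves this exactly when
    [s < 1/2], that is [gamma < 3/2].

    In both cases the squared norm is at most [K * eps^th] with [K] and [th > 0]
    depending on [gamma] alone ([wave_Hnorm_sq]): choose [eps], then [s]. *)

Set Implicit Arguments.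
Unset Strict Implicit.
Unset Printing Implicit Defensive.

Import Order.TTheory GRing.Theory Num.Theory.
Import numFieldNormedType.Exports.

Local Open Scope classical_set_scope.
Local Open Scope ring_scope.

(** * Lipschitz functions *)

Section PlaneLipschitz.
Variable R : realType.
Implicit Types (k : R) (U : R * R -> R).

(** The l^1 distance passes to horizontal and vertical slices with the same constant. *)
Definition lipschitz_plane k U := forall p q : R * R,
  `|U p - U q| <= k * (`|p.1 - q.1| + `|p.2 - q.2|).

(** The product sigma-algebra contains the open sets of the plane because each of
    them is a union of squares with rational centre and radius. *)
Lemma continuous_plane_measurable (f : R * R -> R) :
  continuous f -> measurable_fun setT f.
Proof.
move=> cf.
apply: (measurability _ (RGenOInfty.measurableE R)) => // _ [_ [c ->] <-].
rewrite setTI; set A := f @^-1` _.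
pose sq (q : rat * rat * rat) : set (R * R) :=
  `]ratr q.1.1 - ratr q.2, ratr q.1.1 + ratr q.2[ `*`
  `]ratr q.1.2 - ratr q.2, ratr q.1.2 + ratr q.2[.
pose B n := if @unpickle (rat * rat * rat)%type n is Some q then
  (if `[< sq q `<=` A >] then sq q else set0) else set0.
have -> : A = \bigcup_n B n.
  apply/seteqP; split=> [p Ap|p [n _]]; last first.
    by rewrite /B; case: unpickle => // q; case: ifPn => // /asboolP; apply.
  have : nbhs p A.
    by apply: cf; apply: open_nbhs_nbhs; split; [exact: interval_open|].
  move=> /nbhs_ballP[d /= d0 dA].
  have H (z : R) : exists q : rat, `|z - ratr q| < d / 4.
    have [q] := @rat_in_itvoo R (z - d / 4) (z + d / 4) ltac:(lra).
    by rewrite in_itv/= => /andP[? ?]; exists q; rewrite ltr_norml; lra.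
  have [q1 h1] := H p.1; have [q2 h2] := H p.2.
  have [r] := @rat_in_itvoo R (d / 4) (d / 2) ltac:(lra).
  rewrite in_itv/= => /andP[r1 r2].
  exists (pickle (q1, q2, r)); [exact: I|rewrite /B pickleK].
  have -> : `[< sq (q1, q2, r) `<=` A >].
    apply/asboolP => z [/=]; rewrite !in_itv/= => z1 z2; apply: dA.
    move: h1 h2; rewrite !ltr_norml => h1 h2.
    by split; rewrite /ball/= ltr_norml; lra.
  move: h1 h2; rewrite !ltr_norml => h1 h2.
  by split; rewrite /= in_itv/=; lra.
apply: bigcupT_measurable => n; rewrite /B; case: unpickle => // q.
by case: ifP => // _; apply: measurableX; exact: measurable_itv.
Qed.

Lemma lipschitz_plane_continuous k U : lipschitz_plane k U -> continuous U.
Proof.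
move=> lipU p; apply/cvgrPdist_lt => e e0.
have k0 : 0 <= k.
  have := lipU (1, 0) (0, 0); rewrite /= subrr subr0 normr1 normr0 addr0 mulr1.
  exact: le_trans.
suff : nbhs p [set q | `|U p - U q| < e] by [].
apply/nbhs_ballP; exists (e / (4 * (k + 1))) => /=.
  by rewrite divr_gt0// mulr_gt0// ltr_wpDl.
move=> q [/= h1 h2]; apply: le_lt_trans (lipU p q) _.
move: h1 h2; rewrite /ball/= !ltr_pdivlMr ?mulr_gt0// ?ltr_wpDl// => h1 h2.
by have := normr_ge0 (p.1 - q.1); have := normr_ge0 (p.2 - q.2); lra.
Qed.

Lemma lipschitz_plane_measurable k U :
  lipschitz_plane k U -> measurable_fun setT U.
Proof. by move/lipschitz_plane_continuous/continuous_plane_measurable. Qed.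
End PlaneLipschitz.

Section FTC.
Variable R : realType.
Local Notation mu := (@lebesgue_measure R).

Lemma is_derive_quot (P : R -> R) (x l : R) (h : nat -> R) :
  (forall n, h n != 0) -> h @ \oo --> (0:R) -> is_derive x 1 P l ->
  (P (x + h n) - P x) / h n @[n --> \oo] --> l.
Proof.
move=> h0 hcvg [dP <-].
have := @cvgr_dnbhsP R (fun h => h^-1 *: (P (h *: 1 + x) - P x)) 0 ('D_1 P x).
case=> /(_ dP) /(_ h (conj h0 hcvg)) + _.
apply: cvg_trans; apply: near_eq_cvg; apply: nearW => n.
by rewrite /= [_%:A]mulr1 [h n + x]addrC [RHS]mulrC.
Qed.

(** The difference quotients of [P] with step [1 / (n + 1)] are bounded by [k] and
    converge to [g] almost everywhere, so their integrals converge to that of [g].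
    Those integrals are differences of averages of [P] near [d] and near [c], which
    converge to [P d - P c]. *)
Lemma FTC_lipschitz (P g : R -> R) (k c d : R) : c < d ->
  continuous P ->
  {in `[c, d + 1] &, forall x y, `|P x - P y| <= k * `|x - y|} ->
  measurable_fun `[c, d] g ->
  {ae mu, forall x, x \in `[c, d] -> is_derive x 1 P (g x)} ->
  (\int[mu]_(x in `[c, d]) (g x)%:E = (P d - P c)%:E)%E.
Proof.
move=> cd cP lipP mg dP.
pose h n : R := n.+1%:R^-1.
have h0 n : 0 < h n by rewrite invr_gt0.
have h1 n : h n <= 1 by rewrite invf_le1// ler1n.
have hcvg : h @ \oo --> (0:R) by exact: cvg_harmonic.
pose F n x := (P (x + h n) - P x) / h n.
have lipF n x : c <= x <= d -> `|F n x| <= k.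
  move=> xcd; rewrite normrM [`|(h n)^-1|]gtr0_norm ?invr_gt0// ler_pdivrMr//.
  have := @lipP (x + h n) x; rewrite !in_itv/=.
  rewrite (_ : x + h n - x = h n); last by rewrite addrC addKr.
  by rewrite [`|h n|]gtr0_norm//; apply; have := h0 n; have := h1 n; lra.
have cF n : continuous (F n).
  move=> x; apply: cvgM; last exact: cvg_cst.
  apply: cvgB; last exact: cP.
  apply: (@continuous_comp _ _ _ (fun x => x + h n) P); last exact: cP.
  by apply: cvgD; [exact: cvg_id|exact: cvg_cst].
have mF n : measurable_fun setT (F n) by exact: continuous_measurable_fun.
have icst : mu.-integrable `[c, d] (cst k%:E).
  by apply: (@continuous_compact_integrable R (cst k)); [exact: segment_compact|apply: continuous_subspaceT => x; exact: cvg_cst].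
have mFe n : measurable_fun `[c, d] (EFin \o F n).
  by apply/measurable_EFinP; exact: measurable_funTS (mF n).
have mge : measurable_fun `[c, d] (EFin \o g) by exact/measurable_EFinP.
have [||ig _ lim1] := @dominated_convergence _ _ R mu `[c, d] (measurable_itv _)
  (fun n => EFin \o F n) (EFin \o g) (cst k%:E)
  mFe mge _ icst _.
- move: dP; apply: filterS; first exact: (ae_filter_ringOfSetsType mu).
  move=> x dPx /= xcd; apply: cvg_EFin; first exact: nearW.
  by apply: is_derive_quot => //; [move=> n; rewrite gt_eqF|exact: dPx].
- by apply: aeW => x n /=; rewrite in_itv/= lee_fin; exact: lipF.
(* The difference quotients of a primitive [Q] of [P] are the averages of [P], and
   primitives of the difference quotients of [P]. *)
have lc : c - 1 < d + 2 by lra.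
pose Q t := \int[mu]_(z in `[c - 1, t]) P z.
have dQ t : c - 1 < t < d + 2 -> is_derive t 1 Q (P t).
  move=> /andP[t1 t2].
  have [dQ Q'] := @continuous_FTC1 R P (BLeft (c - 1)) t (d + 2) t2
    ltac:(apply: continuous_compact_integrable; [exact: segment_compact|exact: continuous_subspaceT]) t1 (cP t).
  by split; [exact: dQ|rewrite -derive1E].
have dH n x : c - 1 < x < d + 1 ->
    is_derive x 1 (fun x => (Q (x + h n) - Q x) / h n) (F n x).
  move=> /andP[x1 x2].
  have dQh : is_derive (x + h n) 1 Q (P (x + h n)).
    by apply: dQ; have := h0 n; have := h1 n; lra.
  have dQ0 : is_derive x 1 Q (P x) by apply: dQ; lra.
  have dsh : is_derive x 1 (fun x => Q (x + h n)) (P (x + h n)).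
    have := @is_derive1_comp R Q (fun x => x + h n) x (P (x + h n)) 1 dQh _.
    rewrite mulr1; apply.
    by rewrite -[X in is_derive _ _ _ X]addr0; apply: (@is_deriveD _ _ _ id (cst (h n))).
  have -> : (fun x => (Q (x + h n) - Q x) / h n) =
            (h n)^-1 *: ((fun x => Q (x + h n)) - Q).
    by apply/funext => z; rewrite mulrC.
  by rewrite /F mulrC; exact: is_deriveZ.
have cH n x : c - 1 < x < d + 1 ->
    {for x, continuous (fun x => (Q (x + h n) - Q x) / h n)}.
  move=> /(dH n)[+ _] => /derivable1_diffP; exact: differentiable_continuous.
have IF n : (\int[mu]_(x in `[c, d]) (F n x)%:E =
   ((Q (d + h n) - Q d) / h n - (Q (c + h n) - Q c) / h n)%:E)%E.
  rewrite (@continuous_FTC2 R (F n) (fun x => (Q (x + h n) - Q x) / h n))//.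
  - exact: continuous_subspaceT.
  - split=> [x||].
    + by rewrite in_itv/= => xcd; have [] := dH n x ltac:(lra).
    + by apply: cvg_at_right_filter; apply: cH; lra.
    + by apply: cvg_at_left_filter; apply: cH; lra.
  - move=> x; rewrite in_itv/= derive1E => xcd.
    by have [_ ->] := dH n x ltac:(lra).
have lim2 : (\int[mu]_(x in `[c, d]) (F n x)%:E)%E @[n --> \oo] --> (P d - P c)%:E.
  under eq_fun do rewrite IF.
  apply: cvg_EFin; first exact: nearW.
  apply: cvgB; apply: is_derive_quot => //; try (by move=> n; rewrite gt_eqF); apply: dQ; lra.
exact: cvg_unique lim1 lim2.
Qed.

Lemma continuous_segment_bounded (f : R -> R) (c d : R) :
  continuous f -> exists M : R, forall x : R, c <= x <= d -> `|f x| <= M.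
Proof.
move=> cf; have cT : {within `[c, d], continuous f} by exact: continuous_subspaceT.
have /compact_bounded[M [_ HM]] := continuous_compact cT (@segment_compact _ c d).
exists (`|M| + 1) => x xcd; apply: HM; first by rewrite (le_lt_trans (ler_norm _))// ltrDl.
by exists x.
Qed.

(** The hypothesis on the end points covers both ways in which the boundary terms
    vanish: test functions that are zero there, and periodicity. *)
Lemma integral_by_parts_lipschitz (U g eta eta' : R -> R) (k c d : R) : c < d ->
  (forall x y, `|U x - U y| <= k * `|x - y|) ->
  measurable_fun setT g ->
  {ae mu, forall x, x \in `[c, d] -> is_derive x 1 U (g x)} ->
  (forall x : R, is_derive x 1 eta (eta' x)) -> continuous eta' ->
  U d * eta d = U c * eta c ->
  (\int[mu]_(x in `[c, d]) (g x * eta x + U x * eta' x)%:E = 0)%E.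
Proof.
move=> cd lipU mg dU deta ceta' Uend.
have k0 : 0 <= k by have := lipU 1 0; rewrite subr0 normr1 mulr1; exact: le_trans.
have ceta : continuous eta.
  by move=> x; have [+ _] := deta x; move/derivable1_diffP; exact: differentiable_continuous.
have cU : continuous U.
  move=> x; apply/cvgrPdist_lt => e e0; apply/nbhs_ballP.
  exists (e / (k + 1)) => /=; first by rewrite divr_gt0// ltr_wpDl.
  move=> y; rewrite /ball/= ltr_pdivlMr ?ltr_wpDl// => h.
  apply: le_lt_trans (lipU x y) _; have := normr_ge0 (x - y); lra.
have [M1 HM1] := @continuous_segment_bounded U c (d + 1) cU.
have [M2 HM2] := @continuous_segment_bounded eta c (d + 1) ceta.
have [M3 HM3] := @continuous_segment_bounded eta' c (d + 1) ceta'.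
rewrite (@FTC_lipschitz (fun x => U x * eta x) _ (M1 * M3 + M2 * k) c d)//.
- by rewrite Uend subrr.
- by move=> x; apply: cvgM; [exact: cU|exact: ceta].
- have le_eta x y : c <= x -> y <= d + 1 -> x <= y -> `|eta x - eta y| <= M3 * `|x - y|.
    move=> cx yd; rewrite le_eqVlt => /predU1P[->|xy]; first by rewrite !subrr normr0 mulr0.
    have [z] := @MVT R eta eta' x y xy (fun z _ => deta z) (continuous_subspaceT ceta).
    rewrite in_itv/= distrC => /andP[xz zy] ->; rewrite normrM [`|y - x|]distrC.
    by rewrite ler_wpM2r// HM3//; lra.
  have lipeta x y : c <= x <= d + 1 -> c <= y <= d + 1 -> `|eta x - eta y| <= M3 * `|x - y|.
    move=> hx hy; have [xy|yx] := leP x y; first by apply: le_eta => //; lra.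
    by rewrite distrC [`|x - y|]distrC; apply: le_eta => //; lra.
  move=> x y; rewrite !in_itv/= => hx hy.
  have -> : U x * eta x - U y * eta y = U x * (eta x - eta y) + eta y * (U x - U y) by ring.
  rewrite (le_trans (ler_normD _ _))// !normrM mulrDl -!mulrA lerD//.
    by rewrite ler_pM// ?HM1 ?lipeta.
  by rewrite ler_pM// HM2.
- apply: measurable_funD; apply: measurable_funM.
  + exact: measurable_funTS.
  + apply: measurable_funTS; exact: continuous_measurable_fun.
  + apply: measurable_funTS; exact: continuous_measurable_fun.
  + apply: measurable_funTS; exact: continuous_measurable_fun.
- move: dU; apply: filterS; first exact: (ae_filter_ringOfSetsType mu).
  move=> x dUx xcd; have := dUx xcd; have := deta x.
  move=> d1 d2; have := @is_deriveM _ _ U eta x 1 (g x) (eta' x) d2 d1.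
  by rewrite [_ *: _ + _]addrC [eta x *: _]mulrC.
Qed.
End FTC.

(** * Weak derivatives on the channel *)

Section Leb2.
Variable R : realType.
Local Notation mu := (@lebesgue_measure R).
Local Notation ch := (@channel R).

(** Needed for Fubini's theorem on pairs of points of the plane. *)
Lemma sigma_finite_leb2 : sigma_finite setT (leb2 R).
Proof.
have /sigma_finiteP[F [TF ndF Foo]] := sigma_finiteT mu.
exists (fun n => F n `*` F n).
  apply/seteqP; split=> // -[x y] _.
  have : [set: R] x by []. have : [set: R] y by [].
  rewrite TF => -[n _ Fy] [k _ Fx]; exists (maxn n k) => //; split => /=.
    by move: x Fx; exact/subsetPset/ndF/leq_maxr.
  by move: y Fy; exact/subsetPset/ndF/leq_maxl.
move=> k; have [mF Fk] := Foo k.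
split; first exact: measurableX.
by rewrite /leb2 product_measure1E// lte_mul_pinfty// ge0_fin_numE.
Qed.

HB.instance Definition _ := Measure.on (leb2 R).
HB.instance Definition _ := Measure_isSigmaFinite.Build _ _ _ (leb2 R) sigma_finite_leb2.

Lemma ae_mono d (T : measurableType d) (m : {measure set T -> \bar R})
    (P Q : T -> Prop) :
  (forall x, P x -> Q x) -> {ae m, forall x, P x} -> {ae m, forall x, Q x}.
Proof.
by move=> PQ; apply: filterS => //; exact: (ae_filter_ringOfSetsType m).
Qed.

(** The measures of the sections are nonnegative with integral zero. *)
Lemma ae_xsection_null (N : set (R * R)) : measurable N -> leb2 R N = 0%E ->
  {ae mu, forall x, mu (xsection N x) = 0%E}.
Proof.
move=> mN N0.
have mf := measurable_fun_xsection mu mN.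
have [+ _] := ae_eq_integral_abs mu measurableT mf.
move=> H; have : ae_eq mu setT (mu \o xsection N) (cst 0%E).
  apply: H; rewrite -[RHS]N0 /leb2 /product_measure1.
  by apply: eq_integral => x _; rewrite gee0_abs.
by apply: ae_mono => x; apply.
Qed.

Lemma ae_ysection_null (N : set (R * R)) : measurable N -> leb2 R N = 0%E ->
  {ae mu, forall y, mu (ysection N y) = 0%E}.
Proof.
move=> mN N0.
have mf := measurable_fun_ysection mu mN.
have [+ _] := ae_eq_integral_abs mu measurableT mf.
move=> H; have : ae_eq mu setT (mu \o ysection N) (cst 0%E).
  apply: H; rewrite -[RHS]N0.
  rewrite [RHS](@product_measure_unique _ _ _ _ R mu mu (mu \x^ mu)%E)//.
    by apply: eq_integral => x _; rewrite gee0_abs.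
  by move=> A B mA mB; exact: product_measure2E.
by apply: ae_mono => x; apply.
Qed.

Lemma measurable_channel : measurable (@channel R).
Proof. by apply: measurableX; exact: measurable_itv. Qed.

Lemma leb2_channel : leb2 R (@channel R) = (4 * pi)%:E.
Proof.
rewrite /leb2 /channel /strip product_measure1E; [|exact: measurable_itv..].
have p0 := pi_gt0 R.
transitivity (mu `[0%R, (2 * pi)%R]%classic * mu `[(-1)%R, 1%R]%classic)%E; first by [].
rewrite !lebesgue_measure_itv/= !lte_fin !ifT; [|lra|lra].
by rewrite -!EFinB -EFinM; congr EFin; ring.
Qed.

Lemma bounded_channel_integrable (f : R * R -> R) (M : R) :
  measurable_fun setT f -> (forall p, ch p -> `|f p| <= M) ->
  (leb2 R).-integrable ch (EFin \o f).
Proof.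
move=> mf fM; apply: measurable_bounded_integrable.
- exact: measurable_channel.
- by change (leb2 R ch < +oo)%E; rewrite leb2_channel ltry.
- exact: measurable_funTS.
- exists M; split=> [|t Mt]; first exact: num_real.
  by move=> p /fM /le_trans; apply; exact: ltW.
Qed.

Lemma continuous_channel_bounded (f : R * R -> R) : continuous f ->
  exists M : R, forall p, ch p -> `|f p| <= M.
Proof.
move=> cf.
have cK : compact (ch) by apply: compact_setX; exact: segment_compact.
have /compact_bounded[M [_ HM]] := continuous_compact (continuous_subspaceT cf) cK.
exists (`|M| + 1) => p cp; apply: HM; first by rewrite (le_lt_trans (ler_norm _))// ltrDl.
by exists p.
Qed.

Lemma is_derive_hslice (F : R * R -> R) (x y l : R) :
  is_derive (x, y) (dir R false) F l -> is_derive x 1 (fun t => F (t, y)) l.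
Proof.
have E : (fun h : R => h^-1 *: (F (h *: dir R false + (x, y)) - F (x, y))) =
  (fun h : R => h^-1 *: (F (h *: 1 + x, y) - F (x, y))).
  apply/funext => h; congr (_ *: (F _ - _)).
  by rewrite /dir -[h *: (1, 0) + (x, y)]/(h *: 1 + x, h *: 0 + y) scaler0 add0r.
by rewrite /dir => -[dF <-]; split; rewrite /derivable /derive -?E.
Qed.

Lemma is_derive_vslice (F : R * R -> R) (x y l : R) :
  is_derive (x, y) (dir R true) F l -> is_derive y 1 (fun t => F (x, t)) l.
Proof.
have E : (fun h : R => h^-1 *: (F (h *: dir R true + (x, y)) - F (x, y))) =
  (fun h : R => h^-1 *: (F (x, h *: 1 + y) - F (x, y))).
  apply/funext => h; congr (_ *: (F _ - _)).
  by rewrite /dir -[h *: (0, 1) + (x, y)]/(h *: 0 + x, h *: 1 + y) scaler0 add0r.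
by rewrite /dir => -[dF <-]; split; rewrite /derivable /derive -?E.
Qed.

Lemma continuous_pair_l (x : R) : continuous (fun y : R => (x, y)).
Proof.
move=> y; exact: (@cvg_pair _ _ _ (nbhs y) (nbhs x) (nbhs y) _ _ _ (fun=> x) id (cvg_cst x) cvg_id).
Qed.

Lemma continuous_pair_r (y : R) : continuous (fun x : R => (x, y)).
Proof.
move=> x; exact: (@cvg_pair _ _ _ (nbhs x) (nbhs x) (nbhs y) _ _ _ id (fun=> y) cvg_id (cvg_cst y)).
Qed.

Lemma lipschitz_plane_hslice k (U : R * R -> R) y : lipschitz_plane k U ->
  forall x x' : R, `|U (x, y) - U (x', y)| <= k * `|x - x'|.
Proof.
by move=> lipU x x'; have := lipU (x, y) (x', y); rewrite /= subrr normr0 addr0.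
Qed.

Lemma lipschitz_plane_vslice k (U : R * R -> R) x : lipschitz_plane k U ->
  forall y y' : R, `|U (x, y) - U (x, y')| <= k * `|y - y'|.
Proof.
by move=> lipU y y'; have := lipU (x, y) (x, y'); rewrite /= subrr normr0 add0r.
Qed.

(** Integration by parts on every line that meets [N] in a null set, which by Fubini
    is almost every line. Vertical boundary terms vanish with the test function,
    horizontal ones by periodicity. *)
Lemma weak_partial_lipschitz i (U g : R * R -> R) (k B : R) (N : set (R * R)) :
  lipschitz_plane k U ->
  (forall x y, U (x + 2 * pi, y) = U (x, y)) ->
  measurable_fun setT g -> (forall p, ch p -> `|g p| <= B) ->
  measurable N -> leb2 R N = 0%E ->
  (forall p, ch p -> ~ N p -> is_derive p (dir R i) U (g p)) ->
  weak_partial i U g.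
Proof.
move=> lipU perU mg gB mN N0 dU.
have cU := lipschitz_plane_continuous lipU.
have mU := lipschitz_plane_measurable lipU.
have [MU UM] := continuous_channel_bounded cU.
have intU := bounded_channel_integrable mU UM.
have intg := bounded_channel_integrable mg gB.
split=> // eta [smeta pereta [delta delta0 eta0]].
have [ceta deta] := smeta [::].
have [cDeta _] := smeta [:: i].
rewrite /= in ceta deta; rewrite /= in cDeta.
set De := (fun p => 'D_(dir R i) eta p) in cDeta *.
have [M1 HM1] := continuous_channel_bounded ceta.
have [M2 HM2] := continuous_channel_bounded cDeta.
have meta := continuous_plane_measurable ceta.
have mDe := continuous_plane_measurable cDeta.
have int1 : (leb2 R).-integrable ch (EFin \o (fun p => g p * eta p)).
  apply: (@bounded_channel_integrable _ (B * M1)); first exact: measurable_funM.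
  by move=> p cp; rewrite normrM ler_pM// ?gB// HM1.
have int2 : (leb2 R).-integrable ch (EFin \o (fun p => U p * De p)).
  apply: (@bounded_channel_integrable _ (MU * M2)); first exact: measurable_funM.
  by move=> p cp; rewrite normrM ler_pM// ?UM// HM2.
suff : \int[leb2 R]_(p in ch) (g p * eta p + U p * De p) = 0.
  rewrite (RintegralD _ int1 int2); last exact: measurable_channel.
  move=> /eqP.
  by rewrite addrC addr_eq0 => /eqP.
set h := fun p => g p * eta p + U p * De p.
have int3 : (leb2 R).-integrable ch (EFin \o h).
  by apply: (integrableD _ int1 int2); exact: measurable_channel.
rewrite /Rintegral integral_mkcond.
have imf : (leb2 R).-integrable setT ((EFin \o h) \_ ch).
  refine ((integrable_mkcond _ _).1 int3); exact: measurable_channel.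
have inch x y : ((x, y) \in ch) = (x \in `[0, 2 * pi]) && (y \in `[-1, 1]).
  by rewrite /channel /strip in_setX !mem_setE.
have p0 := pi_gt0 R.
have dN p : ch p -> ~ N p -> is_derive p (dir R i) U (g p) by exact: dU.
have deta' p : is_derive p (dir R i) eta (De p) by split.
suff -> : (\int[leb2 R]_x ((EFin \o h) \_ ch) x = 0)%E by [].
case: i dU @De cDeta HM2 mDe int2 @h int3 imf dN deta' => dU De cDeta HM2 mDe int2 h int3 imf dN deta'.
- rewrite /leb2 -(integral12_prod_meas1 imf).
  rewrite (@ae_eq_integral _ _ _ mu setT (cst 0%E))//; first by rewrite integral0.
    exact: measurable_fubini_F imf.
  apply: ae_mono (ae_xsection_null mN N0) => x Nx _.
  rewrite /fubini_F/=.
  have [xI|xI] := boolP (x \in `[0, 2 * pi]); last first.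
    by rewrite integral0_eq// => y _; rewrite patchE inch (negbTE xI).
  transitivity (\int[mu]_(y in `[(-1)%R, 1%R]) (h (x, y))%:E)%E.
    rewrite [RHS]integral_mkcond; apply: eq_integral => y _.
    by rewrite !patchE inch xI/= mem_setE.
  apply: (@integral_by_parts_lipschitz _ (fun y => U (x, y)) (fun y => g (x, y))
    (fun y => eta (x, y)) (fun y => De (x, y)) k).
  + by lra.
  + exact: lipschitz_plane_vslice.
  + exact: measurable_fun_pair2.
  + exists (xsection N x); split=> //; first exact: measurable_xsection.
    move=> y /= H; apply/xsectionP; apply: contrapT => nN; apply: H => yI.
    by apply: is_derive_vslice; apply: dN nN; rewrite -in_setE inch xI.
  + by move=> y; exact: is_derive_vslice.
  + move=> y; apply: (@continuous_comp _ _ _ (fun y => (x, y)) De); last exact: cDeta.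
    exact: continuous_pair_l.
  + by rewrite !eta0 ?mulr0//; [left; lra|right; lra].
- rewrite /leb2 -(integral21_prod_meas1 imf).
  rewrite (@ae_eq_integral _ _ _ mu setT (cst 0%E))//; first by rewrite integral0.
    exact: measurable_fubini_G imf.
  apply: ae_mono (ae_ysection_null mN N0) => y Ny _.
  rewrite /fubini_G/=.
  have [yI|yI] := boolP (y \in `[-1, 1]); last first.
    by rewrite integral0_eq// => x _; rewrite patchE inch (negbTE yI) andbF.
  transitivity (\int[mu]_(x in `[0%R, (2 * pi)%R]) (h (x, y))%:E)%E.
    rewrite [RHS]integral_mkcond; apply: eq_integral => x _.
    by rewrite !patchE inch yI andbT mem_setE.
  apply: (@integral_by_parts_lipschitz _ (fun x => U (x, y)) (fun x => g (x, y))
    (fun x => eta (x, y)) (fun x => De (x, y)) k).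
  + by lra.
  + exact: lipschitz_plane_hslice.
  + exact: measurable_fun_pair1.
  + exists (ysection N y); split=> //; first exact: measurable_ysection.
    move=> x /= H; apply/ysectionP; apply: contrapT => nN; apply: H => xI.
    by apply: is_derive_hslice; apply: dN nN; rewrite -in_setE inch xI.
  + by move=> x; exact: is_derive_hslice.
  + move=> x; apply: (@continuous_comp _ _ _ (fun x => (x, y)) De); last exact: cDeta.
    exact: continuous_pair_r.
  + by have := perU 0 y; have := pereta 0 y; rewrite !add0r => -> ->.
Qed.
End Leb2.

(** * Pairs of nearby points of the channel *)

Section Dyadic.
Variable R : realType.
Local Notation mu := (@lebesgue_measure R).
Local Notation ch := (@channel R).
Implicit Types (p q : R * R) (s tau : R).

Definition dyad (n : nat) : R := 2^-1 ^+ n.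

Lemma dyad_gt0 n : 0 < dyad n.
Proof. by rewrite exprn_gt0. Qed.

Lemma dyad_le1 n : dyad n <= 1.
Proof. by rewrite exprn_ile1//; lra. Qed.

Lemma dyadS n : dyad n.+1 = dyad n / 2.
Proof. by rewrite /dyad exprSr. Qed.

(** The factor 8 bounds the diameter of the channel: see [distT_le8]. *)
Lemma dyad_shell (d : R) : 0 < d -> d <= 8 ->
  exists n, 8 * dyad n.+1 < d <= 8 * dyad n.
Proof.
move=> d0 d8.
have H : exists n, 8 * dyad n < d.
  have : dyad n @[n --> \oo] --> (0 : R) by apply: cvg_expr; rewrite ger0_norm; lra.
  move=> /cvgrPdist_lt/(_ (d / 8)) []; first by rewrite divr_gt0.
  move=> N _ /(_ N (leqnn N)); rewrite sub0r normrN gtr0_norm ?dyad_gt0// => h.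
  by exists N; lra.
case: (ex_minnP H) => -[|m] mH mmin.
  by move: mH; rewrite /dyad expr0; lra.
exists m; rewrite mH/= leNgt; apply/negP => /mmin.
by rewrite ltnn.
Qed.

Lemma distT_ge0 p q : 0 <= distT p q.
Proof. exact: sqrtr_ge0. Qed.

Lemma le_distT_y p q : `|p.2 - q.2| <= distT p q.
Proof.
by rewrite /distT -sqrtr_sqr ler_sqrt ?addr_ge0 ?sqr_ge0// lerDr sqr_ge0.
Qed.

Lemma le_distT_x p q :
  `|Num.min `|p.1 - q.1| (2 * pi - `|p.1 - q.1|)| <= distT p q.
Proof.
by rewrite /distT -sqrtr_sqr ler_sqrt ?addr_ge0 ?sqr_ge0// lerDl sqr_ge0.
Qed.

Lemma channel_dx p q : ch p -> ch q -> `|p.1 - q.1| <= 2 * pi.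
Proof.
case: p q => [x y] [x' y'] [/=]; rewrite !in_itv/= => h1 _ [/=].
by rewrite !in_itv/= ler_norml; lra.
Qed.

Lemma distT_le8 p q : ch p -> ch q -> distT p q <= 8.
Proof.
move=> cp cq; have dx := channel_dx cp cq.
have p4 : pi < 4 :> R by have := @pihalf_lt2 R; lra.
have p0 := @pi_gt0 R.
have dy : `|p.2 - q.2| <= 2.
  case: p q cp cq {dx} => [x y] [x' y'] [/= _]; rewrite !in_itv/= => h1 [/= _].
  by rewrite !in_itv/= ler_norml; lra.
rewrite /distT -[leRHS]ger0_norm// -[leRHS]sqrtr_sqr ler_sqrt ?addr_ge0 ?sqr_ge0//.
set m := Num.min _ _.
have m4 : 0 <= m <= 4.
  rewrite /m le_min ge_min normr_ge0/=; have := normr_ge0 (p.1 - q.1).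
  case: (leP `|p.1 - q.1| 4) => /=; first lra.
  by move: dx; lra.
have h1 : m ^+ 2 <= 4 ^+ 2 by rewrite ler_sqr ?nnegrE; lra.
have h2 : (p.2 - q.2) ^+ 2 <= 2 ^+ 2.
  by rewrite -[leLHS]real_normK ?num_real// ler_sqr ?nnegrE.
lra.
Qed.

(** Within the channel, a ball for the distance of the cylinder is contained in
    three boxes of the plane. *)
Definition near_pairs tau : set ((R * R) * (R * R)) :=
  [set z | `|z.1.1 - z.2.1| <= tau \/ `|z.1.1 - z.2.1 - 2 * pi| <= tau \/
           `|z.1.1 - z.2.1 + 2 * pi| <= tau] `&`
  [set z | `|z.1.2 - z.2.2| <= tau].

Lemma near_pairs_sym tau p q : near_pairs tau (p, q) -> near_pairs tau (q, p).
Proof.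
rewrite /near_pairs/= => -[H h]; split; last by rewrite distrC.
case: H => [h1|[h1|h1]]; [left|right; right|right; left].
- by rewrite distrC.
- by move: h1; rewrite !ler_norml; lra.
- by move: h1; rewrite !ler_norml; lra.
Qed.

Lemma distT_near_pairs tau p q : ch p -> ch q -> distT p q <= tau ->
  near_pairs tau (p, q).
Proof.
move=> cp cq dtau; split=> /=; last exact: le_trans (le_distT_y p q) dtau.
have := le_trans (le_distT_x p q) dtau; have dx := channel_dx cp cq.
rewrite ger0_norm; last by rewrite le_min normr_ge0/= subr_ge0.
rewrite ge_min => /orP[|h]; first by left.
right; case: (leP 0 (p.1 - q.1)) => s.
  by left; move: dx h; rewrite ger0_norm// ler_norml; lra.
by right; move: dx h; rewrite ltr0_norm// ler_norml; lra.
Qed.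

Lemma mu_ball (x tau : R) : 0 <= tau -> mu [set x' | `|x - x'| <= tau] = (2 * tau)%:E.
Proof.
move=> t0; rewrite (_ : [set _ | _] = `[x - tau, x + tau]%classic).
  rewrite lebesgue_measure_itv/= lte_fin; case: ltP => h; last first.
    by congr EFin; lra.
  by rewrite -EFinB; congr EFin; lra.
by apply/seteqP; split=> y /=; rewrite in_itv/= ler_norml => ?; lra.
Qed.

Lemma near_pairs_slice tau p : 0 <= tau ->
  (leb2 R [set q | near_pairs tau (p, q)] <= (12 * tau ^+ 2)%:E)%E.
Proof.
move=> t0.
pose I (c : R) := [set x' : R | `|c - x'| <= tau].
have mI c : measurable (I c).
  rewrite (_ : I c = `[c - tau, c + tau]%classic)//.
  by apply/seteqP; split=> y /=; rewrite /I/= in_itv/= ler_norml => ?; lra.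
have -> : [set q | near_pairs tau (p, q)] =
    (I p.1 `|` (I (p.1 - 2 * pi) `|` I (p.1 + 2 * pi))) `*` I p.2.
  apply/seteqP; split=> -[x y] /= [] h1 h2; split=> //=.
    by case: h1 => [?|[?|?]]; [left|right; left|right; right] => //; rewrite /I/= addrAC.
  by case: h1 => [?|[h|h]]; [left|right; left|right; right] => //; move: h; rewrite /I/= addrAC.
have mI2 : measurable (I (p.1 - 2 * pi) `|` I (p.1 + 2 * pi)) by exact: measurableU.
have mI3 : measurable (I p.1 `|` (I (p.1 - 2 * pi) `|` I (p.1 + 2 * pi))).
  exact: measurableU.
have m3 : (mu (I p.1 `|` (I (p.1 - 2 * pi)%R `|` I (p.1 + 2 * pi)%R)) <= (6 * tau)%:E)%E.
  apply: (@le_trans _ _ (mu (I p.1) + mu (I (p.1 - 2 * pi)%R `|` I (p.1 + 2 * pi)%R))%E).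
    by apply: measureU2; [exact: mI|exact: mI2].
  apply: (@le_trans _ _ (mu (I p.1) + (mu (I (p.1 - 2 * pi)%R) + mu (I (p.1 + 2 * pi)%R)))%E).
    by apply: leeD => //; apply: measureU2; exact: mI.
  by rewrite !mu_ball// -!EFinD lee_fin; lra.
have m1 : (mu (I p.2) <= (2 * tau)%:E)%E by rewrite mu_ball.
rewrite /leb2 product_measure1E; [|exact: mI3|exact: mI].
apply: (@le_trans _ _ ((6 * tau)%:E * (2 * tau)%:E)%E).
  by apply: lee_pmul.
by rewrite -EFinM lee_fin; lra.
Qed.

Lemma measurable_near_pairs tau : measurable (near_pairs tau).
Proof.
have H (f : (R * R) * (R * R) -> R) : measurable_fun setT f ->
    measurable [set z | `|f z| <= tau].
  move=> mf; rewrite -[X in measurable X]setTI; apply: measurable_fun_le => //.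
  exact: measurableT_comp.
have mx : measurable_fun setT (fun z : (R * R) * (R * R) => z.1.1 - z.2.1).
  apply: measurable_funB.
    exact: (measurableT_comp measurable_fst measurable_fst).
  exact: (measurableT_comp measurable_fst measurable_snd).
have my : measurable_fun setT (fun z : (R * R) * (R * R) => z.1.2 - z.2.2).
  apply: measurable_funB.
    exact: (measurableT_comp measurable_snd measurable_fst).
  exact: (measurableT_comp measurable_snd measurable_snd).
apply: measurableI; last exact: H.
apply: measurableU; first exact: H.
by apply: measurableU; apply: H; [exact: measurable_funB|exact: measurable_funD].
Qed.

Section slices.
Variables (T : R * R -> R) (c tau : R).
Hypotheses (mT : measurable_fun setT T) (T0 : forall p, 0 <= T p).
Hypotheses (c0 : 0 <= c) (tau0 : 0 <= tau).
Local Notation ind := (\1_(near_pairs tau) : (R * R) * (R * R) -> R).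

Lemma measurable_near_pairs_fst :
  measurable_fun setT (fun z : (R * R) * (R * R) => c * (ind z * T z.1)).
Proof.
apply: measurable_funM => //; apply: measurable_funM.
  by apply: measurable_indic; exact: measurable_near_pairs.
exact: (measurableT_comp mT measurable_fst).
Qed.

Lemma measurable_near_pairs_snd :
  measurable_fun setT (fun z : (R * R) * (R * R) => c * (ind z * T z.2)).
Proof.
apply: measurable_funM => //; apply: measurable_funM.
  by apply: measurable_indic; exact: measurable_near_pairs.
exact: (measurableT_comp mT measurable_snd).
Qed.

Lemma indic_slice p :
  (\int[leb2 R]_q (ind (p, q))%:E <= (12 * tau ^+ 2)%:E)%E.
Proof.
have mS : measurable [set q | near_pairs tau (p, q)].
  rewrite -[X in measurable X]setTI.
  exact: (pair1_measurable p _ (measurable_near_pairs tau)).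
apply: le_trans (near_pairs_slice p tau0).
rewrite (_ : (fun q => (ind (p, q))%:E) =
             (fun q => (\1_[set q | near_pairs tau (p, q)] q)%:E)).
  by rewrite integral_indic// setIT.
by apply/funext => q; rewrite !indicE; congr ((nat_of_bool _)%:R%:E); apply/idP/idP; rewrite !inE.
Qed.

(** Fubini's theorem, integrating first in the variable on which [T] does not depend:
    its slice of the near pairs has measure at most [12 * tau ^+ 2]. *)
Lemma integral_near_pairs_fst :
  (\int[leb2 R \x leb2 R]_z (c * (ind z * T z.1))%:E <=
   (c * (12 * tau ^+ 2))%:E * \int[leb2 R]_p (T p)%:E)%E.
Proof.
have mf := measurable_near_pairs_fst.
pose F (z : (R * R) * (R * R)) := (c * (ind z * T z.1))%:E.
have mF : measurable_fun setT F by exact/measurable_EFinP.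
have F0 z : (0 <= F z)%E.
  by rewrite lee_fin mulr_ge0// mulr_ge0// indicE ler0n.
have mTE : measurable_fun setT (EFin \o T) by exact/measurable_EFinP.
have TE0 p : (0 <= (T p)%:E)%E by rewrite lee_fin.
have C0 : (0 <= (c * (12 * tau ^+ 2))%:E)%E.
  by rewrite lee_fin mulr_ge0// mulr_ge0// sqr_ge0.
have -> : (\int[leb2 R \x leb2 R]_z (c * (ind z * T z.1))%:E =
    \int[leb2 R]_p \int[leb2 R]_q F (p, q))%E by exact: (@fubini_tonelli1 _ _ _ _ R (leb2 R) (leb2 R) F mF F0).
rewrite -ge0_integralZl//.
apply: ge0_le_integral => //.
- by move=> p _; apply: integral_ge0 => q _; exact: F0.
- exact: (@measurable_fun_fubini_tonelli_F _ _ _ _ R (leb2 R) F mF F0).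
- exact: measurable_funeM.
- move=> p _;
  have -> : (\int[leb2 R]_q F (p, q) = (c * T p)%:E * \int[leb2 R]_q (ind (p, q))%:E)%E.
    rewrite -ge0_integralZl//.
    + by apply: eq_integral => q _; rewrite /F -EFinM/=; congr EFin; rewrite mulrCA mulrC.
    + apply/measurable_EFinP; apply: (@measurable_fun_pair2 _ _ _ _ _ _ ind).
      by apply: measurable_indic; exact: measurable_near_pairs.
    + by rewrite lee_fin mulr_ge0.
  apply: le_trans (lee_wpmul2l _ (indic_slice p)) _.
    by rewrite lee_fin mulr_ge0.
  by rewrite -!EFinM lee_fin mulrAC.
Qed.

Lemma integral_near_pairs_snd :
  (\int[leb2 R \x leb2 R]_z (c * (ind z * T z.2))%:E <=
   (c * (12 * tau ^+ 2))%:E * \int[leb2 R]_p (T p)%:E)%E.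
Proof.
have mf := measurable_near_pairs_snd.
pose F (z : (R * R) * (R * R)) := (c * (ind z * T z.2))%:E.
have mF : measurable_fun setT F by exact/measurable_EFinP.
have F0 z : (0 <= F z)%E.
  by rewrite lee_fin mulr_ge0// mulr_ge0// indicE ler0n.
have mTE : measurable_fun setT (EFin \o T) by exact/measurable_EFinP.
have TE0 p : (0 <= (T p)%:E)%E by rewrite lee_fin.
have C0 : (0 <= (c * (12 * tau ^+ 2))%:E)%E.
  by rewrite lee_fin mulr_ge0// mulr_ge0// sqr_ge0.
have -> : (\int[leb2 R \x leb2 R]_z (c * (ind z * T z.2))%:E =
    \int[leb2 R]_q \int[leb2 R]_p F (p, q))%E by exact: (@fubini_tonelli2 _ _ _ _ R (leb2 R) (leb2 R) F mF F0).
rewrite -ge0_integralZl//.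
apply: ge0_le_integral => //.
- by move=> p _; apply: integral_ge0 => q _; exact: F0.
- exact: (@measurable_fun_fubini_tonelli_G _ _ _ _ R (leb2 R) F mF F0).
- exact: measurable_funeM.
- move=> q _;
  have E p : ind (p, q) = ind (q, p).
    rewrite !indicE; congr (nat_of_bool _)%:R.
    by apply/idP/idP; rewrite !inE; exact: near_pairs_sym.
  have -> : (\int[leb2 R]_p F (p, q) = (c * T q)%:E * \int[leb2 R]_p (ind (q, p))%:E)%E.
    rewrite -ge0_integralZl//.
    + by apply: eq_integral => p _; rewrite /F -EFinM/= E; congr EFin; rewrite mulrCA mulrC.
    + apply/measurable_EFinP; apply: (@measurable_fun_pair2 _ _ _ _ _ _ ind).
      by apply: measurable_indic; exact: measurable_near_pairs.
    + by rewrite lee_fin mulr_ge0.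
  apply: le_trans (lee_wpmul2l _ (indic_slice q)) _.
    by rewrite lee_fin mulr_ge0.
  by rewrite -!EFinM lee_fin mulrAC.
Qed.
End slices.
End Dyadic.

(** * Dyadic bound of the Gagliardo seminorm *)

Section Gagliardo.
Variable R : realType.
Local Notation ch := (@channel R).
Implicit Types (p q : R * R) (s : R).

Lemma measurable_distT : measurable_fun setT (fun z : (R * R) * (R * R) => distT z.1 z.2).
Proof.
have mx : measurable_fun setT (fun z : (R * R) * (R * R) => `|z.1.1 - z.2.1|).
  apply: measurableT_comp => //; apply: measurable_funB.
    exact: (measurableT_comp measurable_fst measurable_fst).
  exact: (measurableT_comp measurable_fst measurable_snd).
have my : measurable_fun setT (fun z : (R * R) * (R * R) => z.1.2 - z.2.2).
  apply: measurable_funB.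
    exact: (measurableT_comp measurable_snd measurable_fst).
  exact: (measurableT_comp measurable_snd measurable_snd).
have ms : measurable_fun setT (@Num.sqrt R).
  by apply: continuous_measurable_fun; exact: sqrt_continuous.
apply: (measurableT_comp ms).
apply: measurable_funD; apply: measurable_funX => //.
by apply: measurable_minr => //; exact: measurable_funB.
Qed.

(** The value of the Gagliardo kernel at the inner radius of the [n]-th shell. *)
Definition shell_weight s n : R := ((4 * dyad R n) `^ (2 + 2 * s))^-1.

Lemma shell_weight_ge0 s n : 0 <= shell_weight s n.
Proof. by rewrite invr_ge0 powR_ge0. Qed.

Lemma shell_weight_le s n : 0 < s ->
  shell_weight s n * (12 * (8 * dyad R n) ^+ 2) <= 48 * (4 `^ s) ^+ n.
Proof.
move=> s0; have d0 := @dyad_gt0 R n.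
rewrite /shell_weight powRD; last by apply/implyP => _; rewrite gt_eqF// mulr_gt0.
have d4 : 0 <= 4 * dyad R n by rewrite mulr_ge0// ltW.
rewrite powR_mulrn// invfM mulrAC -mulrA.
have -> : ((4 * dyad R n) ^+ 2)^-1 * ((12 * (8 * dyad R n) ^+ 2) * ((4 * dyad R n) `^ (2 * s))^-1)
        = 48 * ((4 * dyad R n) `^ (2 * s))^-1.
  have ne : dyad R n != 0 by rewrite gt_eqF.
  by set z := (_ `^ _)^-1; field.
rewrite ler_wpM2l//.
have E : (4 `^ s) ^+ n = (dyad R n `^ (2 * s))^-1.
  rewrite /dyad exprVn -powR_mulrn// -powRN -powRrM -powR_mulrn ?powR_ge0//.
  have -> : 4 = 2 `^ 2%:R :> R by rewrite powR_mulrn//; ring.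
  by rewrite -[(2 `^ n%:R)^-1]powRN -!powRrM; congr powR; ring.
rewrite E lef_pV2 ?posrE ?powR_gt0 ?mulr_gt0//.
apply: ge0_ler_powR; rewrite ?nnegrE//; [|exact: ltW|lra].
by rewrite mulr_ge0// ltW.
Qed.

Lemma geometric_sum_le (x : R) n : 0 <= x < 1 -> \sum_(0 <= k < n) x ^+ k <= (1 - x)^-1.
Proof.
move=> /andP[x0 x1]; rewrite -[leRHS]mul1r ler_pdivlMr ?subr_gt0//.
rewrite big_mkord mulrC -[_ * _]opprK -mulNr opprB -subrX1 opprB.
by rewrite lerBlDr lerDl exprn_ge0.
Qed.

(** On the shell [4 * 2 ^- n < distT p q <= 8 * 2 ^- n] the kernel is at most
    [shell_weight s n], and a ball of radius [8 * 2 ^- n] has measure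
    [O(4 ^- n)], so the pairs in the shell weigh [O((4 ^ s) ^ n)] on each point. If
    increments at that distance are bounded by functions of one point with
    integral [O(b ^ n)], the shells add up to a geometric series of ratio
    [4 ^ s * b]. *)
Lemma gagliardo_dyadic s (A b : R) (g : R * R -> R) (Th : nat -> R * R -> R) :
  0 < s -> 0 <= A -> 0 <= b -> 4 `^ s * b < 1 ->
  measurable_fun setT g ->
  (forall n, measurable_fun setT (Th n)) -> (forall n p, 0 <= Th n p) ->
  (forall n p q, ch p -> ch q -> distT p q <= 8 * dyad R n ->
     (g p - g q) ^+ 2 <= Th n p + Th n q) ->
  (forall n, (\int[leb2 R]_(p in ch) (Th n p)%:E <= (A * b ^+ n)%:E)%E) ->
  (gagliardo_sq s g <= (96 * A / (1 - 4 `^ s * b))%:E)%E.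
Proof.
move=> s0 A0 b0 r1 mg mTh Th0 gTh ITh.
pose T n p := Th n p * \1_ch p.
have mT n : measurable_fun setT (T n).
  apply: measurable_funM => //; apply: measurable_indic; exact: measurable_channel.
have T0 n p : 0 <= T n p by rewrite mulr_ge0// indicE ler0n.
have IT n : (\int[leb2 R]_p (T n p)%:E <= (A * b ^+ n)%:E)%E.
  apply: le_trans (ITh n); rewrite [leRHS]integral_mkcond.
  rewrite le_eqVlt; apply/orP; left; apply/eqP; apply: eq_integral => p _.
  by rewrite patchE /T indicE; case: ifP => _; rewrite ?mulr1 ?mulr0.
pose c := shell_weight s.
have c0 n : 0 <= c n by exact: shell_weight_ge0.
pose ind n : (R * R) * (R * R) -> R := \1_(near_pairs (8 * dyad R n)).
have tau0 n : 0 <= 8 * dyad R n by rewrite mulr_ge0// ltW// dyad_gt0.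
pose F n z := (c n * (ind n z * T n z.1) + c n * (ind n z * T n z.2))%:E.
have F0 n z : (0 <= F n z)%E.
  by rewrite lee_fin addr_ge0// mulr_ge0// mulr_ge0// /ind indicE ler0n.
have mF n : measurable_fun setT (F n).
  apply/measurable_EFinP; apply: measurable_funD.
    exact: measurable_near_pairs_fst.
  exact: measurable_near_pairs_snd.
have IF n : (\int[leb2 R \x leb2 R]_z F n z <= (96 * A * (4 `^ s * b) ^+ n)%:E)%E.
  rewrite /F; under eq_integral do rewrite EFinD.
  rewrite ge0_integralD//; last 4 first.
  - by move=> z _; rewrite lee_fin mulr_ge0// mulr_ge0// /ind indicE ler0n.
  - apply/measurable_EFinP; exact: measurable_near_pairs_fst.
  - by move=> z _; rewrite lee_fin mulr_ge0// mulr_ge0// /ind indicE ler0n.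
  - apply/measurable_EFinP; exact: measurable_near_pairs_snd.
  have H : ((c n * (12 * (8 * dyad R n) ^+ 2))%:E * \int[leb2 R]_p (T n p)%:E <=
            (48 * A * (4 `^ s * b) ^+ n)%:E)%E.
    apply: le_trans (lee_wpmul2l _ (IT n)) _.
      by rewrite lee_fin mulr_ge0// mulr_ge0// sqr_ge0.
    rewrite -EFinM lee_fin.
    apply: le_trans (ler_wpM2r _ (shell_weight_le n s0)) _.
      by rewrite mulr_ge0// exprn_ge0.
    by rewrite exprMn le_eqVlt; apply/orP; left; apply/eqP; ring.
  apply: le_trans (leeD _ _) _.
  - exact: (integral_near_pairs_fst (mT n) (T0 n) (c0 n) (tau0 n)).
  - exact: (integral_near_pairs_snd (mT n) (T0 n) (c0 n) (tau0 n)).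
  apply: le_trans (leeD H H) _.
  by rewrite -EFinD lee_fin; lra.
pose G z := (((g z.1 - g z.2) ^+ 2 / distT z.1 z.2 `^ (2 + 2 * s))%:E : \bar R).
have G0 z : (0 <= G z)%E by rewrite lee_fin divr_ge0 ?sqr_ge0 ?powR_ge0.
have mG : measurable_fun setT G.
  apply/measurable_EFinP; apply: measurable_funM.
    apply: measurable_funX; apply: measurable_funB.
      exact: (measurableT_comp mg measurable_fst).
    exact: (measurableT_comp mg measurable_snd).
  rewrite (_ : (fun _ => _) = fun z : (R * R) * (R * R) => distT z.1 z.2 `^ (- (2 + 2 * s))).
    exact: (measurableT_comp (@measurable_powR R (- (2 + 2 * s))) measurable_distT).
  by apply/funext => z; rewrite powRN.
have mcc : measurable (ch `*` ch) by apply: measurableX; exact: measurable_channel.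
rewrite /gagliardo_sq.
apply: (@le_trans _ _ (\int[leb2 R \x leb2 R]_z \sum_(n <oo) F n z)%E).
  rewrite integral_mkcond; apply: ge0_le_integral => //.
  - by move=> z _; rewrite patchE; case: ifP => // _; exact: G0.
  - apply: (measurable_restrictT _ _).1; first exact: mcc. exact: measurable_funTS mG.
  - by apply: ge0_emeasurable_sum => [k x _ _|k _]; [exact: F0|exact: mF].
  - move=> [p q] _; rewrite patchE; case: ifPn => [/[!inE] -[/= cp cq]|_]; last exact: nneseries_ge0.
    have [d0|d0] := eqVneq (distT p q) 0.
      rewrite d0 powR0 ?invr0 ?mulr0; first exact: nneseries_ge0.
      by apply: lt0r_neq0; lra.
    have dgt0 : 0 < distT p q by rewrite lt_neqAle eq_sym d0 distT_ge0.
    have [n /andP[dl dr]] := dyad_shell dgt0 (distT_le8 cp cq).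
    apply: (@le_trans _ _ (F n (p, q))).
      rewrite /F lee_fin -mulrDr -mulrDr /ind indicE.
      rewrite (mem_set (distT_near_pairs cp cq dr)) mul1r /T !indicE !mem_set// !mulr1.
      rewrite mulrC ler_pM ?invr_ge0 ?powR_ge0 ?sqr_ge0//; last exact: gTh.
      rewrite /c /shell_weight lef_pV2 ?posrE ?powR_gt0//; last by rewrite mulr_gt0// dyad_gt0.
      apply: ge0_ler_powR; rewrite ?nnegrE ?distT_ge0//; first lra.
        by rewrite mulr_ge0// ltW// dyad_gt0.
      by move: dl; rewrite dyadS; lra.
    apply: le_trans (nneseries_lim_ge n.+1 _) => //.
    by rewrite big_nat_recr//= leeDr// sume_ge0.
rewrite integral_nneseries//.
apply: lime_le.
  by apply: is_cvg_nneseries => k _ _; apply: integral_ge0 => z _; exact: F0.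
apply: nearW => n; apply: (@le_trans _ _ (\sum_(0 <= k < n) (96 * A * (4 `^ s * b) ^+ k)%:E)%E).
  by apply: lee_sum => k _; exact: IF.
rewrite sumEFin lee_fin -mulr_sumr ler_wpM2l ?mulr_ge0//.
by apply: geometric_sum_le; rewrite mulr_ge0 ?powR_ge0.
Qed.
End Gagliardo.

(** * Inverse of a vertical shear *)

Section Shear.
Variable R : realType.
Local Notation mu := (@lebesgue_measure R).
Local Notation ch := (@channel R).
Implicit Types (p q v : R * R) (x y Y c tau : R).

(** The second component of the inverse of the shear [(x, y) |-> (x, y + F (x, y))];
    the first one is the identity. *)
Definition label (F : R * R -> R) (p : R * R) : R :=
  xget 0 [set y | y + F (p.1, y) = p.2].

(** Existence of the two partial derivatives would not allow [F (p.1, label F p)] to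
    be differentiated, as both coordinates move at once. *)
Definition total_derivative (F : R * R -> R) p (F1 F2 : R) :=
  forall eta : R, 0 < eta -> exists2 r : R, 0 < r &
    forall q, `|q.1 - p.1| < r -> `|q.2 - p.2| < r ->
      `|F q - F p - (F1 * (q.1 - p.1) + F2 * (q.2 - p.2))| <=
        eta * (`|q.1 - p.1| + `|q.2 - p.2|).

Variables (F : R * R -> R) (d : R).
Hypotheses (d0 : 0 <= d) (d4 : d <= 4^-1).
Hypothesis Fbound : forall p, `|F p| <= d.
Hypothesis Fx : forall x x' y, `|F (x, y) - F (x', y)| <= d * `|x - x'|.
Hypothesis Fy : forall x y y', `|F (x, y) - F (x, y')| <= 4^-1 * `|y - y'|.

(** The shear moves points by less than 1, so the intermediate value theorem applies
    on [p.2 - 1, p.2 + 1]. *)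
Lemma labelP p : label F p + F (p.1, label F p) = p.2.
Proof.
suff H : exists y, y + F (p.1, y) = p.2 by exact: (xgetPex 0 H).
pose m y := y + F (p.1, y).
have cm : continuous m.
  move=> y; apply/cvgrPdist_lt => e e0; apply/nbhs_ballP.
  exists (e / 2) => /=; first by rewrite divr_gt0.
  move=> y'; rewrite /ball/= /m => h.
  have := h; have := Fy p.1 y y'; rewrite !(ltr_norml, ler_norml).
  by lra.
have mA : m (p.2 - 1) <= p.2.
  rewrite /m; have := Fbound (p.1, p.2 - 1).
  by have := d4; rewrite ler_norml; lra.
have mB : p.2 <= m (p.2 + 1).
  rewrite /m; have := Fbound (p.1, p.2 + 1).
  by have := d4; rewrite ler_norml; lra.
have := @IVT R m (p.2 - 1) (p.2 + 1) p.2 _ (continuous_subspaceT cm).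
case; [lra| |by move=> y _ <-; exists y].
by rewrite ge_min le_max mA mB orbT.
Qed.

Lemma shear_dist x y y' :
  3 / 4 * `|y - y'| <= `|y + F (x, y) - (y' + F (x, y'))| <= 5 / 4 * `|y - y'|.
Proof.
set A := y + _ - _; have AE : A = (y - y') + (F (x, y) - F (x, y')) by rewrite /A; ring.
have h := Fy x y y'; have h1 := ler_normD (y - y') (F (x, y) - F (x, y')).
have h2 := lerB_normD (y - y') (F (x, y) - F (x, y')).
by rewrite AE; lra.
Qed.

Lemma label_shear x y : label F (x, y + F (x, y)) = y.
Proof.
set y' := label F _; have := labelP (x, y + F (x, y)); rewrite -/y'/= => E.
have := shear_dist x y' y; rewrite E subrr normr0 => /andP[h _].
have := normr_ge0 (y' - y) => h'; have /eqP : `|y' - y| = 0 by lra.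
by rewrite normr_eq0 subr_eq0 => /eqP.
Qed.

Lemma label_eqP p y : label F p = y <-> y + F (p.1, y) = p.2.
Proof.
split=> [<-|E]; first exact: labelP.
by rewrite -(label_shear p.1 y) E; case: p E.
Qed.

Lemma label_dist p q :
  `|label F p - label F q| <= 4 / 3 * (`|p.2 - q.2| + d * `|p.1 - q.1|).
Proof.
have := shear_dist p.1 (label F p) (label F q).
have := labelP p; have := labelP q.
set y := label F p; set y' := label F q => Eq Ep /andP[h _].
have := Fx p.1 q.1 y'.
have E : y + F (p.1, y) - (y' + F (p.1, y')) =
    (p.2 - q.2) - (F (p.1, y') - F (q.1, y')) by rewrite Ep -Eq; ring.
have := ler_normB (p.2 - q.2) (F (p.1, y') - F (q.1, y')).
by rewrite E in h; lra.
Qed.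

Lemma label_lipschitz : lipschitz_plane 2 (label F).
Proof.
move=> p q; apply: le_trans (label_dist p q) _.
have := normr_ge0 (p.1 - q.1); have := normr_ge0 (p.2 - q.2) => h1 h2.
by have : d * `|p.1 - q.1| <= 4^-1 * `|p.1 - q.1|; [rewrite ler_wpM2r|lra].
Qed.

Lemma label_periodic :
  (forall x y, F (x + 2 * pi, y) = F (x, y)) ->
  forall x Y, label F (x + 2 * pi, Y) = label F (x, Y).
Proof.
move=> per x Y; apply/label_eqP; rewrite /= per.
exact: (labelP (x, Y)).
Qed.

Lemma measurable_label : measurable_fun setT (label F).
Proof. exact: lipschitz_plane_measurable label_lipschitz. Qed.

Lemma measurable_label_band c tau :
  measurable [set p | `| `|label F p| - c| <= tau].
Proof.
rewrite -[X in measurable X]setTI; apply: measurable_fun_le => //.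
apply: measurableT_comp => //; apply: measurable_funB => //.
by apply: measurableT_comp => //; exact: measurable_label.
Qed.

(** The shear stretches vertical lengths by at most 5/4, and [|y|] is within
    [tau] of [c] on two intervals of length [2 tau]. *)
Lemma leb2_label_band c tau : 0 <= tau ->
  (leb2 R (ch `&` [set p | `| `|label F p| - c| <= tau]%R) <= (40 * tau)%:E)%E.
Proof.
move=> t0; set A := [set p | _].
have mA : measurable (ch `&` A).
  by apply: measurableI; [exact: measurable_channel|exact: measurable_label_band].
pose t5 := 5 / 4 * tau; have t50 : 0 <= t5 by rewrite /t5; lra.
have p0 := @pi_gt0 R; have p4 : pi < 4 :> R by have := @pihalf_lt2 R; lra.
pose B z := [set Y : R | `|z - Y| <= t5].
have mB z : measurable (B z).
  rewrite (_ : B z = `[z - t5, z + t5]%classic)//.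
  by apply/seteqP; split=> y /=; rewrite /B/= in_itv/= ler_norml => ?; lra.
have sec x : (mu (xsection (ch `&` A) x) <= (\1_(`[0, 2 * pi]) x * (5 * tau))%:E)%E.
  rewrite indicE; have [xI|xI] := boolP (x \in _); last first.
    rewrite mul0r (_ : xsection _ _ = set0) ?measure0//.
    apply/seteqP; split=> // Y /xsectionP[[/= xI' _] _].
    by move: xI; rewrite mem_set.
  rewrite mul1r.
  apply: (@le_trans _ _ (mu (B (c + F (x, c)) `|` B (- c + F (x, - c))))).
    apply: le_measure; rewrite ?inE.
    - exact: measurable_xsection.
    - by apply: measurableU; exact: mB.
    move=> Y /xsectionP[_]; rewrite /A/=.
    have := labelP (x, Y); rewrite /=; set y := label F (x, Y) => yY.
    have [y0|y0] := leP 0 y; [rewrite (ger0_norm y0)|rewrite (ltr0_norm y0)] => h.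
      by left; rewrite /B/= -yY; have := shear_dist x c y; rewrite distrC in h; rewrite /t5; lra.
    right; rewrite /B/= -yY; have := shear_dist x (- c) y.
    by move: h; rewrite (_ : - y - c = - c - y) ?/t5; [lra|ring].
  apply: (@le_trans _ _ (mu (B (c + F (x, c))%R) + mu (B (- c + F (x, - c))%R))%E).
    by apply: measureU2; exact: mB.
  by rewrite !mu_ball// -EFinD lee_fin /t5; lra.
rewrite /leb2 /product_measure1.
apply: (@le_trans _ _ (\int[mu]_x (\1_(`[0%R, (2 * pi)%R]) x * (5 * tau))%:E)%E).
  apply: ge0_le_integral => //.
  - exact: (measurable_fun_xsection mu mA).
  - by apply/measurable_EFinP; apply: measurable_funM.
  - by move=> x _; exact: sec.
under eq_integral do rewrite mulrC EFinM.
rewrite ge0_integralZl//; last 2 first.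
- apply/measurable_EFinP; apply: measurable_indic; exact: measurable_itv.
- by rewrite lee_fin; lra.
rewrite integral_indic//= setIT lebesgue_measure_itv/= lte_fin ifT; last lra.
rewrite -EFinB -EFinM lee_fin subr0.
by nra.
Qed.

(** Every vertical line meets a level set of the label in a single point. *)
Lemma leb2_label_level c : leb2 R [set p | label F p = c] = 0%E.
Proof.
rewrite /leb2 /product_measure1 integral0_eq// => x _.
rewrite /= (_ : xsection _ _ = [set c + F (x, c)]) ?lebesgue_measure_set1//.
apply/seteqP; split=> Y.
  by move=> /xsectionP/= /label_eqP.
by move=> -> ; apply/xsectionP; exact: label_shear.
Qed.

Lemma quotient_error (h w z k E : R) : h != 0 -> k != 0 -> E = h * w - z * k ->
  w / k - z / h = E / (h * k).
Proof. by move=> h0 k0 ->; field; rewrite h0 k0. Qed.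

(** Differentiating [label p + F (p.1, label p) = p.2] along [v]. *)
Lemma is_derive_label p v F1 F2 :
  total_derivative F (p.1, label F p) F1 F2 ->
  `|F2| <= 4^-1 -> `|v.1| <= 1 -> `|v.2| <= 1 ->
  is_derive p v (label F) ((v.2 - F1 * v.1) / (1 + F2)).
Proof.
move=> dF F2le v1 v2; set y := label F p; set l := _ / _.
suff H : h^-1 *: (label F (h *: v + p) - label F p) @[h --> (0:R)^'] --> l.
  by split; [apply/cvg_ex; exists l|exact: cvg_lim H].
apply/cvgrPdist_le => e e0.
have [r r0 Hr] := dF (e / 4) ltac:(lra).
near=> h.
have h0 : h != 0 by near: h; exact: nbhs_dnbhs_neq.
have hr : `|h| < r / 8 by near: h; apply: dnbhs0_lt; rewrite divr_gt0.
have hp : 0 < `|h| by rewrite normr_gt0.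
set q := h *: v + p; pose y' := label F q.
have q1 : q.1 - p.1 = h * v.1 by rewrite /q/= [_ *: _]/(h * v.1) addrK.
have q2 : q.2 - p.2 = h * v.2 by rewrite /q/= [_ *: _]/(h * v.2) addrK.
have n1 : `|h * v.1| <= `|h| by rewrite normrM ler_piMr.
have n2 : `|h * v.2| <= `|h| by rewrite normrM ler_piMr.
have dy : `|y' - y| <= 2 * `|h|.
  have := label_lipschitz q p; rewrite q1 q2 -/y -/y'.
  have := label_dist q p; rewrite q1 q2 -/y -/y'.
  have : d * `|h * v.1| <= 4^-1 * `|h| by rewrite ler_pM.
  by lra.
have := Hr (q.1, y'); rewrite /= q1 => HE.
have {}HE := HE ltac:(lra) ltac:(lra).
set E := F (q.1, y') - F (p.1, y) - (F1 * (h * v.1) + F2 * (y' - y)) in HE.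
have eqE : (y' - y) * (1 + F2) = h * (v.2 - F1 * v.1) - E.
  have := labelP p; have := labelP q; rewrite -/y -/y' => E1 E2.
  have : h * v.2 = y' + F (q.1, y') - (y + F (p.1, y)) by rewrite E1 E2.
  by rewrite /E; lra.
have F2p : 3 / 4 <= 1 + F2 by move: F2le; rewrite ler_norml; lra.
have -> : l - h^-1 *: (label F q - label F p) = E / (h * (1 + F2)).
  have -> : h^-1 *: (label F q - label F p) = (y' - y) / h by rewrite mulrC.
  by apply: quotient_error => //; [lra|rewrite eqE; ring].
rewrite normrM normfV normrM [`|1 + F2|]gtr0_norm ?(lt_le_trans _ F2p)//.
rewrite ler_pdivrMr; last by rewrite mulr_gt0// (lt_le_trans _ F2p).
apply: le_trans HE _.
have : e * (`|h| * (3 / 4)) <= e * (`|h| * (1 + F2)).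
  by rewrite (ler_wpM2l (ltW e0))// (ler_wpM2l (ltW hp)).
apply: le_trans.
have : e / 4 * (`|h * v.1| + `|y' - y|) <= e / 4 * (3 * `|h|) by apply: ler_wpM2l; lra.
by lra.
Unshelve. all: by end_near. Qed.
End Shear.

(** * Traces of a C^{1+alpha} displacement *)

Section OneSidedLimits.
Variable R : realType.
Implicit Types (h : R -> R) (c l k T : R).

Lemma lim_left_of_bound h T l c k : l < c -> 0 <= k ->
  (forall y, l <= y < c -> `|h y - T| <= k * (c - y)) ->
  lim (h y @[y --> c^'-]) = T.
Proof.
move=> lc k0 H; apply: cvg_lim => //; apply/cvgrPdist_le => e e0.
near=> y.
have y1 : y < c by near: y; exact: nbhs_left_lt.
have y2 : l < y by near: y; exact: nbhs_left_gt.
have y3 : c - e / (k + 1) < y.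
  by near: y; apply: nbhs_left_gt; rewrite ltrBlDr ltrDl divr_gt0// ltr_wpDl.
rewrite distrC; apply: le_trans (H y _) _; first by rewrite y1 ltW.
have : e / (k + 1) * (k + 1) = e by rewrite divfK// gt_eqF// ltr_wpDl.
have : 0 < e / (k + 1) by rewrite divr_gt0// ltr_wpDl.
set z := e / (k + 1) in y3 * => z0 zE; nra.
Unshelve. all: by end_near. Qed.

Lemma lim_right_of_bound h T u c k : c < u -> 0 <= k ->
  (forall y, c < y <= u -> `|h y - T| <= k * (y - c)) ->
  lim (h y @[y --> c^'+]) = T.
Proof.
move=> cu k0 H; apply: cvg_lim => //; apply/cvgrPdist_le => e e0.
near=> y.
have y1 : c < y by near: y; exact: nbhs_right_gt.
have y2 : y < u by near: y; exact: nbhs_right_lt.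
have y3 : y < c + e / (k + 1).
  by near: y; apply: nbhs_right_lt; rewrite ltrDl divr_gt0// ltr_wpDl.
rewrite distrC; apply: le_trans (H y _) _; first by rewrite y1 ltW.
have : e / (k + 1) * (k + 1) = e by rewrite divfK// gt_eqF// ltr_wpDl.
have : 0 < e / (k + 1) by rewrite divr_gt0// ltr_wpDl.
set z := e / (k + 1) in y3 * => z0 zE; nra.
Unshelve. all: by end_near. Qed.

(** The limit is the infimum of the cones [h y + k * (c - y)]. *)
Lemma lipschitz_left_limit h l c k : l < c -> 0 <= k ->
  (forall y y', l <= y < c -> l <= y' < c -> `|h y - h y'| <= k * `|y - y'|) ->
  forall y, l <= y < c -> `|h y - lim (h y @[y --> c^'-])| <= k * (c - y).
Proof.
move=> lc k0 H.
pose S := [set z | exists2 y, l <= y < c & z = h y + k * (c - y)].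
have lbS y : l <= y < c -> lbound S (h y - k * (c - y)).
  move=> yI _ [y' yI' ->]; have := H y y' yI yI'; rewrite ler_norml => /andP[_ h1].
  have : k * `|y - y'| <= k * (c - y + (c - y')).
    by apply: ler_wpM2l => //; rewrite ler_norml; lra.
  by lra.
have S0 : S !=set0 by exists (h l + k * (c - l)), l => //; lra.
have HT y : l <= y < c -> `|h y - inf S| <= k * (c - y).
  move=> yI; have h1 := lb_le_inf S0 (lbS y yI).
  have h2 : inf S <= h y + k * (c - y).
    by apply: ge_inf; [exists (h y - k * (c - y)); exact: lbS|exists y].
  by rewrite ler_norml; lra.
by move=> y yI; rewrite (lim_left_of_bound lc k0 HT); exact: HT.
Qed.

Lemma lipschitz_right_limit h u c k : c < u -> 0 <= k ->
  (forall y y', c < y <= u -> c < y' <= u -> `|h y - h y'| <= k * `|y - y'|) ->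
  forall y, c < y <= u -> `|h y - lim (h y @[y --> c^'+])| <= k * (y - c).
Proof.
move=> cu k0 H.
have cu' : - u < - c by rewrite ltrN2.
have H' y y' : - u <= y < - c -> - u <= y' < - c -> `|h (- y) - h (- y')| <= k * `|y - y'|.
  move=> yI yI'; have -> : `|y - y'| = `|- y - - y'| by rewrite -opprD normrN.
  by apply: H; lra.
have HT := lipschitz_left_limit cu' k0 H'; set T := lim _ in HT.
have {}HT y : c < y <= u -> `|h y - T| <= k * (y - c).
  by move=> yI; have := HT (- y); rewrite !opprK [- c + y]addrC; apply; lra.
by move=> y yI; rewrite (lim_right_of_bound cu k0 HT); exact: HT.
Qed.
End OneSidedLimits.

Section Slices.
Variable R : realType.

Lemma within_continuous_vslice (D : set (R * R)) (f : R * R -> R) (x : R) (A : set R) :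
  {within D, continuous f} -> (forall y, A y -> D (x, y)) ->
  {within A, continuous (fun y => f (x, y))}.
Proof.
move=> /subspace_continuousP cf AD; apply/subspace_continuousP => y Ay.
have := cf (x, y) (AD _ Ay) => {}cf.
move=> P /cf; rewrite /= => H.
have H2 : nbhs y (fun z => D (x, z) -> P (f (x, z))) := @continuous_pair_l R x y _ H.
suff : nbhs y (fun z => A z -> P (f (x, z))) by [].
by apply: (@filterS _ (nbhs y) _ _ _ _ H2) => z Hz Az; apply: Hz; exact: AD.
Qed.

Lemma mvt_lipschitz (h h' : R -> R) (k y y' : R) : y <= y' ->
  {within `[y, y'], continuous h} ->
  (forall z, y < z < y' -> is_derive z 1 h (h' z) /\ `|h' z| <= k) ->
  `|h y - h y'| <= k * `|y - y'|.
Proof.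
rewrite le_eqVlt => /predU1P[->|yy'] ch dh; first by rewrite !subrr normr0 mulr0.
have [|z] := @MVT R h h' y y' yy' _ ch.
  by move=> z; rewrite in_itv/= => /dh[].
rewrite in_itv/= => /dh[_ zk]; rewrite distrC => ->.
by rewrite normrM [`|y - y'|]distrC ler_wpM2r.
Qed.
End Slices.

Section Bounds.
Variables (R : realType) (alpha eps : R).
Implicit Types (f : R * R -> R) (x y d : R).
Local Notation a := (ya eps).
Local Notation b := (yb eps).

(** The bounds carried by [C1alpha_norm alpha eps f <= d]; unlike the norm, they are
    statements about real numbers. *)
Record C1alpha_bounded f d : Prop := {
  C1ab_sup : forall p, Omega eps p -> `|f p| <= d;
  C1ab_grad : forall p i, Omega_int eps p -> `|'D_(dir R i) f p| <= d;
  C1ab_holder : forall p q i, Omega_int eps p -> Omega_int eps q ->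
    `|'D_(dir R i) f p - 'D_(dir R i) f q| <= d * dist2 p q `^ alpha
}.

Variables (f : R * R -> R) (d : R).
Hypotheses (eps0 : 0 < eps) (eps1 : eps < 1).
Hypothesis (cf : C1alpha_0even alpha eps f).
Hypothesis (bf : C1alpha_bounded f d).

Lemma ab_bounds : 0 < a < b /\ b < 1.
Proof. by have := eps0; have := eps1; rewrite /ya /yb; lra. Qed.

Lemma ab_sub : b - a = eps.
Proof. by rewrite /ya /yb; lra. Qed.

Lemma C1alpha_bounded_ge0 : 0 <= d.
Proof.
have [/andP[a0 ab] b1] := ab_bounds.
apply: le_trans (C1ab_sup bf (p := (0, 0)) _) => //.
by rewrite /Omega/= /outer lexx/= a0.
Qed.

Lemma f_vlipschitz x y y' : (0 <= y < a) && (0 <= y' < a) || (b < y <= 1) && (b < y' <= 1) ->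
  `|f (x, y) - f (x, y')| <= d * `|y - y'|.
Proof.
have [/andP[a0 ab] b1] := ab_bounds.
wlog yy' : y y' / y <= y' => [H|] yI.
  have [|/ltW y'y] := leP y y'; first by move=> yy'; exact: H.
  by rewrite distrC [`|y - y'|]distrC; apply: H => //; rewrite andbC [X in _ || X]andbC.
apply: (mvt_lipschitz (h := fun y => f (x, y)) (h' := fun z => 'D_(dir R true) f (x, z))) => //.
  apply: (within_continuous_vslice (C1a_continuous cf)) => z/=.
  rewrite in_itv/= /Omega/= /outer => zI.
  by case/orP: yI => yI; apply/orP; [left|right]; lra.
move=> z zI.
have zO : Omega_int eps (x, z).
  by rewrite /Omega_int/=; case/orP: yI => yI; apply/orP; [left|right]; lra.
split; last exact: (C1ab_grad bf).
by apply: is_derive_vslice; split => //; exact: (C1a_derivable cf).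
Qed.

(** The gradient is only controlled in the open region, which contains all horizontal
    lines of the domain but [y = 0] and [y = 1]; there [f] is constant. *)
Lemma f_hlipschitz x x' y : outer eps y -> `|f (x, y) - f (x', y)| <= d * `|x - x'|.
Proof.
have [/andP[a0 ab] b1] := ab_bounds.
move=> yO; have d0 := C1alpha_bounded_ge0.
have [->|y0] := eqVneq y 0.
  by rewrite !(C1a_boundary0 cf) subrr normr0 mulr_ge0.
have [->|y1] := eqVneq y 1.
  by rewrite !(C1a_boundary1 cf) subrr normr0 mulr_ge0.
have zO x0 : Omega_int eps (x0, y).
  move: yO y0 y1; rewrite /outer /Omega_int/= !neq_lt.
  by case/orP=> yI /orP y0 /orP y1; apply/orP; [left|right]; case: y0; case: y1; lra.
wlog xx' : x x' / x <= x' => [H|].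
  have [|/ltW x'x] := leP x x'; first exact: H.
  by rewrite distrC [`|x - x'|]distrC; exact: H.
have dx (z : R) : is_derive z 1 (fun x => f (x, y)) ('D_(dir R false) f (z, y)).
  by apply: is_derive_hslice; split => //; exact: (C1a_derivable cf).
apply: (mvt_lipschitz (h := fun x => f (x, y)) (h' := fun z => 'D_(dir R false) f (z, y))) => //.
  apply: continuous_subspaceT => z; have [+ _] := dx z.
  by move/derivable1_diffP; exact: differentiable_continuous.
by move=> z zI; split=> //; exact: (C1ab_grad bf).
Qed.

Lemma trace_left_bound x y : 0 <= y < a -> `|f (x, y) - trace_left f a x| <= d * (a - y).
Proof.
have [/andP[a0 ab] b1] := ab_bounds.
apply: (lipschitz_left_limit a0 C1alpha_bounded_ge0 (h := fun y => f (x, y))).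
by move=> z z' zI zI'; apply: f_vlipschitz; rewrite zI zI'.
Qed.

Lemma trace_right_bound x y : b < y <= 1 -> `|f (x, y) - trace_right f b x| <= d * (y - b).
Proof.
have [/andP[a0 ab] b1] := ab_bounds.
apply: (lipschitz_right_limit b1 C1alpha_bounded_ge0 (h := fun y => f (x, y))).
by move=> z z' zI zI'; apply: f_vlipschitz; rewrite zI zI' orbT.
Qed.
End Bounds.

(** * The displacement on the whole channel *)

Section Extension.
Variables (R : realType) (alpha eps : R).
Implicit Types (x y : R).
Local Notation a := (ya eps).
Local Notation b := (yb eps).

(** Passes to the limit in bounds at distance [t] from a trace. *)
Lemma le_of_slack (A B C t0 : R) : 0 < t0 ->
  (forall t, 0 < t <= t0 -> A <= B + C * t) -> A <= B.
Proof.
move=> t00 H; apply/ler_addgt0Pr => e e0.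
pose t := Num.min t0 (e / (`|C| + 1)).
have C1 : 0 < `|C| + 1 by rewrite ltr_wpDl.
have et : 0 < e / (`|C| + 1) by rewrite divr_gt0.
have tt : 0 < t <= t0 by rewrite /t lt_min t00 et ge_min lexx.
apply: le_trans (H t tt) _; rewrite lerD2l.
apply: (@le_trans _ _ (`|C| * (e / (`|C| + 1)))).
  apply: le_trans (ler_norm _) _; rewrite normrM; apply: ler_wpM2l => //.
  by rewrite gtr0_norm; [rewrite /t ge_min lexx orbT|lra].
rewrite mulrCA -[leRHS]mulr1; apply: ler_wpM2l; first exact: ltW.
by rewrite ler_pdivrMr// mul1r lerDl.
Qed.

(** The displacement is given by different formulas on consecutive intervals; in this
    form Lipschitz bounds can be glued: see [lip_on_glue]. *)
Definition lip_on (h : R -> R) k (l m : R) := forall y y', l <= y -> y <= y' -> y' <= m ->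
  `|h y - h y'| <= k * (y' - y).

Lemma lip_on_glue h k l c m : lip_on h k l c -> lip_on h k c m -> lip_on h k l m.
Proof.
move=> H1 H2 y y' ly yy' ym.
have [y'c|cy'] := leP y' c; first exact: H1.
have [cy|yc] := leP c y; first exact: H2.
have := H1 y c ly (ltW yc) (lexx _); have := H2 c y' (lexx _) (ltW cy') ym.
have := ler_normD (h y - h c) (h c - h y').
by rewrite (_ : h y - h c + (h c - h y') = h y - h y'); [lra|ring].
Qed.

(** Interpolating [f] linearly across the middle layer makes the vorticity a
    function of one global label: see [vorticity_label]. *)
Definition fpos (f : R * R -> R) (p : R * R) : R :=
  if p.2 < a then f p
  else if p.2 <= b then
    trace_left f a p.1 + (p.2 - a) / eps * (trace_right f b p.1 - trace_left f a p.1)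
  else if p.2 <= 1 then f p else 0.

Definition fhat (f : R * R -> R) (p : R * R) : R :=
  if 0 <= p.2 then fpos f p else - fpos f (p.1, - p.2).

Variables (f : R * R -> R) (d : R).
Hypotheses (eps0 : 0 < eps) (eps1 : eps < 1).
Hypothesis (cf : C1alpha_0even alpha eps f).
Hypothesis (bf : C1alpha_bounded alpha eps f d).
Hypothesis (d16 : d <= eps / 16).
Local Notation tl := (trace_left f a).
Local Notation tr := (trace_right f b).
Let ab := ab_bounds eps0 eps1.
Let d0 : 0 <= d := C1alpha_bounded_ge0 eps0 eps1 bf.

Let outl y : 0 <= y < a -> outer eps y. Proof. by move=> h; rewrite /outer h. Qed.
Let outr y : b < y <= 1 -> outer eps y. Proof. by move=> h; rewrite /outer h orbT. Qed.

Lemma trace_left_lipschitz x x' : `|tl x - tl x'| <= d * `|x - x'|.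
Proof.
have [/andP[a0 _] _] := ab.
apply: (@le_of_slack _ _ (2 * d) a) => // t tI.
have yI : 0 <= a - t < a by lra.
have h1 := trace_left_bound eps0 eps1 cf bf x yI.
have h2 := trace_left_bound eps0 eps1 cf bf x' yI.
have h3 := f_hlipschitz eps0 eps1 cf bf x x' (outl yI).
move: h1 h2 h3; rewrite (_ : a - (a - t) = t); last by ring.
by rewrite !ler_norml; lra.
Qed.

Lemma trace_right_lipschitz x x' : `|tr x - tr x'| <= d * `|x - x'|.
Proof.
have [_ b1] := ab.
apply: (@le_of_slack _ _ (2 * d) (1 - b)); first lra.
move=> t tI.
have yI : b < b + t <= 1 by lra.
have h1 := trace_right_bound eps0 eps1 cf bf x yI.
have h2 := trace_right_bound eps0 eps1 cf bf x' yI.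
have h3 := f_hlipschitz eps0 eps1 cf bf x x' (outr yI).
move: h1 h2 h3; rewrite (_ : b + t - b = t); last by ring.
by rewrite !ler_norml; lra.
Qed.

Lemma trace_left_le x : `|tl x| <= d.
Proof.
have [/andP[a0 _] _] := ab.
apply: (@le_of_slack _ _ d a) => // t tI.
have yI : 0 <= a - t < a by lra.
have := trace_left_bound eps0 eps1 cf bf x yI.
have := C1ab_sup bf (p := (x, a - t)) (outl yI).
rewrite (_ : a - (a - t) = t); last by ring.
by rewrite !ler_norml; lra.
Qed.

Lemma trace_right_le x : `|tr x| <= d.
Proof.
have [_ b1] := ab.
apply: (@le_of_slack _ _ d (1 - b)); first lra.
move=> t tI; have yI : b < b + t <= 1 by lra.
have := trace_right_bound eps0 eps1 cf bf x yI.
have := C1ab_sup bf (p := (x, b + t)) (outr yI).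
rewrite (_ : b + t - b = t); last by ring.
by rewrite !ler_norml; lra.
Qed.

Lemma trace_left_periodic x : tl (x + 2 * pi) = tl x.
Proof.
have [/andP[a0 _] _] := ab.
apply: (lim_left_of_bound a0 d0) => y yI.
by rewrite (C1a_periodic cf)//; [exact: (trace_left_bound eps0 eps1 cf bf)|exact: outl].
Qed.

Lemma trace_right_periodic x : tr (x + 2 * pi) = tr x.
Proof.
have [_ b1] := ab.
apply: (lim_right_of_bound b1 d0) => y yI.
by rewrite (C1a_periodic cf)//; [exact: (trace_right_bound eps0 eps1 cf bf)|exact: outr].
Qed.

Lemma fpos_low x y : y < a -> fpos f (x, y) = f (x, y).
Proof. by rewrite /fpos/= => ->. Qed.

Lemma fpos_mid x y : a <= y <= b ->
  fpos f (x, y) = tl x + (y - a) / eps * (tr x - tl x).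
Proof. by move=> /andP[h1 h2]; rewrite /fpos/= ltNge h1/= h2. Qed.

Lemma fpos_high x y : b < y <= 1 -> fpos f (x, y) = f (x, y).
Proof.
have [/andP[_ ab'] _] := ab.
by move=> /andP[h1 h2]; rewrite /fpos/= ltNge (ltW (lt_trans ab' h1))/= leNgt h1/= h2.
Qed.

Lemma fpos_top x y : 1 <= y -> fpos f (x, y) = 0.
Proof.
have [/andP[_ ab'] b1] := ab.
rewrite le_eqVlt => /predU1P[<-|y1].
  by rewrite fpos_high ?(C1a_boundary1 cf)// b1 lexx.
by rewrite /fpos/= !ifF//; apply/negbTE; rewrite -?leNgt -?ltNge; lra.
Qed.

Lemma fpos_cases y : 0 <= y -> [\/ 0 <= y < a, a <= y <= b, b < y <= 1 | 1 <= y].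
Proof.
move=> y0; have [ya|ya] := ltP y a; first by constructor 1; rewrite y0.
have [yb|yb] := leP y b; first by constructor 2.
have [y1|y1] := leP y 1; first by constructor 3.
by constructor 4; exact: ltW.
Qed.

Lemma mid_param y : a <= y <= b -> 0 <= (y - a) / eps <= 1.
Proof.
move=> h; have e0 := eps0; have := @ab_sub R eps => hab.
by apply/andP; split; [apply: divr_ge0; lra|rewrite ler_pdivrMr//; lra].
Qed.

Lemma fpos_le x y : 0 <= y -> `|fpos f (x, y)| <= d.
Proof.
move=> /fpos_cases[] h.
- by rewrite fpos_low; [apply: (C1ab_sup bf); exact: outl|lra].
- rewrite fpos_mid//; have := mid_param h; set t := _ / _ => tI.
  have := trace_left_le x; have := trace_right_le x; rewrite !ler_norml => h1 h2.
  by apply/andP; split; nra.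
- by rewrite fpos_high//; apply: (C1ab_sup bf); exact: outr.
- by rewrite fpos_top// normr0.
Qed.

Lemma fpos_x x x' y : 0 <= y -> `|fpos f (x, y) - fpos f (x', y)| <= d * `|x - x'|.
Proof.
move=> /fpos_cases[] h.
- by rewrite !fpos_low; [apply: (f_hlipschitz eps0 eps1 cf bf); exact: outl|lra|lra].
- rewrite !fpos_mid//; have := mid_param h; set t := _ / _ => tI.
  have := trace_left_lipschitz x x'; have := trace_right_lipschitz x x'.
  rewrite !ler_norml; set D := d * _ => h1 h2.
  by apply/andP; split; nra.
- by rewrite !fpos_high//; apply: (f_hlipschitz eps0 eps1 cf bf); exact: outr.
- by rewrite !fpos_top// subrr normr0 mulr_ge0.
Qed.

Lemma fpos_a x : fpos f (x, a) = tl x.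
Proof.
have [/andP[_ ab'] _] := ab.
by rewrite fpos_mid ?lexx ?ltW// subrr mul0r mul0r addr0.
Qed.

Lemma fpos_b x : fpos f (x, b) = tr x.
Proof.
have [/andP[_ ab'] _] := ab.
by rewrite fpos_mid ?lexx ?ltW// ab_sub divff ?gt_eqF// mul1r addrC subrK.
Qed.

Lemma fpos_y x m : lip_on (fun y => fpos f (x, y)) 4^-1 0 m.
Proof.
have [/andP[a0 ab'] b1] := ab; have e0 := eps0; have e1 := eps1; have D16 := d16.
have d4 : d <= 4^-1 by lra.
have D0 := d0.
have weak z t : 0 <= t -> z <= d * t -> z <= 4^-1 * t.
  by move=> t0 /le_trans; apply; exact: ler_wpM2r.
have norm y y' : y <= y' -> `|y - y'| = y' - y.
  by move=> yy'; rewrite distrC ger0_norm ?subr_ge0.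
apply: (@lip_on_glue _ _ _ 1); last first.
  move=> y y' y1 yy' _; rewrite !fpos_top//; last exact: le_trans yy'.
  by rewrite subrr normr0 mulr_ge0// subr_ge0.
apply: (@lip_on_glue _ _ _ b); last first.
  move=> y y'; rewrite le_eqVlt => /predU1P[<-|yb] yy' y1.
    move: yy'; rewrite le_eqVlt => /predU1P[<-|yy'].
      by rewrite !subrr normr0 mulr0.
    rewrite fpos_b fpos_high ?yy'// distrC; apply: weak; first lra.
    by apply: (trace_right_bound eps0 eps1 cf bf); rewrite yy'.
  rewrite !fpos_high; [|lra|lra]; apply: weak; first lra.
  by rewrite -(norm y y')//; apply: (f_vlipschitz eps0 eps1 cf bf); apply/orP; right; lra.
apply: (@lip_on_glue _ _ _ a).
  move=> y y' y0 yy'; rewrite le_eqVlt => /predU1P[y'a|y'a].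
    move: yy'; rewrite le_eqVlt => /predU1P[<-|yy'].
      by rewrite !subrr normr0 mulr0.
    rewrite {1}y'a fpos_a fpos_low; last by rewrite -y'a.
    apply: weak; first lra.
    by rewrite y'a; apply: (trace_left_bound eps0 eps1 cf bf); rewrite y0 -y'a.
  rewrite !fpos_low; [|lra|lra]; apply: weak; first lra.
  by rewrite -(norm y y')//; apply: (f_vlipschitz eps0 eps1 cf bf); apply/orP; left; lra.
move=> y y' ya yy' yb; rewrite !fpos_mid; [|lra|lra].
set A := tl x; set B := tr x.
rewrite (_ : _ - _ = (B - A) * ((y - y') / eps)); last by field; rewrite gt_eqF.
(* Across the layer, of width [eps], the displacement varies by at most [2 d]: this
   is what the bound [d <= eps / 16] is for. *)
have AB : `|B - A| <= eps / 8.
  have := trace_left_le x; have := trace_right_le x; rewrite -/A -/B !ler_norml; lra.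
rewrite normrM normf_div (gtr0_norm eps0) (norm y y')//.
rewrite mulrA ler_pdivrMr// mulrAC; apply: (@le_trans _ _ (eps / 8 * (y' - y))).
  by apply: ler_wpM2r; rewrite ?subr_ge0.
by nra.
Qed.

Lemma fhat_pos x y : 0 <= y -> fhat f (x, y) = fpos f (x, y).
Proof. by rewrite /fhat/= => ->. Qed.

Lemma fpos0 x : fpos f (x, 0) = 0.
Proof.
by have [/andP[a0 _] _] := ab; rewrite fpos_low// (C1a_boundary0 cf).
Qed.

Lemma fhat_neg x y : y <= 0 -> fhat f (x, y) = - fpos f (x, - y).
Proof.
rewrite le_eqVlt => /predU1P[->|y0]; last by rewrite /fhat/= leNgt y0.
by rewrite fhat_pos// oppr0 fpos0 oppr0.
Qed.

Lemma fhat_le p : `|fhat f p| <= d.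
Proof.
case: p => x y; have [y0|/ltW y0] := leP 0 y; first by rewrite fhat_pos ?fpos_le.
by rewrite fhat_neg// normrN fpos_le// oppr_ge0.
Qed.

Lemma fhat_x x x' y : `|fhat f (x, y) - fhat f (x', y)| <= d * `|x - x'|.
Proof.
have [y0|/ltW y0] := leP 0 y; first by rewrite !fhat_pos ?fpos_x.
by rewrite !fhat_neg// -opprD normrN fpos_x// oppr_ge0.
Qed.

Lemma fhat_y x y y' : `|fhat f (x, y) - fhat f (x, y')| <= 4^-1 * `|y - y'|.
Proof.
wlog yy' : y y' / y <= y' => [H|].
  have [|/ltW y'y] := leP y y'; first exact: H.
  by rewrite distrC [`|y - y'|]distrC; exact: H.
rewrite [`|y - y'|]distrC [`|y' - y|]ger0_norm ?subr_ge0//.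
have [y0|/ltW y0] := leP 0 y.
  rewrite !fhat_pos//; last exact: le_trans yy'.
  exact: (@fpos_y x y' y y').
have [y'0|/ltW y'0] := leP 0 y'.
  rewrite fhat_neg// fhat_pos//.
  have := @fpos_y x y' 0 y' (lexx _) y'0 (lexx _).
  have := @fpos_y x (- y) 0 (- y) (lexx _) ltac:(lra) (lexx _).
  by rewrite /= fpos0 !ler_norml; lra.
rewrite !fhat_neg// -opprD normrN distrC.
have := @fpos_y x (- y) (- y') (- y); rewrite (_ : - y - - y' = y' - y); last by ring.
by apply; lra.
Qed.

Lemma fhat_periodic x y : fhat f (x + 2 * pi, y) = fhat f (x, y).
Proof.
have H z : 0 <= z -> fpos f (x + 2 * pi, z) = fpos f (x, z).
  move=> /fpos_cases[] h.
  - by rewrite !fpos_low ?(C1a_periodic cf)//; [exact: outl|lra|lra].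
  - by rewrite !fpos_mid//= trace_left_periodic trace_right_periodic.
  - by rewrite !fpos_high ?(C1a_periodic cf)//; exact: outr.
  - by rewrite !fpos_top.
have [y0|/ltW y0] := leP 0 y; first by rewrite !fhat_pos ?H.
by rewrite !fhat_neg// H// oppr_ge0.
Qed.

Variable w : R * R -> R.
Hypothesis hw : wave_vorticity eps f w.

Lemma odd_ext_traces x :
  [/\ trace_left (odd_ext f) a x = tl x, trace_right (odd_ext f) b x = tr x,
      trace_left (odd_ext f) (- b) x = - tr x &
      trace_right (odd_ext f) (- a) x = - tl x].
Proof.
have [/andP[a0 ab'] b1] := ab.
have odd_pos y : 0 <= y -> odd_ext f (x, y) = f (x, y) by rewrite /odd_ext/= => ->.
have odd_neg y : y < 0 -> odd_ext f (x, y) = - f (x, - y).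
  by move=> y0; rewrite /odd_ext/= leNgt y0.
split.
- apply: (lim_left_of_bound a0 d0) => y yI; rewrite odd_pos; last by case/andP: yI.
  exact: (trace_left_bound eps0 eps1 cf bf).
- apply: (lim_right_of_bound b1 d0) => y yI; rewrite odd_pos; last by lra.
  exact: (trace_right_bound eps0 eps1 cf bf).
- have b1' : - 1 < - b by rewrite ltrN2.
  apply: (lim_left_of_bound b1' d0) => y yI; rewrite odd_neg; last by lra.
  rewrite -opprD normrN (_ : - b - y = - y - b); last by ring.
  by apply: (trace_right_bound eps0 eps1 cf bf); lra.
- have a0' : - a < 0 by rewrite oppr_lt0.
  have H y : - a < y <= - (a / 2) -> `|odd_ext f (x, y) - - tl x| <= d * (y - - a).
    move=> yI; rewrite odd_neg; last by lra.
    rewrite -opprD normrN (_ : y - - a = a - - y); last by ring.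
    by apply: (trace_left_bound eps0 eps1 cf bf); lra.
  by apply: (lim_right_of_bound _ d0 H); lra.
Qed.

(** In the outer regions this is the definition of the vorticity. In a middle layer the
    vorticity and [varpi] are both constant, so it suffices that the shear maps the
    layer [a <= |y| <= b] into the region bounded by the two displaced lines. *)
Lemma vorticity_label x y : - 1 <= y <= 1 -> w (x, y + fhat f (x, y)) = varpi eps y.
Proof.
have [/andP[a0 ab'] b1] := ab; have e0 := eps0; have D16 := d16.
have [T1 T2 T3 T4] := odd_ext_traces x.
have slope z : a <= z <= b -> let g := fpos f (x, z) in
    a + tl x <= z + g /\ z + g <= b + tr x.
  move=> zI; rewrite /= fpos_mid//.
  have := mid_param zI; set t := _ / _ => tI.
  have tE : z - a = eps * t by rewrite /t mulrCA divff ?gt_eqF// mulr1.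
  have := @ab_sub R eps.
  have := trace_left_le x; have := trace_right_le x; rewrite !ler_norml => h1 h2 h3.
  by split; nra.
move=> /andP[ym y1]; have [y0|y0] := leP 0 y.
  rewrite fhat_pos// /varpi y0 /varpi_pos.
  have [h|h|h|h] := fpos_cases y0.
  - rewrite fpos_low; last by lra.
    have -> : f (x, y) = odd_ext f (x, y) by rewrite /odd_ext/= y0.
    rewrite (vorticity_outer hw).
      by rewrite /varpi y0.
    by rewrite /outer_sym; apply/or3P; constructor 2; lra.
  - rewrite (vorticity_upper hw); last by rewrite T1 T2; have [-> ->] := slope y h.
    by case/andP: h => h1 h2; rewrite ltNge h1/= h2.
  - rewrite fpos_high//.
    have -> : f (x, y) = odd_ext f (x, y) by rewrite /odd_ext/= y0.
    rewrite (vorticity_outer hw).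
      by rewrite /varpi y0.
    by rewrite /outer_sym; apply/or3P; constructor 3; lra.
  - have -> : y = 1 by apply/eqP; rewrite eq_le y1.
    rewrite fpos_top// -{1}(C1a_boundary1 cf x).
    have -> : f (x, 1) = odd_ext f (x, 1) by rewrite /odd_ext/= ler01.
    rewrite (vorticity_outer hw).
      by rewrite /varpi ler01.
    by rewrite /outer_sym b1 lexx !orbT.
rewrite fhat_neg; last exact: ltW.
rewrite /varpi leNgt y0/= /varpi_pos.
have y0' : 0 <= - y by lra.
have oddE : odd_ext f (x, y) = - f (x, - y) by rewrite /odd_ext/= leNgt y0.
have vE : varpi eps y = - varpi_pos eps (- y) by rewrite /varpi leNgt y0.
have [h|h|h|h] := fpos_cases y0'.
- rewrite fpos_low; last by lra.
  rewrite -oddE (vorticity_outer hw) ?vE//.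
  by rewrite /outer_sym; apply/or3P; constructor 2; lra.
- have [s1 s2] := slope _ h.
  rewrite (vorticity_lower hw); last by rewrite T3 T4; apply/andP; split; lra.
  by case/andP: h => h1 h2; rewrite ltNge h1/= h2 mulNr opprK.
- rewrite fpos_high// -oddE (vorticity_outer hw) ?vE//.
  by rewrite /outer_sym; apply/or3P; constructor 1; lra.
- have y1' : - y = 1 by apply/eqP; rewrite eq_le h andbT; lra.
  have -> : - fpos f (x, - y) = odd_ext f (x, y).
    by rewrite oddE y1' fpos_top// (C1a_boundary1 cf).
  rewrite (vorticity_outer hw) ?vE//.
  by rewrite /outer_sym; apply/or3P; constructor 1; lra.
Qed.
End Extension.

(** * Differentiability of the displacement *)

Section Gradient.
Variables (R : realType) (alpha eps : R).
Implicit Types (x y : R) (p q v : R * R).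
Local Notation a := (ya eps).
Local Notation b := (yb eps).

Lemma mvt_error (h h' : R -> R) (c k y y' : R) :
  (forall z, `|z - y| <= `|y' - y| -> is_derive z 1 h (h' z) /\ `|h' z - c| <= k) ->
  `|h y' - h y - c * (y' - y)| <= k * `|y' - y|.
Proof.
move=> H.
pose g z := h z - c * z.
have dg z : `|z - y| <= `|y' - y| -> is_derive z 1 g (h' z - c).
  move=> /H[dh _]; have -> : g = h - (c *: (id : R -> R)) by apply/funext.
  apply: is_deriveB; rewrite -[X in is_derive _ _ _ X]mulr1.
  exact: is_deriveZ.
have -> : h y' - h y - c * (y' - y) = g y' - g y by rewrite /g; ring.
have cont u u' : (forall z, u <= z <= u' -> `|z - y| <= `|y' - y|) ->
    {within `[u, u'], continuous g}.
  move=> Hz; apply: derivable_within_continuous => z; rewrite in_itv/= => zI.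
  by have [] := dg z (Hz z zI).
have [yy'|/ltW y'y] := leP y y'.
  have Hz z : y <= z <= y' -> `|z - y| <= `|y' - y|.
    by move=> zI; rewrite !ger0_norm; lra.
  rewrite distrC [`|y' - y|]distrC; apply: (mvt_lipschitz (h' := fun z => h' z - c)) => //.
    exact: cont.
  move=> z zI; have zz := Hz z ltac:(lra).
  by split; [exact: dg|have [] := H z zz].
have Hz z : y' <= z <= y -> `|z - y| <= `|y' - y|.
  by move=> zI; rewrite !ler0_norm; lra.
apply: (mvt_lipschitz (h' := fun z => h' z - c)) => //.
  exact: cont.
move=> z zI; have zz := Hz z ltac:(lra).
by split; [exact: dg|have [] := H z zz].
Qed.

Lemma dist2_le p q : dist2 p q <= `|p.1 - q.1| + `|p.2 - q.2|.
Proof.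
rewrite /dist2 -[leRHS]ger0_norm ?addr_ge0// -[leRHS]sqrtr_sqr ler_sqrt ?sqr_ge0//.
rewrite -[X in X + _]real_normK ?num_real// -[X in _ + X]real_normK ?num_real//.
have := normr_ge0 (p.1 - q.1); have := normr_ge0 (p.2 - q.2).
by set u := `|_|; set z := `|_|; nra.
Qed.

Lemma Omega_int_radius x y : Omega_int eps (x, y) ->
  exists2 r : R, 0 < r & forall x' t, `|t - y| < r -> Omega_int eps (x', t).
Proof.
rewrite /Omega_int/= => /orP[/andP[y0 ya]|/andP[yb y1]].
  exists (Num.min y (a - y)); first by rewrite lt_min y0 subr_gt0.
  move=> _ t; rewrite lt_min !ltr_norml => /andP[h1 h2].
  by apply/orP; left; lra.
exists (Num.min (y - b) (1 - y)); first by rewrite lt_min !subr_gt0 yb.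
move=> _ t; rewrite lt_min !ltr_norml => /andP[h1 h2].
by apply/orP; right; lra.
Qed.

Variables (f : R * R -> R) (d : R).
Hypothesis (alpha0 : 0 < alpha).
Hypotheses (eps0 : 0 < eps) (eps1 : eps < 1).
Hypothesis (cf : C1alpha_0even alpha eps f).
Hypothesis (bf : C1alpha_bounded alpha eps f d).
Hypothesis (d16 : d <= eps / 16).
Let ab := ab_bounds eps0 eps1.
Let d0 : 0 <= d := C1alpha_bounded_ge0 eps0 eps1 bf.

(** Continuity of the partial derivatives gives total differentiability: the increment
    is the sum of a vertical one along the line through [p] and of a horizontal one,
    each controlled by the mean value inequality. *)
Lemma f_total_derivative p : Omega_int eps p ->
  total_derivative f p ('D_(dir R false) f p) ('D_(dir R true) f p).
Proof.
case: p => x y pO eta eta0.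
have [r r0 Hr] := Omega_int_radius pO.
(* At distance [z] the Hoelder bound [d * z `^ alpha] of the gradient is below
   [eta]. *)
pose z := (eta / (d + 1)) `^ alpha^-1.
have D0 := d0; have d1 : 0 < d + 1 by lra.
have ed : 0 < eta / (d + 1) by rewrite divr_gt0.
have z0 : 0 < z by rewrite powR_gt0.
have small q : Omega_int eps q -> `|q.1 - x| + `|q.2 - y| <= z -> forall i,
    `|'D_(dir R i) f q - 'D_(dir R i) f (x, y)| <= eta.
  move=> qO qz i; apply: le_trans (C1ab_holder bf i qO pO) _.
  have : dist2 q (x, y) `^ alpha <= z `^ alpha.
    apply: ge0_ler_powR; rewrite ?nnegrE ?sqrtr_ge0 ?powR_ge0//; first exact: ltW.
    exact: (le_trans (dist2_le q (x, y))).
  rewrite /z -powRrM mulVf ?gt_eqF// powRr1; last exact: ltW.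
  move=> H.
  apply: le_trans (ler_wpM2l d0 H) _.
  have : (d + 1) * (eta / (d + 1)) = eta by rewrite mulrC divfK// gt_eqF.
  by set w := eta / _ in ed *; nra.
exists (Num.min r (z / 2)); first by rewrite lt_min r0 divr_gt0.
set X := 'D_(dir R false) f (x, y); set Y := 'D_(dir R true) f (x, y).
move=> [x' y'] /=; rewrite !lt_min => /andP[x1 x2] /andP[y1 y2].
have dx : `|f (x', y') - f (x, y') - X * (x' - x)| <= eta * `|x' - x|.
  apply: (@mvt_error (fun t => f (t, y')) (fun t => 'D_(dir R false) f (t, y'))).
  move=> t tx; have tO := Hr t y' y1.
  split; first by apply: is_derive_hslice; split => //; exact: (C1a_derivable cf).
  by apply: small => //=; lra.
have dy : `|f (x, y') - f (x, y) - Y * (y' - y)| <= eta * `|y' - y|.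
  apply: (@mvt_error (fun t => f (x, t)) (fun t => 'D_(dir R true) f (x, t))).
  move=> t ty; have tO := Hr x t (le_lt_trans ty y1).
  split; first by apply: is_derive_vslice; split => //; exact: (C1a_derivable cf).
  by apply: small => //=; rewrite subrr normr0; lra.
have := ler_normD (f (x', y') - f (x, y') - X * (x' - x))
  (f (x, y') - f (x, y) - Y * (y' - y)).
rewrite [eta * _]mulrDr => H; apply: le_trans (lerD dx dy); apply: le_trans H.
by rewrite le_eqVlt; apply/orP; left; apply/eqP; congr `|_|; ring.
Qed.

(** The partial derivatives of the odd extension [Num.sg y * f (x, `|y|)]. *)
Definition hat_dx (f : R * R -> R) p : R := Num.sg p.2 * 'D_(dir R false) f (p.1, `|p.2|).
Definition hat_dy (f : R * R -> R) p : R := 'D_(dir R true) f (p.1, `|p.2|).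

Lemma fhat_outer x y : Omega_int eps (x, `|y|) -> fhat eps f (x, y) = Num.sg y * f (x, `|y|).
Proof.
rewrite /Omega_int/= => yO.
have fE : fpos eps f (x, `|y|) = f (x, `|y|).
  case/orP: yO => yO; first by rewrite fpos_low//; lra.
  by rewrite (fpos_high f eps0 eps1)//; lra.
have [y0|y0|y0] := ltgtP 0 y.
- by move: fE; rewrite gtr0_norm// gtr0_sg// mul1r fhat_pos//; exact: ltW.
- by move: fE; rewrite ltr0_norm// ltr0_sg// mulN1r (fhat_neg eps0 eps1 cf); [move=> ->|exact: ltW].
- by move: yO; rewrite -y0 normr0 ltxx/= => /andP[]; have [] := ab; lra.
Qed.

(** The sign of [y] is locally constant away from the axis, so [fhat] is locally [f]
    composed with a reflection. *)
Lemma fhat_total_derivative p : Omega_int eps (p.1, `|p.2|) ->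
  total_derivative (fhat eps f) p (hat_dx f p) (hat_dy f p).
Proof.
case: p => x y /= pO eta eta0.
have y0 : 0 < `|y| by move: pO; rewrite /Omega_int/= => /orP[]; have [] := ab; lra.
have [r r0 Hr] := Omega_int_radius pO.
have [r' r'0 Hr'] := f_total_derivative pO eta0.
exists (Num.min `|y| (Num.min r r')); first by rewrite !lt_min y0 r0.
move=> [x' y'] /=; rewrite !lt_min => /and3P[x1 x2 x3] /and3P[y1 y2 y3].
have ny : `| `|y'| - `|y| | <= `|y' - y| by exact: ler_dist_dist.
have sgE : Num.sg y' = Num.sg y.
  have [h|h|h] := ltgtP 0 y.
  - have y'0 : 0 < y' by move: y1; rewrite (gtr0_norm h) ltr_norml; lra.
    by rewrite !gtr0_sg.
  - have y'0 : y' < 0 by move: y1; rewrite (ltr0_norm h) ltr_norml; lra.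
    by rewrite !ltr0_sg.
  - by move: y0; rewrite -h normr0 ltxx.
have y'O : Omega_int eps (x', `|y'|) by apply: Hr; exact: le_lt_trans y2.
rewrite !fhat_outer// sgE /hat_dx /hat_dy/=.
have := Hr' (x', `|y'|); rewrite /= => /(_ x3 (le_lt_trans ny y3)).
have sgn : (y' - y) = Num.sg y * (`|y'| - `|y|).
  by rewrite mulrBr -{1}sgE -!numEsg.
have sg2 : Num.sg y * Num.sg y = 1 by rewrite -expr2 sqr_sg -normr_gt0 y0.
have nsg : `|Num.sg y| = 1 by rewrite normr_sg -normr_gt0 y0.
set X := 'D_(dir R false) f _; set Y := 'D_(dir R true) f _ => H.
have -> : Num.sg y * f (x', `|y'|) - Num.sg y * f (x, `|y|) -
    (Num.sg y * X * (x' - x) + Y * (y' - y)) =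
    Num.sg y * (f (x', `|y'|) - f (x, `|y|) - (X * (x' - x) + Y * (`|y'| - `|y|))).
  by rewrite sgn; ring.
rewrite normrM nsg mul1r; apply: le_trans H _.
by apply: ler_wpM2l; [exact: ltW|rewrite lerD2l].
Qed.

Lemma hat_dy_le p : Omega_int eps (p.1, `|p.2|) -> `|hat_dy f p| <= d.
Proof. by move=> pO; exact: (C1ab_grad bf). Qed.
End Gradient.

(** * The profile *)

Section Varpi.
Variables (R : realType) (eps : R).
Implicit Types (y t : R).
Local Notation a := (ya eps).
Local Notation b := (yb eps).
Hypotheses (eps0 : 0 < eps) (eps1 : eps < 1).
Let ab : 0 < a < b /\ b < 1 := ab_bounds eps0 eps1.
Let abs : b - a = eps := ab_sub eps.

Lemma varpi_pos_mono y y' : 0 <= y -> y <= y' ->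
  0 <= varpi_pos eps y - varpi_pos eps y' <= 2 * (y' - y).
Proof.
have [/andP[a0 ab'] b1] := ab.
by move=> y0 yy'; rewrite /varpi_pos; case: (ltP y a) => h1; case: (ltP y' a) => h2;
  case: (leP y b) => h3; case: (leP y' b) => h4; lra.
Qed.

Lemma varpi_pos_bounds y : 0 <= y -> - 2 * y <= varpi_pos eps y <= - 2 * y + 2 * eps /\ varpi_pos eps y <= 0.
Proof.
have [/andP[a0 ab'] b1] := ab; have := abs => h0.
by move=> y0; rewrite /varpi_pos; case: (ltP y a) => h1; case: (leP y b) => h3; lra.
Qed.

Lemma varpi_ge0 y : 0 <= y -> varpi eps y = varpi_pos eps y.
Proof. by rewrite /varpi => ->. Qed.

Lemma varpi_odd y : varpi eps (- y) = - varpi eps y.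
Proof.
have [/andP[a0 ab'] b1] := ab.
have v0 : varpi_pos eps 0 = 0 by rewrite /varpi_pos a0 mulr0.
rewrite /varpi; have [y0|y0|<-] := ltgtP 0 y.
- by rewrite leNgt oppr_lt0 y0/= opprK.
- by rewrite oppr_ge0 ltW// opprK.
- by rewrite oppr0 lexx v0 oppr0.
Qed.

Lemma varpi_lipschitz y y' : `|varpi eps y - varpi eps y'| <= 2 * `|y - y'|.
Proof.
wlog yy' : y y' / y <= y' => [H|].
  have [|/ltW y'y] := leP y y'; first exact: H.
  by rewrite distrC [`|y - y'|]distrC; exact: H.
rewrite [`|y - y'|]distrC [`|y' - y|]ger0_norm ?subr_ge0//.
have [y0|/ltW y0] := leP 0 y.
  rewrite !varpi_ge0//; last exact: le_trans yy'.
  by have := varpi_pos_mono y0 yy'; rewrite ler_norml; lra.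
have yN z : z <= 0 -> varpi eps z = - varpi_pos eps (- z).
  by move=> z0; rewrite -{1}[z]opprK varpi_odd varpi_ge0// oppr_ge0.
have [y'0|/ltW y'0] := leP 0 y'.
  rewrite (yN y y0) (varpi_ge0 y'0) ler_norml.
  have [] := varpi_pos_bounds y'0; have [] := @varpi_pos_bounds (- y) ltac:(lra).
  by lra.
rewrite !yN// ler_norml.
by have := @varpi_pos_mono (- y') (- y) ltac:(lra) ltac:(lra); lra.
Qed.

(** [varpi] only loses the slope - 2 on a layer of width [eps]. *)
Lemma varpi_near_linear y : `|varpi eps y + 2 * y| <= 2 * eps.
Proof.
have e0 := eps0.
have [y0|/ltW y0] := leP 0 y.
  by rewrite varpi_ge0// ler_norml; have [] := varpi_pos_bounds y0; lra.
have -> : varpi eps y = - varpi_pos eps (- y).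
  by rewrite -{1}[y]opprK varpi_odd varpi_ge0// oppr_ge0.
by rewrite ler_norml; have [] := @varpi_pos_bounds (- y) ltac:(lra); lra.
Qed.

Definition open_outer y : bool := (0 < `|y| < a) || (b < `|y| < 1).

(** Oddness transfers the local formula from positive to negative arguments. *)
Lemma varpi_local (k : R) (P : pred R) :
  (forall y, 0 < y -> P y -> exists c r : R, 0 < r /\
     forall t, `|t - y| < r -> varpi eps t = k * t + c) ->
  (forall y, P (- y) = P y) ->
  forall y, y != 0 -> P y -> exists c r : R, 0 < r /\
     forall t, `|t - y| < r -> varpi eps t = k * t + c.
Proof.
move=> H PN y; rewrite neq_lt => /orP[y0|y0] Py; last exact: H.
have [||c [r [r0 Hr]]] := H (- y); rewrite ?oppr_gt0 ?PN//.
exists (- c), r; split=> // t ty.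
rewrite -[t]opprK varpi_odd (Hr (- t)); first by ring.
by rewrite -opprD normrN.
Qed.

Lemma varpi_local_outer y : open_outer y -> exists c r : R, 0 < r /\
  forall t, `|t - y| < r -> varpi eps t = - 2 * t + c.
Proof.
have [/andP[a0 ab'] b1] := ab.
move=> yO; apply: (@varpi_local _ open_outer) => //; last 2 first.
- by move=> z; rewrite /open_outer normrN.
- by apply: contraTneq yO => ->; rewrite /open_outer normr0 ltxx/=; apply/negP => /andP[]; lra.
move=> z z0; rewrite /open_outer gtr0_norm// => /orP[/andP[_ za]|/andP[zb z1]].
  exists 0, (Num.min z (a - z)); split; first by rewrite lt_min z0 subr_gt0.
  move=> t; rewrite lt_min !ltr_norml => /andP[h1 h2].
  rewrite varpi_ge0; last by lra.
  by rewrite /varpi_pos ifT ?addr0//; lra.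
exists (2 * b - 2 * a), (z - b); split; first by rewrite subr_gt0.
move=> t; rewrite ltr_norml => h.
rewrite varpi_ge0; last by lra.
rewrite /varpi_pos !ifF; [ring|..]; apply/negbTE; rewrite -?leNgt -?ltNge; lra.
Qed.

Lemma varpi_local_mid y : a < `|y| < b -> exists c r : R, 0 < r /\
  forall t, `|t - y| < r -> varpi eps t = 0 * t + c.
Proof.
have [/andP[a0 ab'] b1] := ab.
move=> yM; apply: (@varpi_local _ (fun z => a < `|z| < b)) => //; last 2 first.
- by move=> z; rewrite normrN.
- by apply: contraTneq yM => ->; rewrite normr0 ltNge ltW.
move=> z z0; rewrite gtr0_norm// => /andP[za zb].
exists (- 2 * a), (Num.min (z - a) (b - z)); split; first by rewrite lt_min !subr_gt0 za.
move=> t; rewrite lt_min !ltr_norml => /andP[h1 h2].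
rewrite varpi_ge0; last by lra.
rewrite /varpi_pos ifF ?ifT; [ring|lra|].
by apply/negbTE; rewrite -leNgt; lra.
Qed.
End Varpi.

Section DeriveTools.
Variable R : realType.
Implicit Types (p v : R * R) (U V : R * R -> R).

Lemma is_derive_near_eq U V p v (l : R) : (\forall q \near p, V q = U q) ->
  is_derive p v V l -> is_derive p v U l.
Proof.
move=> VU [dV <-]; split; first exact: near_eq_derivable dV.
by apply/esym; exact: near_eq_derive.
Qed.

Lemma is_derive_snd p v : is_derive p v (snd : R * R -> R) v.2.
Proof.
suff H : h^-1 *: ((h *: v + p).2 - p.2) @[h --> (0:R)^'] --> v.2.
  by split; [apply/cvg_ex; exists v.2|exact: cvg_lim H].
apply/cvgrPdist_le => e e0; near=> h.
have h0 : h != 0 by near: h; exact: nbhs_dnbhs_neq.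
by rewrite /= addrK scalerA mulVf// scale1r subrr normr0 ltW.
Unshelve. all: by end_near. Qed.

Lemma derive_seq_cvg U p v (l : R) : is_derive p v U l ->
  n.+1%:R * (U ((n.+1%:R^-1 : R) *: v + p) - U p) @[n --> \oo] --> l.
Proof.
move=> [dU <-].
have := @cvgr_dnbhsP R (fun h => h^-1 *: (U (h *: v + p) - U p)) 0 ('D_v U p).
case=> /(_ dU) /(_ (fun n => n.+1%:R^-1)) H _.
have {}H := H (conj (fun n => invr_neq0 (lt0r_neq0 (ltr0Sn R n))) cvg_harmonic).
by apply: cvg_trans H; apply: near_eq_cvg; apply: nearW => n; rewrite invrK.
Qed.
End DeriveTools.

(** * The vorticity perturbation and its weak gradient *)

Section Wave.
Variables (R : realType) (alpha eps : R).
Local Notation ch := (@channel R).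
Implicit Types (x y : R) (p q v : R * R) (i : bool).
Local Notation a := (ya eps).
Local Notation b := (yb eps).

Definition wave_label (f : R * R -> R) : R * R -> R := label (fhat eps f).

(** The vorticity minus that of the shear flow [- 2 y]: see [vorticity_wave_u]. *)
Definition wave_u (f : R * R -> R) p : R := varpi eps (wave_label f p) + 2 * p.2.

Definition hat_partial i (f : R * R -> R) : R * R -> R := if i then hat_dy f else hat_dx f.

(** The gradient of [wave_u], by differentiating [L p + fhat (p.1, L p) = p.2]: in the
    outer regions [varpi' = - 2] and [2 - 2 / (1 + f_y) = 2 f_y / (1 + f_y)] for the
    vertical component; in the middle layers [varpi' = 0], and only the derivative of
    [2 y] is left. *)
Definition wave_g i (f : R * R -> R) p : R :=
  let q := (p.1, wave_label f p) in
  if open_outer eps q.2 then 2 * hat_partial i f q / (1 + hat_dy f q)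
  else if i && (a <= `|q.2| <= b) then 2 else 0.

Variables (f : R * R -> R) (d : R).
Hypothesis (alpha0 : 0 < alpha).
Hypotheses (eps0 : 0 < eps) (eps1 : eps < 1).
Hypothesis (cf : C1alpha_0even alpha eps f).
Hypothesis (bf : C1alpha_bounded alpha eps f d).
Hypothesis (d16 : d <= eps / 16).
Let ab : 0 < a < b /\ b < 1 := ab_bounds eps0 eps1.
Let d0 : 0 <= d := C1alpha_bounded_ge0 eps0 eps1 bf.
Let d4 : d <= 4^-1. Proof. by have := eps1; have := d16; lra. Qed.
Local Notation L := (wave_label f).
Local Notation U := (wave_u f).
Let Fle := fhat_le eps0 eps1 cf bf.
Let Fx := fhat_x eps0 eps1 cf bf.
Let Fy := fhat_y eps0 eps1 cf bf d16.

Lemma wave_label_lipschitz : lipschitz_plane 2 L.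
Proof. exact: (label_lipschitz d4 Fle Fx Fy). Qed.

Lemma wave_label_periodic x y : L (x + 2 * pi, y) = L (x, y).
Proof. exact: (label_periodic d4 Fle Fy (fhat_periodic eps0 eps1 cf bf)). Qed.

Lemma wave_labelP p : L p + fhat eps f (p.1, L p) = p.2.
Proof. exact: (labelP d4 Fle Fy). Qed.

(** The shear is the identity outside the channel. *)
Lemma wave_label_le1 p : ch p -> `|L p| <= 1.
Proof.
move=> [_ /=]; rewrite in_itv/= => /andP[p1 p2].
have E := wave_labelP p; rewrite ler_norml; apply/andP; split; rewrite leNgt; apply/negP => h.
  move: E; rewrite (fhat_neg eps0 eps1 cf) ?(fpos_top eps0 eps1 cf); lra.
by move: E; rewrite fhat_pos ?(fpos_top eps0 eps1 cf); lra.
Qed.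

Lemma wave_u_lipschitz : lipschitz_plane 6 U.
Proof.
move=> p q; have h1 := wave_label_lipschitz p q.
have h2 := varpi_lipschitz eps0 eps1 (L p) (L q).
rewrite /wave_u.
have -> : varpi eps (L p) + 2 * p.2 - (varpi eps (L q) + 2 * q.2) =
  (varpi eps (L p) - varpi eps (L q)) + 2 * (p.2 - q.2) by ring.
have := ler_normD (varpi eps (L p) - varpi eps (L q)) (2 * (p.2 - q.2)).
rewrite normrM (ger0_norm (ler0n R 2)).
by have := normr_ge0 (p.1 - q.1); lra.
Qed.

Lemma wave_u_periodic x y : U (x + 2 * pi, y) = U (x, y).
Proof. by rewrite /wave_u wave_label_periodic. Qed.

Lemma wave_u_le p : `|U p| <= 3 * eps.
Proof.
have h1 := varpi_near_linear eps0 eps1 (L p); have E := wave_labelP p.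
have h2 := Fle (p.1, L p); rewrite /wave_u.
have e0 := eps0; have D := d16.
by move: h1 h2; rewrite !ler_norml; lra.
Qed.

Lemma wave_label_derive p v : open_outer eps (L p) -> `|v.1| <= 1 -> `|v.2| <= 1 ->
  is_derive p v L ((v.2 - hat_dx f (p.1, L p) * v.1) / (1 + hat_dy f (p.1, L p))).
Proof.
move=> pO v1 v2.
apply: (is_derive_label d0 d4 Fle Fx Fy) => //.
  exact: (fhat_total_derivative alpha0 eps0 eps1 cf bf).
by apply: le_trans d4; exact: (hat_dy_le bf).
Qed.

Lemma hat_dy_gt0 p : open_outer eps (L p) -> 3 / 4 <= 1 + hat_dy f (p.1, L p).
Proof.
move=> pO; have := d4; have : `|hat_dy f (p.1, L p)| <= d by exact: (hat_dy_le bf).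
by rewrite ler_norml; lra.
Qed.

Lemma hat_partial_le i p : open_outer eps p.2 -> `|hat_partial i f p| <= d.
Proof.
case: i => op; first exact: (hat_dy_le bf).
apply: le_trans _ (@C1ab_grad _ _ _ _ _ bf (p.1, `|p.2|) false op).
by rewrite /hat_partial /hat_dx normrM ler_piMl// normr_sg; case: eqP.
Qed.

Lemma wave_label_near p (r : R) : 0 < r -> \forall q \near p, `|L q - L p| < r.
Proof.
move=> r0; have cL := lipschitz_plane_continuous wave_label_lipschitz.
have /cvgrPdist_lt/(_ _ r0) := cL p.
by apply: filterS => q; rewrite distrC.
Qed.

(** The local formula for [varpi] reduces [wave_u] to an affine function of [L]. *)
Lemma wave_u_derive_aux p v (k c l r : R) : 0 < r ->
  (forall t, `|t - L p| < r -> varpi eps t = k * t + c) ->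
  is_derive p v (fun q => k * L q) (k * l) ->
  is_derive p v U (k * l + 2 * v.2).
Proof.
move=> r0 Hr dL.
apply: (@is_derive_near_eq _ _ (fun q => k * L q + c + 2 * q.2)).
  by have := wave_label_near p r0; apply: filterS => q /Hr; rewrite /wave_u => ->.
have -> : (fun q => k * L q + c + 2 * q.2) =
    (fun q => k * L q) + cst c + (2 *: (snd : R * R -> R)) by apply/funext.
have h1 : is_derive p v ((fun q => k * L q) + cst c) (k * l + 0) by exact: is_deriveD.
have h2 : is_derive p v (2 *: (snd : R * R -> R)) (2 * v.2).
  exact: (@is_deriveZ _ _ _ snd 2 p v v.2 (is_derive_snd p v)).
have := @is_deriveD _ _ _ _ _ p v _ _ h1 h2.
by rewrite addr0.
Qed.

Lemma dir_le1 i : `|(dir R i).1| <= 1 /\ `|(dir R i).2| <= 1.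
Proof. by case: i; rewrite /dir/= normr0 normr1. Qed.

Lemma wave_u_derive_outer i p : open_outer eps (L p) ->
  is_derive p (dir R i) U (wave_g i f p).
Proof.
move=> pO; have [c [r [r0 Hr]]] := varpi_local_outer eps0 eps1 pO.
have dL : is_derive p (dir R i) L _ := wave_label_derive pO
  (dir_le1 i).1 (dir_le1 i).2.
have dL2 := @is_deriveZ _ _ _ L (- 2) _ _ _ dL.
have := wave_u_derive_aux r0 Hr dL2; rewrite /wave_g /= pO.
have P0 := hat_dy_gt0 pO; rewrite /hat_partial.
have ne : 1 + hat_dy f (p.1, L p) != 0 by rewrite gt_eqF// (lt_le_trans _ P0).
by case: i {dL dL2} => /=; congr is_derive; field.
Qed.

Lemma wave_u_derive_mid i p : a < `|L p| < b -> is_derive p (dir R i) U (wave_g i f p).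
Proof.
move=> pM; have [c [r [r0 Hr]]] := varpi_local_mid eps0 eps1 pM.
have dL2 : is_derive p (dir R i) (fun q => 0 * L q) (0 * 0).
  rewrite (_ : (fun q => 0 * L q) = cst 0) ?mul0r; first exact: is_derive_cst.
  by apply/funext => q; rewrite mul0r.
have := wave_u_derive_aux r0 Hr dL2; rewrite /wave_g /= ifF; last first.
  by case/andP: pM => h1 h2; rewrite /open_outer !ltNge (ltW h1) (ltW h2) andbF.
have -> : a <= `|L p| <= b by case/andP: pM => /ltW -> /ltW ->.
by rewrite mul0r add0r; case: i {dL2} => /=; rewrite ?mulr1 ?mulr0.
Qed.

(** The preimage of the corners of [varpi] and of the boundary of the channel. *)
Definition wave_corners : set (R * R) :=
  \big[setU/set0]_(c <- [:: 0; a; b; 1; - a; - b; - 1]) [set p | L p = c].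

Lemma measurable_wave_corners : measurable wave_corners.
Proof.
rewrite /wave_corners; apply: bigsetU_measurable => c _.
rewrite -[X in measurable X]setTI.
have mL := lipschitz_plane_measurable wave_label_lipschitz.
exact: (mL measurableT [set c]).
Qed.

Lemma leb2_wave_corners : leb2 R wave_corners = 0%E.
Proof.
apply: measure_negligible; first exact: measurable_wave_corners.
rewrite /wave_corners; elim/big_ind: _ => [|A B nA nB|c _].
- exact: negligible_set0.
- exact: negligibleU.
apply/negligibleP; last exact: (leb2_label_level d4 Fle Fy c).
rewrite -[X in measurable X]setTI.
have mL := lipschitz_plane_measurable wave_label_lipschitz.
exact: (mL measurableT [set c]).
Qed.

Lemma wave_u_derive i p : ch p -> ~ wave_corners p -> is_derive p (dir R i) U (wave_g i f p).
Proof.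
move=> cp nN; have L1 := wave_label_le1 cp.
have ne c : c \in [:: 0; a; b; 1] -> `|L p| != c.
  move=> cI; apply/eqP => E; apply: nN; rewrite /wave_corners -bigcup_seq.
  have [h|h] := leP 0 (L p).
    exists c => /=; last by rewrite -E ger0_norm.
    by move: cI; rewrite !inE => /or4P[] ->; rewrite ?orbT.
  exists (- c) => /=; last by rewrite -E ltr0_norm// opprK.
  by move: cI; rewrite !inE => /or4P[] /eqP ->; rewrite ?oppr0 !eqxx ?orbT.
have n0 := ne 0 ltac:(by rewrite !inE eqxx).
have na := ne a ltac:(by rewrite !inE eqxx ?orbT).
have nb := ne b ltac:(by rewrite !inE eqxx ?orbT).
have n1 := ne 1 ltac:(by rewrite !inE eqxx ?orbT).
have y0 : 0 < `|L p| by rewrite lt_neqAle eq_sym n0 normr_ge0.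
have y1 : `|L p| < 1 by rewrite lt_neqAle n1.
move: na; rewrite neq_lt => /orP[ya|ya].
  by apply: wave_u_derive_outer; rewrite /open_outer y0 ya.
move: nb; rewrite neq_lt => /orP[yb|yb].
  by apply: wave_u_derive_mid; rewrite ya yb.
by apply: wave_u_derive_outer; rewrite /open_outer yb y1 orbT.
Qed.

Lemma wave_g_le i p : `|wave_g i f p| <= if a <= `|L p| <= b then 2 else 4 * d.
Proof.
have [/andP[a0 ab'] b1] := ab; have D0 := d0; have D4 := d4.
rewrite /wave_g/=; case: ifPn => pO.
  have -> : (a <= `|L p| <= b) = false.
    by apply/negP => /andP[h1 h2]; move: pO; rewrite /open_outer => /orP[] /andP[]; lra.
  have P0 := hat_dy_gt0 pO.
  rewrite normrM normfV [`|1 + _|]gtr0_norm; last by apply: lt_le_trans P0; lra.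
  rewrite ler_pdivrMr; last by apply: lt_le_trans P0; lra.
  have : `|hat_partial i f (p.1, L p)| <= d by exact: hat_partial_le.
  by rewrite normrM (ger0_norm (ler0n R 2)); nra.
by case: (a <= `|L p| <= b); case: (i) => /=; rewrite ?normr0 ?ger0_norm//; lra.
Qed.

(** The derivatives of [f] are not known to be measurable off the open region, but
    [wave_g] is the pointwise limit of difference quotients of the Lipschitz function
    [wave_u], cut off to the outer regions, plus a constant on the middle layers. *)
Lemma measurable_wave_g i : measurable_fun setT (wave_g i f).
Proof.
have mL := lipschitz_plane_measurable wave_label_lipschitz.
have mU := lipschitz_plane_measurable wave_u_lipschitz.
have mnL : measurable_fun setT (fun p => `|L p|) by exact: measurableT_comp.
have mO : measurable [set p | open_outer eps (L p)].
  rewrite (_ : [set p | _] = (fun p => `|L p|) @^-1` (`]0, a[ `|` `]b, 1[)%classic).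
    rewrite -[X in measurable X]setTI; apply: mnL => //.
    by apply: measurableU; exact: measurable_itv.
  apply/seteqP; split=> p /=; rewrite /open_outer !in_itv/=; first by move/orP.
  by move=> H; apply/orP.
have mM : measurable [set p | a <= `|L p| <= b].
  rewrite (_ : [set p | _] = (fun p => `|L p|) @^-1` `[a, b]%classic).
    by rewrite -[X in measurable X]setTI; apply: mnL => //; exact: measurable_itv.
  by apply/seteqP; split=> p /=; rewrite in_itv.
pose e n : R * R := (n.+1%:R^-1 : R) *: dir R i.
pose h n p := \1_[set p | open_outer eps (L p)] p * (n.+1%:R * (U (e n + p) - U p)) +
  (if i then 2 else 0) * \1_[set p | a <= `|L p| <= b] p.
have mh n : measurable_fun setT (h n).
  apply: measurable_funD; apply: measurable_funM => //; try exact: measurable_indic.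
  apply: measurable_funM => //; apply: measurable_funB => //.
  apply: (@lipschitz_plane_measurable _ 6) => p q.
  apply: le_trans (wave_u_lipschitz _ _) _.
  have E (s t t' : R) : s + t - (s + t') = t - t' by ring.
  by rewrite /= !E.
apply: (measurable_fun_cvg mh) => p _.
rewrite /h /wave_g/= !indicE.
have [pO|pO] := boolP (open_outer eps (L p)).
  have -> : (p \in [set p | a <= `|L p| <= b]) = false.
    apply/negP; rewrite inE/= => /andP[h1 h2].
    by move: pO; rewrite /open_outer => /orP[] /andP[]; lra.
  rewrite mem_set// mulr0.
  have := derive_seq_cvg (wave_u_derive_outer i pO); rewrite /wave_g/= pO.
  apply: cvg_trans; apply: near_eq_cvg; apply: nearW => n.
  by rewrite mul1r addr0.
rewrite memNset; last exact/negP.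
have E : (if i then 2 else 0) * (p \in [set p | a <= `|L p| <= b])%:R =
    (if i && (a <= `|L p| <= b) then 2 else 0) :> R.
  case: (i) => /=; rewrite ?mul0r//.
  by case: ifPn => M; [rewrite mem_set// mulr1|rewrite memNset ?mulr0//; exact/negP].
rewrite E (_ : (fun _ => _) = cst (if i && (a <= `|L p| <= b) then 2 else 0)).
  exact: cvg_cst.
by apply/funext => n; rewrite /= mulr0n mul0r add0r.
Qed.

Lemma wave_weak_partial i : weak_partial i U (wave_g i f).
Proof.
apply: (@weak_partial_lipschitz _ i U (wave_g i f) 6 2 wave_corners).
- exact: wave_u_lipschitz.
- exact: wave_u_periodic.
- exact: measurable_wave_g.
- move=> p _; apply: le_trans (wave_g_le i p) _.
  by case: ifP => _ //; have := d4; lra.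
- exact: measurable_wave_corners.
- exact: leb2_wave_corners.
- exact: wave_u_derive.
Qed.
End Wave.

(** * Elementary inequalities *)

Section RealEstimates.
Variable R : realType.
Implicit Types (P Q h u v t z th x y : R).

Lemma quotient_difference P P' Q Q' h : `|P| <= 4^-1 -> `|P'| <= 4^-1 ->
  `|Q| <= 4^-1 -> `|Q'| <= 4^-1 -> `|P - P'| <= h -> `|Q - Q'| <= h ->
  `|2 * P / (1 + Q) - 2 * P' / (1 + Q')| <= 6 * h.
Proof.
move=> hP hP' hQ hQ' dP dQ.
have /andP[q1 q2] : - 4^-1 <= Q <= 4^-1 by rewrite -ler_norml.
have /andP[q1' q2'] : - 4^-1 <= Q' <= 4^-1 by rewrite -ler_norml.
have Q0 : 0 < 1 + Q by lra.
have Q0' : 0 < 1 + Q' by lra.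
have h0 : 0 <= h by apply: le_trans dP.
have -> : 2 * P / (1 + Q) - 2 * P' / (1 + Q') =
   2 * ((P - P') * (1 + Q') - P' * (Q - Q')) / ((1 + Q) * (1 + Q')).
  by field; rewrite !gt_eqF.
rewrite normrM normfV (gtr0_norm (mulr_gt0 Q0 Q0')) ler_pdivrMr ?mulr_gt0//.
have m1 : 9 / 16 <= (1 + Q) * (1 + Q') by nra.
have m2 : `|(P - P') * (1 + Q')| <= h * (5 / 4).
  by rewrite normrM (gtr0_norm Q0') ler_pM ?normr_ge0 ?(ltW Q0')//; lra.
have m3 : `|P' * (Q - Q')| <= 4^-1 * h by rewrite normrM ler_pM ?normr_ge0.
have m4 := ler_normB ((P - P') * (1 + Q')) (P' * (Q - Q')).
have m5 : `|(P - P') * (1 + Q') - P' * (Q - Q')| <= 3 / 2 * h by lra.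
have m6 : 6 * h * (9 / 16) <= 6 * h * ((1 + Q) * (1 + Q')).
  by rewrite ler_wpM2l// mulr_ge0.
rewrite normrM (@ger0_norm _ 2)//; lra.
Qed.

(** This is where [alpha >= 1/2] enters: for [z <= 1] the left-hand side is at most
    [z]. The range up to 40 covers [40 * 2 ^- n], the largest distance to which the
    Hoelder bound is applied at scale [n]. *)
Lemma powR_double_le (al z : R) : 2^-1 <= al < 1 -> 0 <= z <= 40 -> (z `^ al) ^+ 2 <= 40 * z.
Proof.
move=> /andP[al1 al2] /andP[z0 z40].
have Z2 : z = (z `^ 2^-1) ^+ 2 by rewrite powR12_sqrt// sqr_sqrtr.
have [z1|z1] := leP z 1.
  have [->|zn] := eqVneq z 0.
    by rewrite powR0 ?expr0n/= ?mulr0// gt_eqF//; lra.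
  have zp : 0 < z by rewrite lt_neqAle eq_sym zn.
  apply: (@le_trans _ _ z); last lra.
  rewrite {2}Z2; apply: lerXn2r; rewrite ?nnegrE ?powR_ge0//.
  by apply: ger_powR => //; rewrite zp.
apply: (@le_trans _ _ (z ^+ 2)); last by rewrite expr2 ler_wpM2r.
apply: lerXn2r; rewrite ?nnegrE ?powR_ge0//.
by rewrite -{2}(powRr1 z0); apply: ler_powR; [exact: ltW|exact: ltW].
Qed.

(** The minimum is its own geometric mean. *)
Lemma min_interpolation th x z : 0 <= th <= 1 -> 0 < x -> 0 < z ->
  Num.min x z <= x `^ th * z `^ (1 - th).
Proof.
move=> /andP[th0 th1] x0 z0; set m := Num.min x z.
have m0 : 0 < m by rewrite lt_min x0.
have -> : m = m `^ th * m `^ (1 - th).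
  by rewrite -powRD ?(gt_eqF m0) ?implybT// addrC subrK powRr1// ltW.
apply: ler_pM; rewrite ?powR_ge0//; apply: ge0_ler_powR; rewrite ?nnegrE ?(ltW x0) ?(ltW z0) ?(ltW m0) ?subr_ge0//.
  by rewrite ge_min lexx.
by rewrite ge_min lexx orbT.
Qed.

Lemma dyad_powR n (r : R) : dyad R n `^ r = (2^-1 `^ r) ^+ n.
Proof.
rewrite /dyad -[2^-1 ^+ n]powR_mulrn ?invr_ge0// -powRrM mulrC powRrM powR_mulrn//.
Qed.

(** The ratio of the geometric series in [gagliardo_dyadic], for a modulus of order
    [r `^ (1 - th)]. *)
Lemma half_powR_lt1 (r s : R) : 2 * s < r -> 4 `^ s * 2^-1 `^ r < 1.
Proof.
move=> sr; have -> : 4 `^ s = 2 `^ (2 * s) :> R.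
  by rewrite powRrM (_ : 2 `^ 2 = 4)// (powR_mulrn 2)// expr2 -natrM.
rewrite -(powR_inv1 (ler0n R 2)) -powRrM mulN1r -powRD; last by rewrite pnatr_eq0 implybT.
rewrite lt_neqAle powR_eq1 -[X in _ <= X](powRr0 2) ler_powR ?ler1n ?andbT//; last lra.
by apply/negP => /or3P[/eqP|/ltW|/eqP]; lra.
Qed.

Definition near_corner (a b t u : R) : bool :=
  [|| `| `|u| - 0| <= t, `| `|u| - a| <= t, `| `|u| - b| <= t
    | `| `|u| - 1| <= t].

(** If [X] and [Y] do not lie in the same region, one of the corners 0, a, b, 1
    separates [|X|] from [|Y|], or [X] and [Y] have opposite signs and 0 separates
    them; the separating corner is then within [t] of both. *)
Lemma label_dichotomy (a b X Y t : R) : 0 < a < b -> b < 1 -> `|X| <= 1 -> `|Y| <= 1 ->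
  `|X - Y| <= t ->
  [\/ [/\ (0 < `|X| < a) || (b < `|X| < 1), (0 < `|Y| < a) || (b < `|Y| < 1) &
          Num.sg X = Num.sg Y],
      a <= `|X| <= b /\ a <= `|Y| <= b |
      near_corner a b t X /\ near_corner a b t Y].
Proof.
move=> /andP[a0 ab] b1 X1 Y1 XY.
have key : `| `|X| - `|Y| | <= t by apply: le_trans XY; exact: ler_dist_dist.
have [h1 h2] : `|X| - `|Y| <= t /\ `|Y| - `|X| <= t.
  by split; apply: le_trans key; rewrite ?ler_norm// distrC ler_norm.
have crn (c : R) : `|X| <= c <= `|Y| \/ `|Y| <= c <= `|X| -> `| `|X| - c| <= t /\ `| `|Y| - c| <= t.
  by move=> [] /andP[? ?]; split; rewrite ler_norml; apply/andP; split; lra.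
have X0 := normr_ge0 X; have Y0 := normr_ge0 Y.
have atc (c : R) : c \in [:: 0; a; b; 1] -> `|X| <= c <= `|Y| \/ `|Y| <= c <= `|X| ->
    near_corner a b t X /\ near_corner a b t Y.
  move=> cI /crn[k1 k2]; move: cI; rewrite !inE /near_corner.
  by move=> /or4P[] /eqP <-; rewrite k1 k2 ?orbT.
have in4 (c : R) : c \in [:: 0; a; b; 1] = [|| c == 0, c == a, c == b | c == 1] by rewrite !inE.
have [X00|Xn] := eqVneq X 0.
  by apply: Or33; apply: (atc 0); rewrite ?in4 ?eqxx// X00 normr0 lexx Y0; left.
have [Y00|Yn] := eqVneq Y 0.
  by apply: Or33; apply: (atc 0); rewrite ?in4 ?eqxx// Y00 normr0 lexx X0; right.
have Xp : 0 < `|X| by rewrite normr_gt0.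
have Yp : 0 < `|Y| by rewrite normr_gt0.
have [X11|Xn1] := leP 1 `|X|.
  by apply: Or33; apply: (atc 1); rewrite ?in4 ?eqxx ?orbT// X11 Y1; right.
have [Y11|Yn1] := leP 1 `|Y|.
  by apply: Or33; apply: (atc 1); rewrite ?in4 ?eqxx ?orbT// Y11 X1; left.
have [sXY|sXY] := eqVneq (Num.sg X) (Num.sg Y); last first.
  have E : `|X - Y| = `|X| + `|Y|.
    have [x0|x0] := ltP X 0; have [y0|y0] := ltP Y 0.
    - by move: sXY; rewrite (ltr0_sg x0) (ltr0_sg y0) eqxx.
    - by rewrite (ltr0_norm x0) (ger0_norm y0) ler0_norm; lra.
    - by rewrite (ger0_norm x0) (ltr0_norm y0) ger0_norm; lra.
    have x0' : 0 < X by rewrite lt_neqAle eq_sym Xn.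
    have y0' : 0 < Y by rewrite lt_neqAle eq_sym Yn.
    by move: sXY; rewrite (gtr0_sg x0') (gtr0_sg y0') eqxx.
  by apply: Or33; rewrite /near_corner !subr0 !normr_id; split; apply/orP; left; lra.
have [Xa|Xa] := ltP `|X| a.
  have [Ya|Ya] := ltP `|Y| a.
    by apply: Or31; rewrite Xp Yp.
  by apply: Or33; apply: (atc a); rewrite ?in4 ?eqxx ?orbT// Ya (ltW Xa); left.
have [Xb|Xb] := leP `|X| b; last first.
  have [Yb|Yb] := leP `|Y| b; last by apply: Or31; rewrite !orbT.
  by apply: Or33; apply: (atc b); rewrite ?in4 ?eqxx ?orbT// Yb (ltW Xb); right.
have [Ya|Ya] := ltP `|Y| a.
  by apply: Or33; apply: (atc a); rewrite ?in4 ?eqxx ?orbT// Xa (ltW Ya); right.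
have [Yb|Yb] := leP `|Y| b; first by apply: Or32.
by apply: Or33; apply: (atc b); rewrite ?in4 ?eqxx ?orbT// Xb (ltW Yb); left.
Qed.
End RealEstimates.

(** * Integrals of step functions on the channel *)

Lemma leb2_channel_le (R : realType) : (leb2 R (@channel R) <= 16%:E)%E.
Proof. by rewrite leb2_channel lee_fin; have := @pihalf_lt2 R; lra. Qed.

Lemma integral_channel_indic (R : realType) (A B : set (R * R)) (k1 k2 k3 m1 m2 : R) :
  measurable A -> measurable B -> 0 <= k1 -> 0 <= k2 -> 0 <= k3 ->
  (leb2 R (channel (R:=R) `&` A) <= m1%:E)%E -> (leb2 R (channel (R:=R) `&` B) <= m2%:E)%E ->
  (\int[leb2 R]_(p in channel (R:=R)) (k1 * (\1_A p : R) + k2 * (\1_B p : R) + k3)%:E <=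
    (k1 * m1 + k2 * m2 + 16 * k3)%:E)%E.
Proof.
move=> mA mB k10 k20 k30 hA hB.
have mC := @measurable_channel R.
have mI (S : set (R * R)) : measurable S -> measurable_fun (@channel R) (fun p => (\1_S p : R)%:E).
  by move=> mS; apply/measurable_EFinP; exact: measurable_indic.
have I (S : set (R * R)) (k m : R) : measurable S -> 0 <= k -> (leb2 R (channel (R:=R) `&` S) <= m%:E)%E ->
   (\int[leb2 R]_(p in channel (R:=R)) (k%:E * (\1_S p : R)%:E) <= (k * m)%:E)%E.
  move=> mS k0 hS.
  rewrite (@ge0_integralZl_EFin _ _ R (leb2 R) (@channel R) mC (fun p => (\1_S p : R)%:E)
    (fun p _ => _) (mI S mS))//.
  rewrite (@integral_indic _ _ R (leb2 R) (@channel R) mC S mS) setIC EFinM.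
  by apply: lee_wpmul2l => //; rewrite lee_fin.
under eq_integral do rewrite !EFinD !EFinM.
have i0 (S : set (R * R)) (k : R) p : 0 <= k -> (0%R <= k%:E * (\1_S p : R)%:E)%E.
  by move=> k0; rewrite -EFinM lee_fin mulr_ge0.
have mZ (S : set (R * R)) (k : R) : measurable S -> measurable_fun (@channel R) (fun p => k%:E * (\1_S p : R)%:E)%E.
  by move=> mS; apply: measurable_funeM; exact: mI.
have m12 : measurable_fun (@channel R) (fun p => k1%:E * (\1_A p : R)%:E + k2%:E * (\1_B p : R)%:E)%E.
  by apply: emeasurable_funD; exact: mZ.
have pc p : @channel R p -> (0%R <= cst k3%:E p)%E by rewrite lee_fin.
have p12 p : @channel R p -> (0%R <= k1%:E * (\1_A p : R)%:E + k2%:E * (\1_B p : R)%:E)%E.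
  by move=> _; rewrite adde_ge0 ?i0.
rewrite (@ge0_integralD _ _ R (leb2 R) (@channel R) mC _ (cst k3%:E) p12 m12
  pc (measurable_cst _)).
rewrite (@ge0_integralD _ _ R (leb2 R) (@channel R) mC (fun p => k1%:E * (\1_A p : R)%:E)%E
  (fun p => k2%:E * (\1_B p : R)%:E)%E (fun p _ => i0 A k1 p k10) (mZ A k1 mA)
  (fun p _ => i0 B k2 p k20) (mZ B k2 mB)).
rewrite !EFinD; apply: leeD; first by apply: leeD; exact: I.
rewrite (@integral_cst _ _ R (leb2 R) (@channel R) mC) mulrC EFinM.
by apply: lee_wpmul2l; [rewrite lee_fin|exact: leb2_channel_le].
Qed.

(** * Increments of the perturbation and of its gradient *)

Section WaveEstimates.
Variables (R : realType) (alpha eps : R).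
Local Notation ch := (@channel R).
Implicit Types (x y : R) (p q v : R * R) (i : bool).
Local Notation a := (ya eps).
Local Notation b := (yb eps).
Variables (f : R * R -> R) (d : R).
Hypothesis (alpha2 : 2^-1 <= alpha < 1).
Hypotheses (eps0 : 0 < eps) (eps1 : eps < 1).
Hypothesis (cf : C1alpha_0even alpha eps f).
Hypothesis (bf : C1alpha_bounded alpha eps f d).
Hypothesis (d16 : d <= eps / 16).
Let alpha0 : 0 < alpha. Proof. by have := alpha2; lra. Qed.
Let ab : 0 < a < b /\ b < 1 := ab_bounds eps0 eps1.
Let d0 : 0 <= d := C1alpha_bounded_ge0 eps0 eps1 bf.
Let d4 : d <= 4^-1. Proof. by have := eps1; have := d16; lra. Qed.
Local Notation L := (wave_label eps f).
Local Notation U := (wave_u eps f).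
Local Notation G i := (wave_g eps i f).
Let Lper x y : L (x + 2 * pi, y) = L (x, y).
Proof. exact: wave_label_periodic eps0 eps1 cf bf d16 x y. Qed.
Let Llip : lipschitz_plane 2 L.
Proof. exact: wave_label_lipschitz eps0 eps1 cf bf d16. Qed.

(** The reflection [y |-> |y|] does not increase distances, and the Hoelder bound
    holds across the two components of the outer region; only the sign in [hat_dx]
    must agree. *)
Lemma hat_partial_holder i p q : open_outer eps p.2 -> open_outer eps q.2 ->
  Num.sg p.2 = Num.sg q.2 ->
  `|hat_partial i f p - hat_partial i f q| <= d * (`|p.1 - q.1| + `|p.2 - q.2|) `^ alpha.
Proof.
move=> op oq spq.
have key : `|'D_(dir R i) f (p.1, `|p.2|) - 'D_(dir R i) f (q.1, `|q.2|)| <=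
    d * (`|p.1 - q.1| + `|p.2 - q.2|) `^ alpha.
  apply: le_trans (@C1ab_holder _ _ _ _ _ bf (p.1, `|p.2|) (q.1, `|q.2|) i op oq) _.
  rewrite ler_wpM2l//; apply: ge0_ler_powR; rewrite ?nnegrE ?(ltW alpha0) ?addr_ge0 ?sqrtr_ge0//.
  by apply: le_trans (dist2_le _ _) _; rewrite lerD2l; exact: ler_dist_dist.
case: i key => // key; rewrite /hat_partial /hat_dx spq -mulrBr normrM.
apply: le_trans _ key; rewrite ler_piMl// normr_sg; case: eqP => _ //=.
Qed.

Lemma derive_periodic i x y : Omega_int eps (x, y) ->
  'D_(dir R i) f (x + 2 * pi, y) = 'D_(dir R i) f (x, y).
Proof.
move=> oxy; have -> : 'D_(dir R i) f (x + 2 * pi, y) =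
    'D_(dir R i) (fun p : R * R => f (p + ((2 * pi, 0) : R * R))) (x, y).
  have E (u : R * R) : f (u + (x + 2 * pi, y)) = f (u + (x, y) + ((2 * pi, 0) : R * R)).
    by congr f; apply/pair_equal_spec; split => /=; rewrite ?addr0// addrA.
  have E0 : f (x + 2 * pi, y) = f ((x, y) + ((2 * pi, 0) : R * R)).
    by have := E 0; rewrite !add0r.
  rewrite /derive E0; set F1 := (X in lim (X @ _)); set F2 := (X in _ = lim (X @ _)).
  suff -> : F1 = F2 by [].
  by apply/funext => h; rewrite /F1 /F2 /= E.
apply: near_eq_derive; have [r r0 Hr] := Omega_int_radius oxy.
have : \forall p \near (x, y), `|p.2 - y| < r.
  exists (setT, [set t | `|t - y| < r]) => /=; last by move=> p [].
  split; first exact: filterT.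
  by exists r => //= t /=; rewrite distrC.
apply: filterS => -[x' y'] /= /(Hr x') o.
rewrite (_ : (x', y') + (2 * pi, 0) = (x' + 2 * pi, y')); last by apply/pair_equal_spec; split => //=; rewrite addr0.
apply: (C1a_periodic cf); move: o; rewrite /Omega_int/outer/= => /orP[|] /andP[h1 h2].
  by rewrite h2 (ltW h1).
by rewrite h1 (ltW h2) orbT.
Qed.

Lemma wave_g_periodic i x y : G i (x + 2 * pi, y) = G i (x, y).
Proof.
rewrite /wave_g/= Lper; case: ifP => // o.
have D j : 'D_(dir R j) f (x + 2 * pi, `|L (x, y)|) = 'D_(dir R j) f (x, `|L (x, y)|).
  exact: derive_periodic.
have Dy : hat_dy f (x + 2 * pi, L (x, y)) = hat_dy f (x, L (x, y)) := D true.
have Dx : hat_dx f (x + 2 * pi, L (x, y)) = hat_dx f (x, L (x, y)).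
  exact: (congr1 (fun z => Num.sg (L (x, y)) * z) (D false)).
by case: i; rewrite /hat_partial ?Dx Dy.
Qed.

Lemma wave_g_dichotomy i p q t : `|L p| <= 1 -> `|L q| <= 1 -> `|L p - L q| <= t ->
  `|G i p - G i q| <= 6 * (d * (`|p.1 - q.1| + t) `^ alpha) \/
  near_corner a b t (L p) /\ near_corner a b t (L q).
Proof.
move=> p1 q1 pq; have h0 : 0 <= 6 * (d * (`|p.1 - q.1| + t) `^ alpha).
  by rewrite !mulr_ge0 ?powR_ge0.
have [ab1 b1] := ab; have [[op oq spq]|[mp mq]|nn] := label_dichotomy ab1 b1 p1 q1 pq; last by right.
- left; rewrite /wave_g/= /open_outer op oq.
  have hold j : `|hat_partial j f (p.1, L p) - hat_partial j f (q.1, L q)| <=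
      d * (`|p.1 - q.1| + t) `^ alpha.
    apply: le_trans (hat_partial_holder j _ _ _) _ => //=.
    rewrite ler_wpM2l//; apply: ge0_ler_powR; rewrite ?nnegrE ?(ltW alpha0) ?addr_ge0//.
      exact: le_trans pq.
    by rewrite lerD2l.
  have small j r : open_outer eps (L r) -> `|hat_partial j f (r.1, L r)| <= 4^-1.
    by move=> o; apply: le_trans d4; exact: (hat_partial_le bf).
  by apply: quotient_difference; [exact: small|exact: small|exact: (small true)|
    exact: (small true)|exact: hold|exact: (hold true)].
left; suff -> : G i p = G i q by rewrite subrr normr0.
have no r : a <= `|L r| <= b -> open_outer eps (L r) = false.
  by move=> /andP[m1 m2]; apply/negP; rewrite /open_outer => /orP[] /andP[]; lra.
by rewrite /wave_g/= !no// mp mq.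
Qed.

(** The distance of the cylinder is that of the plane after a shift by a period, and
    the functions at hand are periodic: see [shift_periodic]. *)
Lemma channel_shift p q rho : ch p -> ch q -> distT p q <= rho ->
  exists k : R, [/\ k = 0 \/ k = 2 * pi \/ k = - (2 * pi),
     `|p.1 - (q.1 + k)| <= rho & `|p.2 - q.2| <= rho].
Proof.
move=> cp cq pq; have [[h|[h|h]] h2] := distT_near_pairs cp cq pq.
- by exists 0; split; [left|rewrite addr0|].
- by exists (2 * pi); split; [right; left|rewrite opprD addrA|].
- by exists (- (2 * pi)); split; [right; right|rewrite opprD opprK addrA|].
Qed.

Lemma shift_periodic (F : R * R -> R) q k : (forall x y, F (x + 2 * pi, y) = F (x, y)) ->
  k = 0 \/ k = 2 * pi \/ k = - (2 * pi) -> F (q.1 + k, q.2) = F q.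
Proof.
move=> Fper; case: q => q1 q2 /= [->|[->|->]]; first by rewrite addr0.
  exact: Fper.
by rewrite -Fper subrK.
Qed.

(** Labels of points at distance [8 * 2 ^- n] differ by at most [32 * 2 ^- n]: 16 for
    the l^1 distance, times the Lipschitz constant 2 of the label. *)
Definition corner_zone n : set (R * R) := [set p | near_corner a b (32 * dyad R n) (L p)].
Definition layer_zone : set (R * R) := [set p | a <= `|L p| <= b].

(** Near a corner [2 * wave_g ^+ 2] is at most 8 in the middle layers and [32 d^2]
    elsewhere. The last term bounds the square of the Hoelder estimate
    [6 * d * (40 * 2 ^- n) `^ alpha]. *)
Definition wave_modulus n p : R := 8 * (\1_(corner_zone n `&` layer_zone) p : R) +
  32 * d ^+ 2 * (\1_(corner_zone n) p : R) + (240 * d) ^+ 2 * dyad R n.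

Lemma wave_modulus_ge0 n p : 0 <= wave_modulus n p.
Proof.
rewrite /wave_modulus !indicE; apply: addr_ge0; first apply: addr_ge0.
- by apply: mulr_ge0.
- by apply: mulr_ge0 => //; apply: mulr_ge0 => //; exact: sqr_ge0.
by apply: mulr_ge0; [exact: sqr_ge0|rewrite ltW// dyad_gt0].
Qed.

Lemma wave_g_increment i n p q : ch p -> ch q -> distT p q <= 8 * dyad R n ->
  (G i p - G i q) ^+ 2 <= wave_modulus n p + wave_modulus n q.
Proof.
move=> cp cq pq; have D0 := dyad_gt0 R n; have D1 := dyad_le1 R n.
have [k [kper k1 k2]] := channel_shift cp cq pq.
pose q' : R * R := (q.1 + k, q.2).
have EG : G i q' = G i q by apply: shift_periodic kper; exact: wave_g_periodic.
have EL : L q' = L q by apply: shift_periodic kper.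
have Lp := wave_label_le1 eps0 eps1 cf bf d16 cp.
have Lq := wave_label_le1 eps0 eps1 cf bf d16 cq.
have Lpq : `|L p - L q'| <= 32 * dyad R n.
  by apply: le_trans (Llip p q') _; rewrite /q'/=; lra.
have H0 r := wave_modulus_ge0 n r.
rewrite -EG; rewrite -EL in Lq.
have [hold|[np nq]] := wave_g_dichotomy i Lp Lq Lpq.
  apply: (@le_trans _ _ ((240 * d) ^+ 2 * dyad R n)); last first.
    rewrite -[leLHS]addr0 lerD ?H0// /wave_modulus !indicE lerDr.
    by rewrite addr_ge0// mulr_ge0// mulr_ge0// sqr_ge0.
  have z1 : `|p.1 - q'.1| + 32 * dyad R n <= 40 * dyad R n by rewrite /q'/=; lra.
  have z0 : 0 <= `|p.1 - q'.1| + 32 * dyad R n by rewrite addr_ge0// mulr_ge0// ltW.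
  have z2 : 0 <= `|p.1 - q'.1| + 32 * dyad R n <= 40 by rewrite z0/=; lra.
  have h1 := powR_double_le alpha2 z2.
  rewrite -real_normK ?num_real//.
  apply: (@le_trans _ _ ((6 * (d * (`|p.1 - q'.1| + 32 * dyad R n) `^ alpha)) ^+ 2)).
    by rewrite lerXn2r ?nnegrE// ?mulr_ge0 ?powR_ge0.
  rewrite !exprMn; move: h1; set y := _ ^+ 2; move=> h1.
  have d2 : 0 <= d ^+ 2 by exact: sqr_ge0.
  have : d ^+ 2 * y <= d ^+ 2 * (40 * (40 * dyad R n)) by rewrite ler_wpM2l//; lra.
  lra.
have half r : near_corner a b (32 * dyad R n) (L r) -> 2 * (G i r) ^+ 2 <= wave_modulus n r.
  move=> nr; rewrite /wave_modulus !indicE.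
  have -> : r \in corner_zone n by rewrite inE.
  have -> : (r \in corner_zone n `&` layer_zone) = (a <= `|L r| <= b).
    by apply/idP/idP => [|mr]; rewrite inE => //; case.
  have g := wave_g_le eps0 eps1 bf d16 i r.
  have g2 : (G i r) ^+ 2 <= (if a <= `|L r| <= b then 2 else 4 * d) ^+ 2.
    rewrite -real_normK ?num_real// lerXn2r ?nnegrE//; case: ifP => _ //.
    exact: mulr_ge0.
  have d2 : 0 <= d ^+ 2 by exact: sqr_ge0.
  have d3 : 0 <= d ^+ 2 * dyad R n by rewrite mulr_ge0// ltW.
  by move: g2; case: ifP => _ g2; rewrite ?mulr1 ?mulr0; lra.
have := half _ np; have := half _ nq.
rewrite (_ : wave_modulus n q' = wave_modulus n q).
  by have := sqr_ge0 (G i p + G i q'); lra.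
rewrite /wave_modulus !indicE.
have -> : (q' \in corner_zone n) = (q \in corner_zone n).
  by apply/idP/idP; rewrite !inE /corner_zone/= EL.
suff -> : (q' \in corner_zone n `&` layer_zone) = (q \in corner_zone n `&` layer_zone) by [].
by apply/idP/idP; rewrite !inE /corner_zone /layer_zone/= EL.
Qed.

Let mlab c tau := measurable_label_band d4 (fhat_le eps0 eps1 cf bf)
  (fhat_x eps0 eps1 cf bf) (fhat_y eps0 eps1 cf bf d16) c tau.
Let llab c tau := leb2_label_band d4 (fhat_le eps0 eps1 cf bf)
  (fhat_x eps0 eps1 cf bf) (fhat_y eps0 eps1 cf bf d16) c (tau := tau).

Lemma corner_zoneE n : let B c := [set p | `| `|L p| - c| <= 32 * dyad R n] in
  corner_zone n = (B 0%R `|` B a) `|` (B b `|` B 1%R).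
Proof.
apply/seteqP; split => p; rewrite /corner_zone/near_corner/=.
  by move=> /or4P[]; [left; left|left; right|right; left|right; right].
by move=> [[]|[]] ->; rewrite ?orbT.
Qed.

Lemma layer_zoneE : layer_zone = [set p | `| `|L p| - 2^-1| <= eps / 2].
Proof.
apply/seteqP; split => p; rewrite /layer_zone /ya /yb /=; set u := `|L p|.
  by move=> /andP[? ?]; rewrite ler_norml; apply/andP; split; lra.
by rewrite ler_norml => /andP[? ?]; apply/andP; split; lra.
Qed.

Lemma measurable_corner_zone n : measurable (corner_zone n).
Proof. by rewrite corner_zoneE; do ?apply: measurableU; exact: mlab. Qed.

Lemma measurable_layer_zone : measurable layer_zone.
Proof. by rewrite layer_zoneE; exact: mlab. Qed.

Lemma leb2_corner_zone n : (leb2 R (ch `&` corner_zone n) <= (160 * (32 * dyad R n))%:E)%E.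
Proof.
have t0 : 0 <= 32 * dyad R n by rewrite mulr_ge0// ltW// dyad_gt0.
have m c : measurable (ch `&` [set p | `| `|L p| - c| <= 32 * dyad R n]).
  by apply: measurableI; [exact: measurable_channel|exact: mlab].
rewrite corner_zoneE !setIUr.
apply: le_trans (measureU2 _ _ _) _; try by apply: measurableU; exact: m.
have -> : 160 * (32 * dyad R n) = (40 * (32 * dyad R n) + 40 * (32 * dyad R n)) +
   (40 * (32 * dyad R n) + 40 * (32 * dyad R n)) by lra.
rewrite EFinD; apply: leeD; apply: le_trans (measureU2 _ _ _) _; try exact: m;
by rewrite EFinD; apply: leeD; exact: (llab _ t0).
Qed.

Lemma leb2_layer_zone : (leb2 R (ch `&` layer_zone) <= (20 * eps)%:E)%E.
Proof.
rewrite layer_zoneE; have -> : 20 * eps = 40 * (eps / 2) by lra.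
by apply: (llab 2^-1); rewrite divr_ge0// ltW.
Qed.

Lemma wave_modulus_measurable n : measurable_fun setT (wave_modulus n).
Proof.
have mB := measurable_corner_zone n.
have mA : measurable (corner_zone n `&` layer_zone).
  by apply: measurableI; [exact: mB|exact: measurable_layer_zone].
apply: measurable_funD; last exact: measurable_cst.
by apply: measurable_funD; apply: measurable_funM; try exact: measurable_cst; exact: measurable_indic.
Qed.

(** The leading term lives on the intersection of a strip of measure [O(eps)] with one
    of measure [O(2 ^- n)]; the others have integral [O(d^2 * 2 ^- n)]. *)
Lemma wave_modulus_integral n : (\int[leb2 R]_(p in ch) (wave_modulus n p)%:E <=
  (10 ^+ 5 * Num.min eps (dyad R n))%:E)%E.
Proof.
have mB := measurable_corner_zone n; have mL := measurable_layer_zone.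
have mA : measurable (corner_zone n `&` layer_zone) by exact: measurableI.
have mC := @measurable_channel R.
have mCl : measurable (ch `&` layer_zone) by exact: measurableI.
have mCz : measurable (ch `&` corner_zone n) by exact: measurableI.
have mCA : measurable (ch `&` (corner_zone n `&` layer_zone)) by exact: measurableI.
have z0 := dyad_gt0 R n; have z1 := dyad_le1 R n.
have D2 : d ^+ 2 <= eps ^+ 2 / 256.
  have : d ^+ 2 <= (eps / 16) ^+ 2 by rewrite lerXn2r ?nnegrE// divr_ge0// ltW.
  lra.
have hB := leb2_corner_zone n.
have hA : (leb2 R (ch `&` (corner_zone n `&` layer_zone)) <=
    (160 * 32 * Num.min eps (dyad R n))%:E)%E.
  have [h|h] := leP eps (dyad R n).
    apply: (@le_trans _ _ (leb2 R (ch `&` layer_zone))).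
      by apply: le_measure; rewrite ?inE// => p [? []].
    by apply: le_trans leb2_layer_zone _; rewrite lee_fin; have := eps0; lra.
  apply: (@le_trans _ _ (leb2 R (ch `&` corner_zone n))).
    by apply: le_measure; rewrite ?inE// => p [? []].
  by rewrite -mulrA.
apply: le_trans (integral_channel_indic (k1 := 8) (k2 := 32 * d ^+ 2)
  (k3 := (240 * d) ^+ 2 * dyad R n) mA mB _ _ _ hA hB) _ => //.
- by rewrite mulr_ge0// sqr_ge0.
- by rewrite mulr_ge0 ?sqr_ge0// ltW.
rewrite lee_fin.
have e2 : eps * dyad R n <= Num.min eps (dyad R n).
  rewrite le_min; apply/andP; split; first by rewrite ler_piMr// ltW.
  by rewrite ler_piMl// ltW.
have e3 : d ^+ 2 * dyad R n <= Num.min eps (dyad R n) / 256.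
  apply: (@le_trans _ _ (eps ^+ 2 / 256 * dyad R n)).
    by rewrite ler_wpM2r// ltW.
  have : eps * (eps * dyad R n) <= 1 * (eps * dyad R n).
    by rewrite ler_wpM2r ?mulr_ge0// ltW.
  by lra.
have m0 : 0 <= Num.min eps (dyad R n) by rewrite le_min !ltW.
move: e3 m0; set m := Num.min _ _ => e3 m0; lra.
Qed.

Lemma wave_g_gagliardo i (s th : R) : 0 < s -> 0 <= th -> 2 * s < 1 - th ->
  (gagliardo_sq s (G i) <=
    (96 * (10 ^+ 5 * eps `^ th) / (1 - 4 `^ s * 2^-1 `^ (1 - th)))%:E)%E.
Proof.
move=> s0 th0 sth.
apply: (gagliardo_dyadic (Th := wave_modulus)) => //.
- by apply: mulr_ge0; [exact: exprn_ge0|exact: powR_ge0].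
- exact: half_powR_lt1.
- exact: measurable_wave_g alpha0 eps0 eps1 cf bf d16 i.
- exact: wave_modulus_measurable.
- exact: wave_modulus_ge0.
- by move=> n p q cp cq h; exact: wave_g_increment.
move=> n; apply: le_trans (wave_modulus_integral n) _.
rewrite lee_fin -dyad_powR -mulrA; apply: ler_wpM2l; first exact: exprn_ge0.
apply: min_interpolation => //; last exact: dyad_gt0.
by rewrite th0/=; lra.
Qed.

Lemma wave_g_L2sq i : (L2sq (G i) <= (100 * eps)%:E)%E.
Proof.
have mL := measurable_layer_zone; have mC := @measurable_channel R.
have D2 : d ^+ 2 <= eps / 256.
  have h1 : d ^+ 2 <= (eps / 16) ^+ 2 by rewrite lerXn2r ?nnegrE// divr_ge0// ltW.
  have : eps * eps <= eps * 1 by rewrite ler_wpM2l// ltW.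
  by move: h1; rewrite expr2; lra.
have := integral_channel_indic (k1 := 4) (k2 := 0) (k3 := (4 * d) ^+ 2) mL mL
  (ler0n _ _) (lexx _) (sqr_ge0 _) leb2_layer_zone leb2_layer_zone.
move=> h; apply: le_trans _ (le_trans h _); last first.
  by rewrite lee_fin; have := eps0; lra.
apply: ge0_le_integral => //.
- by move=> p _; rewrite lee_fin sqr_ge0.
- apply/measurable_EFinP; apply: measurable_funX.
  exact: measurable_funS (measurable_wave_g alpha0 eps0 eps1 cf bf d16 i).
- apply/measurable_EFinP; apply: measurable_funD; last exact: measurable_cst.
  by apply: measurable_funD; apply: measurable_funM; try exact: measurable_cst; exact: measurable_indic.
move=> p _; rewrite lee_fin mul0r addr0 indicE.
have -> : (p \in layer_zone) = (a <= `|L p| <= b) by apply/idP/idP; rewrite inE.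
have g := wave_g_le eps0 eps1 bf d16 i p.
have g2 : (G i p) ^+ 2 <= (if a <= `|L p| <= b then 2 else 4 * d) ^+ 2.
  rewrite -real_normK ?num_real// lerXn2r ?nnegrE//; case: ifP => _ //.
  exact: mulr_ge0.
have d2 : 0 <= (4 * d) ^+ 2 by exact: sqr_ge0.
by move: g2; case: ifP => _ g2; rewrite ?mulr1 ?mulr0; lra.
Qed.

Lemma measurable_wave_u : measurable_fun setT U.
Proof. exact: lipschitz_plane_measurable (wave_u_lipschitz eps0 eps1 cf bf d16). Qed.

Lemma wave_u_increment n p q : ch p -> ch q -> distT p q <= 8 * dyad R n ->
  (U p - U q) ^+ 2 <= (100 * Num.min eps (dyad R n)) ^+ 2.
Proof.
move=> cp cq pq; have z0 := dyad_gt0 R n.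
have [k [kper k1 k2]] := channel_shift cp cq pq.
pose q' : R * R := (q.1 + k, q.2).
have EU : U q' = U q.
  by apply: shift_periodic kper; exact: wave_u_periodic eps0 eps1 cf bf d16.
have h1 := wave_u_lipschitz eps0 eps1 cf bf d16 p q'.
have u1 := wave_u_le eps0 eps1 cf bf d16 p.
have u2 := wave_u_le eps0 eps1 cf bf d16 q.
have u3 := ler_normB (U p) (U q).
rewrite -[X in X <= _]real_normK ?num_real// lerXn2r ?nnegrE//.
  by rewrite mulr_ge0// le_min !ltW.
have e0 := eps0; have [h|h] := leP eps (dyad R n); first by lra.
by move: h1; rewrite EU /q'/=; lra.
Qed.

Lemma integral_channel_cst (c : R) : 0 <= c -> (\int[leb2 R]_(p in ch) c%:E <= (16 * c)%:E)%E.
Proof.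
move=> c0; rewrite (@integral_cst _ _ R (leb2 R) ch (@measurable_channel R)) mulrC EFinM.
by apply: lee_wpmul2l; [rewrite lee_fin|exact: leb2_channel_le].
Qed.

Lemma wave_u_gagliardo (s th : R) : 0 < s -> 0 <= th -> s < 1 - th ->
  (gagliardo_sq s U <=
    (96 * (16 * 100 ^+ 2 * (eps `^ th) ^+ 2) / (1 - 4 `^ s * (2^-1 `^ (1 - th)) ^+ 2))%:E)%E.
Proof.
move=> s0 th0 sth.
apply: (gagliardo_dyadic (Th := fun n p => (100 * Num.min eps (dyad R n)) ^+ 2)) => //.
- by rewrite mulr_ge0 ?sqr_ge0// mulr_ge0 ?sqr_ge0.
- by rewrite -powR_mulrn ?powR_ge0// -powRrM; apply: half_powR_lt1; lra.
- exact: measurable_wave_u.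
- by move=> n p; exact: sqr_ge0.
- by move=> n p q cp cq h; rewrite -[leLHS]addr0 lerD ?sqr_ge0//; exact: wave_u_increment.
move=> n; apply: le_trans (integral_channel_cst (sqr_ge0 _)) _.
have m0 : 0 <= Num.min eps (dyad R n) by rewrite le_min !ltW// dyad_gt0.
have th1 : 0 <= th <= 1 by rewrite th0/=; lra.
have h := min_interpolation th1 eps0 (dyad_gt0 R n).
have : (Num.min eps (dyad R n)) ^+ 2 <= (eps `^ th * dyad R n `^ (1 - th)) ^+ 2.
  by rewrite lerXn2r ?nnegrE// mulr_ge0 ?powR_ge0.
rewrite lee_fin [((_ `^ _) ^+ 2) ^+ n]exprAC -dyad_powR.
set x := _ `^ th; set y := _ `^ _; set m := Num.min _ _; rewrite !exprMn.
lra.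
Qed.

Lemma wave_u_L2sq : (L2sq U <= (144 * eps)%:E)%E.
Proof.
have mC := @measurable_channel R; have e1 := eps1; have e0 := eps0.
apply: (@le_trans _ _ (\int[leb2 R]_(p in ch) ((3 * eps) ^+ 2)%:E)%E).
  apply: ge0_le_integral => //.
  - by move=> p _; rewrite lee_fin sqr_ge0.
  - apply/measurable_EFinP; apply: measurable_funX.
    exact: measurable_funS measurable_wave_u.
  move=> p _; rewrite lee_fin -[X in X <= _]real_normK ?num_real// lerXn2r ?nnegrE//.
    by rewrite mulr_ge0// ltW.
  exact: (wave_u_le eps0 eps1 cf bf d16).
apply: le_trans (integral_channel_cst (sqr_ge0 _)) _.
have : eps * eps <= eps * 1 by rewrite ler_wpM2l// ltW.
by rewrite lee_fin; lra.
Qed.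
End WaveEstimates.

(** * Sobolev norm of the perturbation *)

Section SobolevWave.
Variable R : realType.
Local Notation ch := (@channel R).
Implicit Types (p : R * R) (eps s th : R).

Lemma eps_le_powR eps th : 0 < eps -> eps < 1 -> th <= 1 -> eps <= eps `^ th.
Proof. by move=> e0 e1 t1; apply: ger1_powR => //; rewrite e0 ltW. Qed.

Lemma slobodeckij_sq_le eps s th (c C : R) u : 0 < eps -> eps < 1 -> th <= 1 ->
  0 <= s -> 0 <= c -> 0 <= C -> (L2sq u <= (c * eps)%:E)%E ->
  (0 < s -> (gagliardo_sq s u <= (C * eps `^ th)%:E)%E) ->
  (slobodeckij_sq s u <= ((c + C) * eps `^ th)%:E)%E.
Proof.
move=> e0 e1 t1 s0 c0 C0 hL hG; rewrite /slobodeckij_sq mulrDl EFinD; apply: leeD.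
  by apply: le_trans hL _; rewrite lee_fin ler_wpM2l// eps_le_powR.
case: ifPn => [_|sn]; first by rewrite lee_fin mulr_ge0// powR_ge0.
by apply: hG; rewrite lt_neqAle eq_sym sn.
Qed.

(** The midpoint of the admissible exponents: [0 < th < 1 - gamma] when the increments
    of the function itself are interpolated, [0 < th < 1 - 2 (gamma - 1)] for those of
    its gradient. *)
Definition rate (gamma : R) : R := if gamma < 1 then (1 - gamma) / 2 else (3 - 2 * gamma) / 2.

Lemma wave_Hnorm_sq (gamma : R) : 0 <= gamma < 3 / 2 ->
  exists K : R, 0 <= K /\ forall (alpha eps : R) f d, 2^-1 <= alpha < 1 -> 0 < eps -> eps < 1 ->
    C1alpha_0even alpha eps f -> C1alpha_bounded alpha eps f d -> d <= eps / 16 ->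
    (Hnorm_sq gamma (wave_u eps f) <= (K * eps `^ rate gamma)%:E)%E.
Proof.
move=> /andP[g0 g32]; rewrite /Hnorm_sq /rate; have [g1|g1] := ltP gamma 1.
  set th := (1 - gamma) / 2; have th0 : 0 <= th by rewrite /th; lra.
  pose C := 96 * (16 * 100 ^+ 2) / (1 - 4 `^ gamma * (2^-1 `^ (1 - th)) ^+ 2).
  have sth : gamma < 1 - th by rewrite /th; lra.
  have y0 : 0 <= (1 - 4 `^ gamma * (2^-1 `^ (1 - th)) ^+ 2)^-1.
    rewrite invr_ge0 subr_ge0 -powR_mulrn ?powR_ge0// -powRrM ltW//.
    by apply: half_powR_lt1; lra.
  have C0 : 0 <= C by rewrite /C mulr_ge0// mulr_ge0// mulr_ge0 ?sqr_ge0.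
  exists (144 + C); split; first by rewrite addr_ge0.
  move=> alpha eps f d al e0 e1 cf bf dd; apply: slobodeckij_sq_le => //.
  - by rewrite /th; lra.
  - exact: wave_u_L2sq e0 e1 cf bf dd.
  move=> s0; apply: le_trans (wave_u_gagliardo e0 e1 cf bf dd s0 th0 sth) _.
  rewrite lee_fin /C; set x := eps `^ th; move: y0; set y := _^-1 => y0.
  have x2 : x ^+ 2 <= x.
    rewrite expr2 ler_piMl ?powR_ge0//.
    by rewrite -[leRHS](powRr0 eps); apply: ger_powR => //; rewrite e0 ltW.
  have : x ^+ 2 * y <= x * y by exact: ler_wpM2r.
  lra.
pose s := gamma - 1; set th := (3 - 2 * gamma) / 2.
have th0 : 0 <= th by rewrite /th; lra.
have sth : 2 * s < 1 - th by rewrite /th /s; lra.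
have s0 : 0 <= s by rewrite subr_ge0.
pose C := 96 * 10 ^+ 5 / (1 - 4 `^ s * 2^-1 `^ (1 - th)).
have C0 : 0 <= C.
  apply: divr_ge0; first by apply: mulr_ge0 => //; exact: exprn_ge0.
  by rewrite subr_ge0 ltW// half_powR_lt1.
exists (144 + 2 * (100 + C)); split; first by rewrite addr_ge0 ?mulr_ge0 ?addr_ge0.
move=> alpha eps f d al e0 e1 cf bf dd.
have th1 : th <= 1 by rewrite /th; lra.
have al0 : 0 < alpha by lra.
have hg i : (slobodeckij_sq s (wave_g eps i f) <= ((100 + C) * eps `^ th)%:E)%E.
  apply: slobodeckij_sq_le => //; first exact: wave_g_L2sq al e0 e1 cf bf dd i.
  move=> sp; apply: le_trans (wave_g_gagliardo al e0 e1 cf bf dd i sp th0 sth) _.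
  by rewrite lee_fin /C; lra.
rewrite mulrDl EFinD; apply: leeD.
  apply: le_trans (wave_u_L2sq e0 e1 cf bf dd) _.
  by rewrite lee_fin ler_wpM2l// eps_le_powR.
apply: (@le_trans _ _ (slobodeckij_sq s (wave_g eps false f) + slobodeckij_sq s (wave_g eps true f))%E).
  apply: ereal_inf_lbound; exists (wave_g eps false f, wave_g eps true f) => //=.
  by split; exact: wave_weak_partial al0 e0 e1 cf bf dd _.
have -> : 2 * (100 + C) * eps `^ th = (100 + C) * eps `^ th + (100 + C) * eps `^ th by ring.
by rewrite EFinD; apply: leeD.
Qed.

(** Everything in the norm is an integral over the channel. *)
Lemma Hnorm_eq_on_channel (gamma : R) u v : (forall p, ch p -> u p = v p) ->
  Hnorm gamma u = Hnorm gamma v.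
Proof.
move=> uv.
have uv2 p : p \in ch -> u p = v p by rewrite inE; exact: uv.
have mE : measurable_fun ch u = measurable_fun ch v.
  apply/propext; split; apply: eq_measurable_fun => p pc; first exact: uv2.
  by rewrite uv2.
have LE : L2sq u = L2sq v by apply: eq_integral => p pc; rewrite uv2.
have GE s : gagliardo_sq s u = gagliardo_sq s v.
  by apply: eq_integral => z; rewrite inE => -[z1 z2]; rewrite !uv.
have WE i g : weak_partial i u g = weak_partial i v g.
  have half u' v' : (forall p, ch p -> u' p = v' p) -> weak_partial i u' g -> weak_partial i v' g.
    move=> uv' [iu ig H]; split => //.
      apply: eq_integrable iu; first exact: measurable_channel.
      by move=> p; rewrite inE => pc; rewrite /= uv'.
    move=> eta te; rewrite -H//; apply: eq_Rintegral => p; rewrite inE => pc.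
    by rewrite uv'.
  by apply/propext; split; apply: half => // p pc; rewrite uv.
rewrite /Hnorm mE /Hnorm_sq /slobodeckij_sq LE GE /weak_grad_sq.
by under eq_set do rewrite !WE.
Qed.

Lemma slobodeckij_sq_ge0 s u : (0%R <= slobodeckij_sq s u)%E.
Proof.
rewrite /slobodeckij_sq adde_ge0//.
  by apply: integral_ge0 => p _; rewrite lee_fin sqr_ge0.
case: ifP => // _; apply: integral_ge0 => z _.
by rewrite lee_fin divr_ge0 ?sqr_ge0 ?powR_ge0.
Qed.

Lemma Hnorm_sq_ge0 (gamma : R) u : (0%R <= Hnorm_sq gamma u)%E.
Proof.
rewrite /Hnorm_sq; case: ifP => _; first exact: slobodeckij_sq_ge0.
rewrite adde_ge0//; first by apply: integral_ge0 => p _; rewrite lee_fin sqr_ge0.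
by apply: le_ereal_inf_tmp => _ [g _ <-]; rewrite adde_ge0 ?slobodeckij_sq_ge0.
Qed.

Lemma Hnorm_lt (gamma e : R) u : measurable_fun setT u -> 0 < e ->
  (Hnorm_sq gamma u < (e ^+ 2)%:E)%E -> (Hnorm gamma u < e%:E)%E.
Proof.
move=> mu e0 h; rewrite /Hnorm; case: asboolP => [_|]; last first.
  by case; exact: measurable_funS mu.
have := Hnorm_sq_ge0 gamma u; move: h; case: (Hnorm_sq _ _) => [r| |]//.
rewrite !lte_fin lee_fin => re r0.
have -> : e = (e ^+ 2) `^ 2^-1 by rewrite powR12_sqrt ?sqr_ge0// sqrtr_sqr gtr0_norm.
by apply: gt0_ltr_powR; rewrite ?invr_gt0// nnegrE ?sqr_ge0.
Qed.
End SobolevWave.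

(** * Small waves on the branch *)

Section SmallBranch.
Variables (R : realType) (alpha eps : R).
Implicit Types (p q : R * R) (i : bool).
Hypotheses (eps0 : 0 < eps) (eps1 : eps < 1).

Lemma Omega_int_nonempty : Omega_int eps (0, ya eps / 2).
Proof. by rewrite /Omega_int /ya /=; apply/orP; left; have := eps0; have := eps1; lra. Qed.

Lemma sup_norm_ge0 (D : set (R * R)) f p : D p -> (0%R <= sup_norm D f)%E.
Proof.
move=> Dp; apply: (@le_trans _ _ (`|f p|)%:E); first by rewrite lee_fin.
by apply: ereal_sup_ubound; exists p.
Qed.

Lemma holder_seminorm_ge0 (D : set (R * R)) f p : D p -> (0%R <= holder_seminorm alpha D f)%E.
Proof.
move=> Dp; apply: (@le_trans _ _ (`|f p - f p| / dist2 p p `^ alpha)%:E).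
  by rewrite lee_fin divr_ge0 ?powR_ge0.
by apply: ereal_sup_ubound; exists p => //; exists p.
Qed.

Lemma dist2_eq0 p q : dist2 p q = 0 -> p = q.
Proof.
move=> /eqP; rewrite sqrtr_eq0 => h.
have := sqr_ge0 (p.1 - q.1); have := sqr_ge0 (p.2 - q.2) => h1 h2.
rewrite [p]surjective_pairing [q]surjective_pairing; congr (_, _); apply/eqP; rewrite -subr_eq0 -sqrf_eq0; apply/eqP; lra.
Qed.

Lemma holder_seminorm_bound (D : set (R * R)) f (d : R) p q : D p -> D q ->
  (holder_seminorm alpha D f <= d%:E)%E -> `|f p - f q| <= d * dist2 p q `^ alpha.
Proof.
move=> Dp Dq h; have [/dist2_eq0 ->|dn] := eqVneq (dist2 p q) 0.
  rewrite subrr normr0 mulr_ge0 ?powR_ge0// -lee_fin.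
  by apply: le_trans h; exact: holder_seminorm_ge0 Dp.
have d0 : 0 < dist2 p q by rewrite lt_neqAle eq_sym dn sqrtr_ge0.
rewrite -ler_pdivrMr ?powR_gt0// -lee_fin; apply: le_trans h.
by apply: ereal_sup_ubound; exists p => //; exists q.
Qed.

Lemma ge0_sum5_le (s1 s2 s3 s4 s5 d : \bar R) :
  (0%R <= s1)%E -> (0%R <= s2)%E -> (0%R <= s3)%E -> (0%R <= s4)%E -> (0%R <= s5)%E ->
  (s1 + s2 + s3 + s4 + s5 <= d)%E ->
  [/\ (s1 <= d)%E, (s2 <= d)%E, (s3 <= d)%E, (s4 <= d)%E & (s5 <= d)%E].
Proof.
move=> n1 n2 n3 n4 n5 h.
have t2 := adde_ge0 n1 n2; have t3 := adde_ge0 t2 n3; have t4 := adde_ge0 t3 n4.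
have k5 := le_trans (leeDr s5 t4) h; have k4 := le_trans (leeDl (s1 + s2 + s3 + s4)%E n5) h.
have k4' := le_trans (leeDr s4 t3) k4; have k3 := le_trans (leeDl (s1 + s2 + s3)%E n4) k4.
have k3' := le_trans (leeDr s3 t2) k3; have k2 := le_trans (leeDl (s1 + s2)%E n3) k3.
have k2' := le_trans (leeDr s2 n1) k2; have k1 := le_trans (leeDl s1 n2) k2.
by [].
Qed.

Lemma C1alpha_norm_bounded f (d : R) : (C1alpha_norm alpha eps f <= d%:E)%E ->
  C1alpha_bounded alpha eps f d.
Proof.
have o := Omega_int_nonempty.
have O : Omega eps (0, ya eps / 2).
  move: o; rewrite /Omega_int /Omega /outer /= => /orP[] /andP[h1 h2].
    by rewrite h2 ltW.
  by rewrite h1 (ltW h2) orbT.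
rewrite /C1alpha_norm.
have n1 := sup_norm_ge0 f O.
have n2 := sup_norm_ge0 (dx f) o; have n3 := sup_norm_ge0 (dy f) o.
have n4 := holder_seminorm_ge0 (dx f) o; have n5 := holder_seminorm_ge0 (dy f) o.
move=> /(ge0_sum5_le n1 n2 n3 n4 n5)[h1 h2 h3 h4 h5].
split.
- move=> p Dp; rewrite -lee_fin; apply: le_trans h1.
  by apply: ereal_sup_ubound; exists p.
- move=> p [] Dp; rewrite -lee_fin; [apply: le_trans h3|apply: le_trans h2];
  by apply: ereal_sup_ubound; exists p.
- by move=> p q [] Dp Dq; [exact: holder_seminorm_bound h5|exact: holder_seminorm_bound h4].
Qed.

Lemma C1alpha_bounded_le f (d d' : R) : d <= d' -> C1alpha_bounded alpha eps f d ->
  C1alpha_bounded alpha eps f d'.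
Proof.
move=> dd' [h1 h2 h3]; split => [p Dp|p i Dp|p q i Dp Dq].
- exact: le_trans (h1 _ Dp) dd'.
- exact: le_trans (h2 _ _ Dp) dd'.
- by apply: le_trans (h3 _ _ _ Dp Dq) _; rewrite ler_wpM2r ?powR_ge0.
Qed.

Lemma C1alpha_bounded_combination f h (s d H : R) :
  (forall p i, Omega_int eps p -> derivable f p (dir R i)) ->
  (forall p i, Omega_int eps p -> derivable h p (dir R i)) ->
  C1alpha_bounded alpha eps (fun p => f p - s * h p) d ->
  C1alpha_bounded alpha eps h H ->
  C1alpha_bounded alpha eps f (d + `|s| * H).
Proof.
move=> df dh [g1 g2 g3] [h1 h2 h3].
have split_norm (x y u v : R) : `|x - s * y| <= u -> `|y| <= v -> `|x| <= u + `|s| * v.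
  move=> xu yv; rewrite -[x](subrK (s * y)); apply: le_trans (ler_normD _ _) _.
  by apply: lerD => //; rewrite normrM ler_wpM2l.
have D p i : Omega_int eps p ->
    'D_(dir R i) (fun p => f p - s * h p) p = 'D_(dir R i) f p - s * 'D_(dir R i) h p.
  move=> Dp; have F := derivableP (df p i Dp); have H1 := derivableP (dh p i Dp).
  have E := @is_deriveB _ _ _ f (s \*: h) p (dir R i) _ _ F (@is_deriveZ _ _ _ h s p _ _ H1).
  exact: (@derive_val _ _ _ _ _ _ _ E).
split => [p Dp|p i Dp|p q i Dp Dq].
- by apply: split_norm; [exact: g1|exact: h1].
- by apply: (split_norm _ ('D_(dir R i) h p)); [rewrite -D//; exact: g2|exact: h2].
rewrite mulrDl -mulrA.
apply: (split_norm _ ('D_(dir R i) h p - 'D_(dir R i) h q)); last exact: h3.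
have := g3 _ _ i Dp Dq; rewrite !D//; congr (_ <= _); congr (`| _ |); ring.
Qed.

(** [f s] is the sum of [s * hstar], of norm [O(s)], and of a remainder whose norm is
    at most [s] for small [s]. *)
Lemma branch_small_C1alpha lamstar hstar (sig0 : R) f lam (delta : R) :
  bifurcation_branch alpha eps lamstar hstar sig0 f lam -> 0 < delta ->
  exists s : R, 0 < s < sig0 /\ C1alpha_bounded alpha eps (f s) delta.
Proof.
move=> B delta0; have C := hstar_C1a B.
have [H H0 bH] : exists2 H : R, 0 <= H & C1alpha_bounded alpha eps hstar H.
  have := C1a_norm C; case E : (C1alpha_norm alpha eps hstar) => [H| |]// _.
    have bH : C1alpha_bounded alpha eps hstar H by apply: C1alpha_norm_bounded; rewrite E.
    by exists H => //; exact: C1alpha_bounded_ge0 eps0 eps1 bH.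
  have b0 : C1alpha_bounded alpha eps hstar 0.
    by apply: C1alpha_norm_bounded; rewrite E leNye.
  by exists 0.
have [r /= r0 Hr] := branch_f_asymp B ltr01.
have s0 := sig0_gt0 B.
have H1 : 0 < 1 + H by exact: ltr_pwDl.
pose s := Num.min (r / 2) (Num.min (sig0 / 2) (delta / (1 + H))).
have sp : 0 < s by rewrite !lt_min !divr_gt0.
have sr : s < r.
  by apply: (@le_lt_trans _ _ (r / 2)); [rewrite ge_min lexx|lra].
have ss : s < sig0.
  by apply: (@le_lt_trans _ _ (sig0 / 2)); [rewrite !ge_min lexx orbT|lra].
have sd : s * (1 + H) <= delta by rewrite -ler_pdivlMr// !ge_min lexx !orbT.
exists s; split; first by rewrite sp.
have := Hr s; rewrite /= sub0r normrN (gtr0_norm sp) mul1r => /(_ sr (lt0r_neq0 sp)) N.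
have bg := C1alpha_norm_bounded N.
have sl : `|s| < sig0 by rewrite gtr0_norm.
apply: C1alpha_bounded_le (C1alpha_bounded_combination (C1a_derivable (branch_C1a B sl))
  (C1a_derivable C) bg bH).
by rewrite gtr0_norm//; lra.
Qed.
End SmallBranch.

Section Conclusion.
Variable R : realType.

Lemma rate_gt0 (gamma : R) : gamma < 3 / 2 -> 0 < rate gamma.
Proof. by move=> g; rewrite /rate; case: ifPn => [g1|_]; rewrite divr_gt0// subr_gt0//; lra. Qed.

Lemma small_eps (K th e eps0 : R) : 0 <= K -> 0 < th -> 0 < e -> 0 < eps0 ->
  exists eps : R, [/\ 0 < eps, eps < 1, eps < eps0 & K * eps `^ th < e].
Proof.
move=> K0 th0 e0 E0; have K1 : 0 < K + 1 by lra.
pose x := e / (K + 1); have x0 : 0 < x by rewrite divr_gt0.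
pose eps := Num.min (eps0 / 2) (Num.min 2^-1 (x `^ th^-1)).
have p0 : 0 < eps.
  rewrite /eps !lt_min; apply/and3P; split; [exact: divr_gt0|by rewrite invr_gt0|exact: powR_gt0].
exists eps; split => //.
- by apply: (@le_lt_trans _ _ 2^-1); [rewrite !ge_min lexx orbT|lra].
- by apply: (@le_lt_trans _ _ (eps0 / 2)); [rewrite !ge_min lexx|lra].
have h : eps `^ th <= x.
  rewrite -[leRHS](powRr1 (ltW x0)) -(mulVf (lt0r_neq0 th0)) powRrM.
  apply: ge0_ler_powR; rewrite ?nnegrE ?(ltW th0) ?(ltW p0) ?powR_ge0//.
  by rewrite !ge_min lexx !orbT.
apply: (@le_lt_trans _ _ (K * x)); first by rewrite ler_wpM2l.
have : (K + 1) * x = e by rewrite /x mulrCA mulfV ?mulr1// gt_eqF.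
lra.
Qed.

Lemma vorticity_wave_u (alpha eps d : R) f w p : 0 < eps -> eps < 1 ->
  C1alpha_0even alpha eps f -> C1alpha_bounded alpha eps f d -> d <= eps / 16 ->
  wave_vorticity eps f w -> channel p -> w p + 2 * p.2 = wave_u eps f p.
Proof.
move=> e0 e1 cf bf dd hw cp; rewrite /wave_u; congr (_ + _).
have L1 := wave_label_le1 e0 e1 cf bf dd cp.
rewrite -(vorticity_label e0 e1 cf bf dd hw p.1 (y := wave_label eps f p)).
  by rewrite (wave_labelP e0 e1 cf bf dd) -surjective_pairing.
by rewrite -ler_norml.
Qed.
End Conclusion.

Theorem theorem10p2 (R : realType) (alpha : R) (halpha : 2^-1 <= alpha < 1)
    (eps0 : R) (heps0 : 0 < eps0)
    (lamstar : R -> R) (hstar : R -> R * R -> R) (sig0 : R -> R)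
    (f : R -> R -> R * R -> R) (lam : R -> R -> R)
    (hbranch : forall eps : R, 0 < eps < eps0 ->
       bifurcation_branch alpha eps (lamstar eps) (hstar eps) (sig0 eps)
         (f eps) (lam eps))
    (w : R -> R -> R * R -> R)
    (hw : forall eps s : R, 0 < eps < eps0 -> `|s| < sig0 eps ->
       wave_vorticity eps (f eps s) (w eps s))
    (gamma : R) (hgamma : 0 <= gamma < 3 / 2)
    (e : R) (he : 0 < e) :
  exists eps s : R, [/\ 0 < eps < eps0, 0 < s < sig0 eps &
    (Hnorm gamma (fun p => w eps s p + 2 * p.2)%R < e%:E)%E].
Proof.
have [K [K0 HK]] := wave_Hnorm_sq hgamma.
have r0 : 0 < rate gamma by apply: rate_gt0; have /andP[] := hgamma.
have e2 : 0 < e ^+ 2 by rewrite exprn_gt0.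
have [eps [p0 p1 pe Ke]] := small_eps K0 r0 e2 heps0.
have pe' : 0 < eps < eps0 by rewrite p0.
have [s [/andP[s0 ss] bs]] := branch_small_C1alpha p0 p1 (hbranch _ pe')
  (divr_gt0 p0 (ltr0n R 16)).
have sl : `|s| < sig0 eps by rewrite gtr0_norm.
have cf := branch_C1a (hbranch _ pe') sl.
exists eps, s; split => //; first by rewrite s0.
rewrite (@Hnorm_eq_on_channel _ gamma _ (wave_u eps (f eps s))).
  apply: Hnorm_lt => //; first exact: measurable_wave_u p0 p1 cf bs (lexx _).
  by apply: le_lt_trans (HK _ _ _ _ halpha p0 p1 cf bs (lexx _)) _; rewrite lte_fin.
by move=> p; exact: vorticity_wave_u p0 p1 cf bs (lexx _) (hw _ _ pe' sl).
Qed.
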